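(* Let $\psi:\mathbb{R}^2\to\mathbb{R}$ be Lipschitz and $\phi:\mathbb{R}^4\to\mathbb{R}$ be bounded and Lipschitz, and let $T>0$. Let $\{N_n\}_{n\in\mathbb{N}}$ be a sequence of finite networks (with edge marks in $\mathbb{R}_+$ and vertex marks in $\mathbb{R}\times\mathbb{R}$), where $N_n$ has vertex set $[n]$. Assume: 1. $U(N_n)\to\nu$ weakly in $\mathcal{P}(\mathcal{N}^* )$ for some $\nu\in\mathcal{P}(\mathcal{N}^* )$. 2. $\nu$ is supported on nice rooted networks, i.e. $\nu(\mathcal{B}^* )=1$. 3. $\max_{v\in[n]}d_v^{N_n}=n^{\epsilon_n}$ where $\epsilon_n\to0$ as $n\to+\infty$. Let $k\in\mathbb{N}$ and let $f_1,\dots,f_k:\mathcal{C}^*\to\mathbb{R}$ satisfy $\|f_i\|_{BL}\le1$ for all $1\le i\le k$. Let $(\mathsf{N}_1,o_1),\dots,(\mathsf{N}_k,o_k)$ be i.i.d. rooted networks with law $\nu$. Then $$\lim_{n\to\infty}\mathbb{E}\left[\prod_{i=1}^kU(N_n^{\theta})(f_i)\right]=\prod_{i=1}^k\mathbb{E}\left[f_i(\mathsf{N}_i^\theta,o_i)\right].$$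
   Context: Graphs $G=(V,E)$ are undirected, locally finite, with finite or countable vertex set (which may be taken as a subset of $\mathbb{N}$); loops are allowed; $d_v$ denotes the degree and $[n]=\{1,\dots,n\}$. A network $N=(G,\boldsymbol{\mu},\boldsymbol{\omega},\boldsymbol{\theta}(0))$ is a graph $G=(V,E)$ with edge weights $\mu_e\in\mathbb{R}_+=(0,\infty)$ ($e\in E$), media variables $\omega_v\in\mathbb{R}$ and initial conditions $\theta_v(0)\in\mathbb{R}$ ($v\in V$). Put $\mu_{uv}=\mu_{vu}=\mu_e$ if $e=\{u,v\}\in E$, $\mu_{uv}=0$ otherwise, and $\mu_v=\sum_u\mu_{uv}$. Let $(B_v)_{v\in\mathbb{N}}$ be i.i.d. standard Brownian motions. The system of interacting diffusions on $N$ is the strong solution $\boldsymbol{\theta}^N(\cdot)=(\theta^N_v(\cdot))_{v\in V}$ on $[0,T]$ of $$\mathrm{d}\theta_{v}(t)= \frac{1}{\mu_v}\sum_{u \in V}\mu_{uv}\,\phi(\theta_{u}(t),\theta_{v}(t);\omega_v,\omega_u)\,\mathrm{d}t+\psi(\theta_{v}(t);\omega_v)\,\mathrm{d}t + \mathrm{d}B_v(t),\qquad v\in V,$$ with initial conditions $\theta_v(0)$ (the first term on the right is $0$ if $\mu_v=0$). It exists and is unique for every $N$ with $(N,o)$ nice (defined below), in particular for finite $N$. $N^\theta=(G,\boldsymbol{\mu},\boldsymbol{\omega},\boldsymbol{\theta}^N(\cdot))$ is the random network in which the marks $(\omega_v,\theta_v(0))$ are replaced by $(\omega_v,\theta^N_v(\cdot))\in\mathbb{R}\times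 C([0,T];\mathbb{R})$. The expectation on the left of the claim is over the Brownian motions; those on the right are over the choice of $(\mathsf{N}_i,o_i)$ and over Brownian motions independent of it. $\mathcal{N}^*$ is the set of rooted-isomorphism classes of rooted connected networks $(N,o)$ with edge marks in $\mathbb{R}_+$ and vertex marks in $\mathbb{R}\times\mathbb{R}$; $\mathcal{C}^*$ is the analogous set with vertex marks in $\mathbb{R}\times C([0,T];\mathbb{R})$ (sup norm on $C([0,T];\mathbb{R})$, a product metric on vertex marks, usual distance on edge marks). A rooted isomorphism is a bijection of vertices preserving edges, marks and the root. $(N,o)_r$ is the rooted network induced by the vertices within graph distance $r$ of $o$. For $r\in\{0,1,2,\dots\}$ and $\delta>0$, $(r,\delta)$ is good for $(N,o),(N',o')$ if there is a root-preserving graph isomorphism between $(N,o)_r$ and $(N',o')_r$ under which corresponding vertex marks and corresponding edge marks are at distance $<\delta$. The distance between $[N,o]$ and $[N',o']$ is $\inf\{\frac{1}{1+r}+\delta:(r,\delta)\text{ is good}\}$. $\mathcal{P}(\cdot)$ denotes Borel probability measures with the weak topology. For a real function $h$ on a metric space, $\|h\|_{BL}=\|h\|_\infty+\|h\|_{Lip}$, with $\|h\|_{Lip}$ the best Lipschitz constant. For a finite network $N$ with vertex set $V$, $U(N)=\frac1{|V|}\sum_{v\in V}\delta_{[N(v),v]}$, where $N(v)$ is the network induced by the connected component of $v$; for a measure $m$, $m(f)=\int f\,\mathrm{d}m$. $(N,o)$, with underlying rooted graph $(G,o)$, is nice if (1) there is $a>0$ with $|\partial(G,o)_r|\le ae^{ar}$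 for all $r\ge1$, where $\partial(G,o)_r$ is the set of vertices of the ball $(G,o)_r$ having a neighbor outside it; and (2) $0<\inf_e\mu_e$ and $\sup_e\mu_e<\infty$ (automatic if there are no edges). $\mathcal{B}^*\subset\mathcal{N}^*$ is the Borel set of nice rooted networks. *)

(* Defs.v *)
From HB Require Import structures.
From mathcomp Require Import all_boot all_order all_algebra finmap lra.
From mathcomp Require Import all_classical all_reals all_analysis.

Set Implicit Arguments.
Unset Strict Implicit.
Unset Printing Implicit Defensive.

Import Order.TTheory GRing.Theory Num.Theory.
Import numFieldNormedType.Exports.

Local Open Scope classical_set_scope.
Local Open Scope ring_scope.

(* The values of [mark] off [vertex] carry no information: every notion below
   only looks at marks of vertices. *)
Record network (R : realType) (M : Type) := Network {
  vertex : set nat;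
  edge : rel nat;
  weight : nat -> nat -> R;
  mark : nat -> M;
  edge_sym : symmetric edge;
  edge_vertex : forall u v, edge u v -> vertex u;
  locally_finite : forall v, finite_set [set u | edge v u];
  weight_sym : forall u v, weight u v = weight v u;
  weight_gt0 : forall u v, edge u v -> 0 < weight u v;
  weight0 : forall u v, ~~ edge u v -> weight u v = 0 }.

Section Networks.
Variable R : realType.
Implicit Type M : Type.

(* A loop is counted once. *)
Definition degree M (N : network R M) (v : nat) : nat :=
  #|` fset_set [set u | edge N v u]|.

Definition total_weight M (N : network R M) (v : nat) : R :=
  \sum_(u \in vertex N) weight N u v.

Definition walk M (N : network R M) (u v : nat) (p : seq nat) : Prop :=
  path (edge N) u p /\ last u p = v.

Definition component M (N : network R M) (o : nat) : set nat :=
  [set v | exists p, walk N o v p].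

(* The vertices at graph distance at most [r] from [o]. *)
Definition ball_vertices M (N : network R M) (o r : nat) : set nat :=
  [set v | exists2 p, walk N o v p & (size p <= r)%N].

Definition ball_boundary M (N : network R M) (o r : nat) : set nat :=
  [set v | ball_vertices N o r v /\
           exists2 u, edge N v u & ~ ball_vertices N o r u].

Definition nice M (N : network R M) (o : nat) : Prop :=
  [/\ exists2 a : R, 0 < a & forall r, (1 <= r)%N ->
        #|` fset_set (ball_boundary N o r)|%:R <= a * expR (a * r%:R),
      (0 < ereal_inf [set (weight N uv.1 uv.2)%:E |
                        uv in [set uv | edge N uv.1 uv.2]])%E &
      (ereal_sup [set (weight N uv.1 uv.2)%:E |
                        uv in [set uv | edge N uv.1 uv.2]] < +oo)%E].

Section Induced.
Variables (M : Type) (N : network R M) (A : set nat).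

Let iedge (u v : nat) := [&& u \in A, v \in A & edge N u v].
Let iweight (u v : nat) : R := if iedge u v then weight N u v else 0.

Let iedge_sym : symmetric iedge.
Proof. by move=> u v; rewrite /iedge edge_sym andbCA. Qed.

Let iedge_vertex u v : iedge u v -> A u.
Proof. by case/and3P=> /set_mem. Qed.

Let ifinite v : finite_set [set u | iedge v u].
Proof.
by apply: sub_finite_set (locally_finite N v) => u /= /and3P[].
Qed.

Let iweight_sym u v : iweight u v = iweight v u.
Proof. by rewrite /iweight iedge_sym weight_sym. Qed.

Let iweight_gt0 u v : iedge u v -> 0 < iweight u v.
Proof.
by move=> uv; rewrite /iweight uv; apply: weight_gt0; case/and3P: uv.
Qed.

Let iweight0 u v : ~~ iedge u v -> iweight u v = 0.
Proof. by rewrite /iweight => /negbTE ->. Qed.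

(* Meant for [A] included in [vertex N]. *)
Definition induced : network R M :=
  Network (mark N) iedge_sym iedge_vertex ifinite
    iweight_sym iweight_gt0 iweight0.

End Induced.

Definition set_marks M M' (N : network R M) (mk : nat -> M') : network R M' :=
  Network mk (@edge_sym _ _ N) (@edge_vertex _ _ N) (@locally_finite _ _ N)
    (@weight_sym _ _ N) (@weight_gt0 _ _ N) (@weight0 _ _ N).

Definition graph_iso M (N N' : network R M) (f : nat -> nat) : Prop :=
  set_bij (vertex N) (vertex N') f /\
  forall u v, vertex N u -> vertex N v -> edge N' (f u) (f v) = edge N u v.

Definition connected_network M (N : network R M) : Prop :=
  forall u v, vertex N u -> vertex N v -> component N u v.

Record rnet M := RNet {
  rnet_net :> network R M;
  root : nat;
  root_vertex : vertex rnet_net root;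
  rnet_connected : connected_network rnet_net }.

HB.instance Definition _ M := gen_eqMixin (rnet M).
HB.instance Definition _ M := gen_choiceMixin (rnet M).

Definition rooted_iso M (x y : rnet M) : Prop :=
  exists f : nat -> nat,
    [/\ graph_iso x y f, f (root x) = root y,
        forall v, vertex x v -> mark y (f v) = mark x v &
        forall u v, vertex x u -> vertex x v ->
          weight y (f u) (f v) = weight x u v].

Lemma component_connected M (N : network R M) o :
  connected_network (induced N (component N o)).
Proof.
have from p u : component N o u -> path (edge N) u p ->
    path (edge (induced N (component N o))) u p.
  elim: p u => //= w p IH u [q [qp qu]] /andP[uw wp].
  have ow : component N o w.
    by exists (rcons q w); split; rewrite ?last_rcons// rcons_path qp qu.
  rewrite IH// andbT; apply/and3P; split=> //; apply/mem_set => //.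
  by exists q.
have symN p u v : walk N u v p -> component N v u.
  elim: p u => [|w p IH] u; rewrite /walk/=.
    by move=> [_ <-]; exists [::].
  move=> [/andP[uw wp] lw]; have [q [qp ql]] := IH w (conj wp lw).
  exists (rcons q u); split; rewrite ?last_rcons// rcons_path qp ql.
  by rewrite edge_sym.
move=> u v /= ou [q [qp qv]].
have [p up] := ou; have [p' [p'p p'o]] := symN _ _ _ up.
exists (p' ++ q); split; last by rewrite last_cat p'o.
by apply: from => //; rewrite cat_path p'p p'o.
Qed.

(* The component of [v], rooted at [v]. *)
Definition component_at M (N : network R M) (v : nat) : rnet M :=
  @RNet M (induced N (component N v)) v
    (ex_intro _ [::] (conj isT erefl)) (@component_connected M N v).

Lemma set_marks_connected M M' (N : network R M) (mk : nat -> M') :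
  connected_network N -> connected_network (set_marks N mk).
Proof. by []. Qed.

Definition rset_marks M M' (x : rnet M) (mk : nat -> M') : rnet M' :=
  @RNet M' (set_marks x mk) (root x) (@root_vertex _ x)
    (@set_marks_connected M M' x mk (@rnet_connected _ x)).

Lemma rooted_iso_refl M (x : rnet M) : rooted_iso x x.
Proof.
exists id; split=> //; split=> //; split=> //.
by move=> v xv; exists v.
Qed.

Lemma set_bij_inverse (A B : set nat) (f : nat -> nat) : set_bij A B f ->
  exists g : nat -> nat, [/\ set_bij B A g,
    forall v, A v -> g (f v) = v & forall w, B w -> f (g w) = w].
Proof.
move=> [fAB finj fsurj].
have /choice[g gP] w : exists v, B w -> A v /\ f v = w.
  have [/fsurj[v Av <-]|nB] := pselect (B w); first by exists v.
  by exists 0%N.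
have gf v : A v -> g (f v) = v.
  move=> Av; have [Ag fg] := gP _ (fAB _ Av).
  by apply: finj; rewrite ?inE.
exists g; split=> //; last by move=> w /gP[].
split.
- by move=> w /gP[].
- move=> u w; rewrite !inE => /gP[_ fu] /gP[_ fw] guw.
  by rewrite -fu guw fw.
- by move=> v Av; exists (f v); [exact: fAB|rewrite gf].
Qed.

Lemma rooted_iso_sym M (x y : rnet M) : rooted_iso x y -> rooted_iso y x.
Proof.
move=> [f [[fbij fedge] froot fmark fweight]].
have [g [gbij gf fg]] := set_bij_inverse fbij.
have [gfun _ _] := gbij.
exists g; split=> [|||u v yu yv].
- split=> // u v yu yv.
  by rewrite -fedge ?fg//; exact: gfun.
- by rewrite -froot gf//; exact: root_vertex.
- by move=> v yv; rewrite -fmark ?fg//; exact: gfun.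
- by rewrite -fweight ?fg//; exact: gfun.
Qed.

Lemma rooted_iso_trans M (y x z : rnet M) :
  rooted_iso x y -> rooted_iso y z -> rooted_iso x z.
Proof.
move=> [f [[fbij fedge] froot fmark fweight]].
move=> [g [[gbij gedge] groot gmark gweight]].
have [ffun _ _] := fbij.
exists (g \o f); split=> [|||u v xu xv] /=.
- split; first exact: (set_bij_comp fbij gbij).
  by move=> u v xu xv /=; rewrite gedge ?fedge//; exact: ffun.
- by rewrite froot.
- by move=> v xv; rewrite gmark ?fmark//; exact: ffun.
- by rewrite gweight ?fweight//; exact: ffun.
Qed.

Definition rooted_isob M : rel (rnet M) := fun x y => `[< rooted_iso x y >].

Lemma rooted_isob_equiv M : equiv_class_of (@rooted_isob M).
Proof.
split.
- by move=> x; apply/asboolP; exact: rooted_iso_refl.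
- by move=> x y; apply/asboolP/asboolP; exact: rooted_iso_sym.
- move=> y x z /asboolP xy /asboolP yz; apply/asboolP.
  exact: rooted_iso_trans xy yz.
Qed.

Canonical rooted_iso_rel M := EquivRelPack (@rooted_isob_equiv M).

(* Rooted-isomorphism classes of rooted connected networks with vertex marks
   in [M]. *)
Definition nstar M := {eq_quot (rooted_iso_rel M)}%qT.

HB.instance Definition _ M := Choice.on (nstar M).
HB.instance Definition _ M := EqQuotient.on (nstar M).

Definition nclass M (x : rnet M) : nstar M := (\pi_(nstar M) x)%qT.

Lemma nclassP M (x y : rnet M) : nclass x = nclass y <-> rooted_iso x y.
Proof.
split=> [/eqmodP/asboolP//|xy]; apply/eqmodP; exact/asboolP.
Qed.

Definition nice_class M : set (nstar M) :=
  [set nclass x | x in [set x : rnet M | nice x (root x)]].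

Section Pointed.
Variable M : pointedType.

Lemma single_finite v :
  finite_set [set u | (fun _ _ : nat => false) v u].
Proof. by apply: sub_finite_set (finite_set0 nat) => u. Qed.

Definition single_net : network R M :=
  @Network R M [set 0%N] (fun _ _ => false) (fun _ _ => 0) (fun=> point)
   (fun _ _ => erefl) (fun _ _ (h : false) => match notF h with end)
   single_finite (fun _ _ => erefl)
   (fun _ _ (h : false) => match notF h with end) (fun _ _ _ => erefl).

Lemma single_connected : connected_network single_net.
Proof. by move=> u v /= -> ->; exists [::]. Qed.

HB.instance Definition _ := isPointed.Build (nstar M)
  (nclass (@RNet M single_net 0%N erefl single_connected)).

End Pointed.

Lemma ball_vertices0 M (N : network R M) o : ball_vertices N o 0 = [set o].
Proof.
apply/seteqP; split=> v /=; first by move=> [[|//] [_ /= ->]].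
by move=> ->; exists [::].
Qed.

Lemma ball_verticesS M (N : network R M) o r v :
  ball_vertices N o r.+1 v <->
  v = o \/ exists2 u, ball_vertices N o r u & edge N u v.
Proof.
split=> [[p]|[->|[u [p [op pu] pr] uv]]].
- case/lastP: p => [|p w] [op ow] pr; first by left.
  move: op ow; rewrite rcons_path last_rcons => /andP[op pw] <-.
  right; exists (last o p) => //; exists p => //.
  by move: pr; rewrite size_rcons.
- by exists [::].
- exists (rcons p v); last by rewrite size_rcons.
  by split; rewrite ?last_rcons// rcons_path op pu.
Qed.

Lemma ball_vertices_root M (N : network R M) o r : ball_vertices N o r o.
Proof. by exists [::]. Qed.

Lemma ball_vertices_le M (N : network R M) o r s :
  (r <= s)%N -> ball_vertices N o r `<=` ball_vertices N o s.
Proof. by move=> rs v [p op pr]; exists p => //; exact: leq_trans rs. Qed.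

Lemma rnet_ball_vertex M (x : rnet M) r v :
  ball_vertices x (root x) r v -> vertex x v.
Proof.
case: r => [|r].
  by rewrite ball_vertices0 => ->; exact: root_vertex.
move/ball_verticesS=> [->|[u _ uv]]; first exact: root_vertex.
by apply: (@edge_vertex _ _ _ v u); rewrite edge_sym.
Qed.

(* The rooted network induced by the vertices within distance [r] of [o]. *)
Definition net_ball M (N : network R M) (o r : nat) : network R M :=
  induced N (ball_vertices N o r).

Section Distance.
Variable M : pseudoMetricType R.
Implicit Types x y z : rnet M.

Definition good x y (r : nat) (delta : R) : Prop :=
  exists f : nat -> nat,
    let Bx := net_ball x (root x) r in let By := net_ball y (root y) r in
    [/\ graph_iso Bx By f, f (root x) = root y,
        forall v, vertex Bx v -> ball (mark Bx v) delta (mark By (f v)) &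
        forall u v, edge Bx u v ->
          ball (weight Bx u v) delta (weight By (f u) (f v))].

(* [+oo] when no pair is good, which happens exactly when one of the two roots
   carries a loop and the other does not. *)
Definition rdist x y : \bar R :=
  ereal_inf [set e | exists r delta,
    [/\ 0 < delta, good x y r delta & e = ((1 + r%:R)^-1 + delta)%:E]].

Lemma net_ball_edge (N : network R M) o r u v :
  edge (net_ball N o r) u v <->
  [/\ ball_vertices N o r u, ball_vertices N o r v & edge N u v].
Proof.
split; first by case/and3P=> /set_mem ? /set_mem ?.
by move=> [? ? uv]; apply/and3P; split=> //; exact/mem_set.
Qed.

Lemma net_ball_weight (N : network R M) o r u v :
  edge (net_ball N o r) u v -> weight (net_ball N o r) u v = weight N u v.
Proof. by rewrite /= => ->. Qed.

Lemma graph_iso_edge (N N' : network R M) f u v : graph_iso N N' f ->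
  edge N u v -> edge N' (f u) (f v).
Proof.
move=> [_ fe] uv; rewrite fe//; first exact: edge_vertex uv.
by apply: edge_vertex; rewrite edge_sym; exact: uv.
Qed.

Lemma good_sym x y r d : good x y r d -> good y x r d.
Proof.
move=> [f [[fbij fe] fr fm fw]].
have [g [gbij gf fg]] := set_bij_inverse fbij.
have [gfun _ _] := gbij.
have gi : graph_iso (net_ball y (root y) r) (net_ball x (root x) r) g.
  split=> // u v yu yv; rewrite -fe ?fg//; exact: gfun.
exists g; split=> //.
- by rewrite -fr gf//; exact: ball_vertices_root.
- move=> v yv; apply: ball_sym.
  by have := fm _ (gfun _ yv); rewrite fg.
- move=> u v uv; apply: ball_sym.
  have [yu yv _] := (net_ball_edge _ _ _ _ _).1 uv.
  by have := fw _ _ (graph_iso_edge gi uv); rewrite !fg.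
Qed.

Lemma good_trans y x z r d e :
  good x y r d -> good y z r e -> good x z r (d + e).
Proof.
move=> [f [[fbij fe] fr fm fw]] [g [[gbij ge] gr gm gw]].
have [ffun _ _] := fbij.
exists (g \o f); split.
- split; first exact: (set_bij_comp fbij gbij).
  by move=> u v xu xv; rewrite [LHS]ge ?fe//; exact: ffun.
- by rewrite -gr -fr.
- by move=> v xv; apply: ball_triangle (fm v xv) (gm _ _); exact: ffun.
- move=> u v uv; apply: ball_triangle (fw u v uv) (gw _ _ _).
  exact: graph_iso_edge (conj fbij fe) uv.
Qed.

Lemma graph_iso_ball x y r s f :
  graph_iso (net_ball x (root x) r) (net_ball y (root y) r) f ->
  f (root x) = root y -> (s <= r)%N ->
  forall v, ball_vertices x (root x) s v -> ball_vertices y (root y) s (f v).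
Proof.
move=> fi fr; elim: s => [|s IH] sr v.
  by rewrite ball_vertices0 => ->; rewrite fr; exact: ball_vertices_root.
move/ball_verticesS=> [->|[u xu uv]].
  by rewrite fr; exact: ball_vertices_root.
apply/ball_verticesS; right; exists (f u); first exact: IH (ltnW sr) _ xu.
have : edge (net_ball x (root x) r) u v.
  apply/net_ball_edge; split=> //.
    exact: ball_vertices_le (ltnW sr) _ xu.
  apply: ball_vertices_le sr _ _.
  by apply/ball_verticesS; right; exists u.
by move/(graph_iso_edge fi)/net_ball_edge => -[].
Qed.

Lemma good_le x y r s d e : (s <= r)%N -> d <= e ->
  good x y r d -> good x y s e.
Proof.
move=> sr de [f [fi fr fm fw]].
have [[ffun finj fsurj] fe] := fi.
have [g [gbij gf fg]] := set_bij_inverse fi.1.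
have gi : graph_iso (net_ball y (root y) r) (net_ball x (root x) r) g.
  have [gfun _ _] := gbij.
  by split=> // u v yu yv; rewrite -fe ?fg//; exact: gfun.
have gr : g (root y) = root x.
  by rewrite -fr gf//; exact: ball_vertices_root.
have fs := graph_iso_ball fi fr sr.
have gs := graph_iso_ball gi gr sr.
have fsi : graph_iso (net_ball x (root x) s) (net_ball y (root y) s) f.
  split.
    split=> //=.
    - move=> u v; rewrite !inE => xu xv; apply: finj; rewrite inE/=.
        exact: ball_vertices_le sr _ xu.
      exact: ball_vertices_le sr _ xv.
    - move=> v yv; exists (g v); first exact: gs.
      by apply: fg; exact: ball_vertices_le sr _ yv.
  move=> u v xu xv; have := fe _ _ (ball_vertices_le sr xu)
    (ball_vertices_le sr xv).
  have sub z w : ball_vertices z (root z) s w -> ball_vertices z (root z) r w.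
    exact: ball_vertices_le.
  by rewrite /= !mem_set//=; try solve [apply: sub; auto | auto].
have es u v : edge (net_ball x (root x) s) u v ->
    edge (net_ball x (root x) r) u v.
  move=> /net_ball_edge[xu xv uv]; apply/net_ball_edge; split=> //.
    exact: ball_vertices_le sr _ xu.
  exact: ball_vertices_le sr _ xv.
exists f; split=> //.
- move=> v xv; apply: le_ball de _ _.
  by apply: fm; exact: ball_vertices_le sr _ xv.
- move=> u v uv; have uvr := es _ _ uv; have := fw _ _ uvr.
  rewrite (net_ball_weight uvr) (net_ball_weight (graph_iso_edge fi uvr)).
  rewrite (net_ball_weight uv) (net_ball_weight (graph_iso_edge fsi uv)).
  exact: le_ball.
Qed.

Lemma rooted_iso_good x y r (d : R) : 0 < d -> rooted_iso x y -> good x y r d.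
Proof.
have ballf x' y' f : graph_iso x' y' f -> f (root x') = root y' ->
    forall s v, ball_vertices x' (root x') s v ->
      ball_vertices y' (root y') s (f v).
  move=> fi fr; elim=> [|s IH] v.
    by rewrite ball_vertices0 => ->; rewrite fr; exact: ball_vertices_root.
  move/ball_verticesS=> [->|[u xu uv]].
    by rewrite fr; exact: ball_vertices_root.
  apply/ball_verticesS; right; exists (f u); first exact: IH.
  exact: graph_iso_edge fi uv.
move=> d0 [f [fi fr fm fw]].
have [[ffun finj fsurj] fe] := fi.
have [g [gbij gf fg]] := set_bij_inverse fi.1.
have [gfun _ _] := gbij.
have gi : graph_iso y x g.
  by split=> // u v yu yv; rewrite -fe ?fg//; exact: gfun.
have gr : g (root y) = root x by rewrite -fr gf//; exact: root_vertex.
have fb := ballf _ _ _ fi fr r.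
have gb := ballf _ _ _ gi gr r.
have bi : graph_iso (net_ball x (root x) r) (net_ball y (root y) r) f.
  split.
    split=> //=.
    - move=> u v; rewrite !inE => xu xv.
      apply: finj; rewrite inE; first exact: rnet_ball_vertex xu.
      exact: rnet_ball_vertex xv.
    - move=> v yv; exists (g v); first exact: gb.
      by apply: fg; exact: rnet_ball_vertex yv.
  move=> u v xu xv; rewrite /= !mem_set//=; try exact: fb.
  by apply: fe; [exact: rnet_ball_vertex xu|exact: rnet_ball_vertex xv].
exists f; split=> //.
- move=> v xv; rewrite [mark _ (f v)]fm; first exact: ballxx.
  exact: rnet_ball_vertex xv.
- move=> u v uv.
  rewrite (net_ball_weight uv) (net_ball_weight (graph_iso_edge bi uv)).
  have [xu xv _] := (net_ball_edge _ _ _ _ _).1 uv.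
  rewrite fw; first exact: ballxx.
    exact: rnet_ball_vertex xu.
  exact: rnet_ball_vertex xv.
Qed.

Lemma rdist_iso0 x y (e : R) : 0 < e -> rooted_iso x y -> (rdist x y < e%:E)%E.
Proof.
move=> e0 xy; have e20 : 0 < e / 2 by rewrite divr_gt0.
have [r re] : exists r : nat, (1 + r%:R)^-1 < e / 2.
  exists (Num.truncn (e / 2)^-1); rewrite -[ltRHS]invrK.
  have n0 n : 0 < 1 + n%:R :> R by rewrite ltr_wpDr.
  rewrite ltf_pV2 ?posrE ?invr_gt0 ?n0//.
  by rewrite addrC natr1; exact: Num.Theory.truncnS_gt.
apply: (@le_lt_trans _ _ ((1 + r%:R)^-1 + e / 2)%:E).
  apply: ereal_inf_lbound; exists r, (e / 2); split=> //.
  exact: rooted_iso_good.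
by rewrite lte_fin [ltRHS]splitr ltrD2r.
Qed.

Lemma rdist_sym x y : rdist x y = rdist y x.
Proof.
by congr ereal_inf; apply/seteqP; split=> e /= [r [d [d0 xy ->]]];
  exists r, d; split=> //; exact: good_sym.
Qed.

Lemma rdist_triangle x y z a b : (rdist x y < a%:E)%E ->
  (rdist y z < b%:E)%E -> (rdist x z < (a + b)%:E)%E.
Proof.
move=> /ereal_inf_lt[_ [r [d [d0 xy ->]]] ra].
move=> /ereal_inf_lt[_ [s [e [e0 yz ->]]] sb].
rewrite !lte_fin in ra sb.
apply: (@le_lt_trans _ _ ((1 + (minn r s)%:R)^-1 + (d + e))%:E).
  apply: ereal_inf_lbound; exists (minn r s), (d + e); split=> //.
    exact: addr_gt0.
  apply: (@good_trans y).
    exact: good_le (geq_minl _ _) (lexx d) xy.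
  exact: good_le (geq_minr _ _) (lexx e) yz.
rewrite lte_fin.
have pos n : 0 < (1 + n%:R)^-1 :> R by rewrite invr_gt0 ltr_wpDr.
have := pos r; have := pos s; rewrite /minn; case: ifP => _ *; lra.
Qed.

(* The distance between the classes. *)
Definition ndist (x y : nstar M) : \bar R := rdist (repr x) (repr y).

Lemma ndistE x y : ndist (nclass x) (nclass y) = rdist x y.
Proof.
have repr_iso z : rooted_iso (repr (nclass z)) z.
  by apply/nclassP; rewrite /nclass reprK.
have le x1 y1 x2 y2 : rooted_iso x1 x2 -> rooted_iso y1 y2 ->
    (rdist x1 y1 <= rdist x2 y2)%E.
  move=> xx yy; apply/ereal_infP => _ [r [d [d0 xy ->]]].
  have h : (rdist x2 y2 <= ((1 + r%:R)^-1 + d)%:E)%E.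
    by apply: ereal_inf_lbound; exists r, d.
  apply/lee_addgt0Pr => e e0; rewrite -EFinD.
  have e40 : 0 < e / 4 by rewrite divr_gt0.
  have h' : (rdist x2 y2 < ((1 + r%:R)^-1 + d + e / 4)%:E)%E.
    by apply: le_lt_trans h _; rewrite lte_fin ltrDl.
  have h1 := rdist_triangle (rdist_iso0 e40 xx) h'.
  have h2 := rdist_triangle h1 (rdist_iso0 e40 (rooted_iso_sym yy)).
  apply/ltW/(lt_le_trans h2); rewrite lee_fin; lra.
apply/eqP; rewrite eq_le /ndist !le//; exact: rooted_iso_sym.
Qed.

Definition nball (x : nstar M) (e : R) (y : nstar M) : Prop :=
  (ndist x y < e%:E)%E.

Lemma nball_center (X : nstar M) (e : R) : 0 < e -> nball X e X.
Proof. by move=> e0; apply: rdist_iso0 => //; exact: rooted_iso_refl. Qed.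

Lemma nball_sym (X Y : nstar M) e : nball X e Y -> nball Y e X.
Proof. by rewrite /nball /ndist rdist_sym. Qed.

Lemma nball_triangle (X Y Z : nstar M) e1 e2 :
  nball X e1 Y -> nball Y e2 Z -> nball X (e1 + e2) Z.
Proof. exact: rdist_triangle. Qed.

HB.instance Definition _ := hasNbhs.Build (nstar M) (nbhs_ (entourage_ nball)).
HB.instance Definition _ := @Nbhs_isPseudoMetric.Build R (nstar M)
  (entourage_ nball) erefl nball nball_center nball_sym nball_triangle erefl.

Lemma ndist_ge0 (X Y : nstar M) : (0 <= ndist X Y)%E.
Proof.
apply/ereal_infP => _ [r [d [d0 _ ->]]].
by rewrite lee_fin addr_ge0 ?invr_ge0 ?addr_ge0// ltW.
Qed.

Lemma edist_ndist (X Y : nstar M) : edist (X, Y) = ndist X Y.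
Proof.
apply/eqP; rewrite eq_le; apply/andP; split; last first.
  by apply/ereal_infP => _ [e [_ /ltW XY] <-].
have := ndist_ge0 X Y; case E : (ndist X Y) => [a| |]// a0; last exact: leey.
apply/lee_addgt0Pr => e e0; rewrite -EFinD; apply: ereal_inf_lbound.
exists (a + e) => //; split; first by rewrite ltr_wpDl// -lee_fin.
by rewrite /ball/= /nball E lte_fin ltrDl.
Qed.

End Distance.
End Networks.

HB.instance Definition _ (R : realType) (M : pseudoPMetricType R) :=
  Pointed.on (nstar R M).

HB.instance Definition _ (R : realType) (M M' : pseudoPMetricType R) :=
  Pointed.on (M * M')%type.

(* [C([0, T]; R)]; a path is stored as a function on [R] that vanishes outside
   [[0, T]], so that equal paths are equal elements. *)
Record cpath (R : realType) (T : R) := CPath {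
  path_fun :> R -> R;
  path_continuous : {within `[0, T], continuous path_fun};
  path_out : forall t, t \notin `[0, T] -> path_fun t = 0 }.

Section Paths.
Variables (R : realType) (T : R).

HB.instance Definition _ := gen_eqMixin (cpath T).
HB.instance Definition _ := gen_choiceMixin (cpath T).

Lemma zero_path_continuous : {within `[0, T], continuous (fun=> 0 : R)}.
Proof. by apply: continuous_subspaceT => x; exact: cst_continuous. Qed.

HB.instance Definition _ := isPointed.Build (cpath T)
  (CPath zero_path_continuous (fun _ _ => erefl)).

Definition sup_dist (f g : cpath T) : \bar R :=
  ereal_sup [set `|f t - g t|%:E | t in `[0, T]].

Definition path_ball (f : cpath T) (e : R) (g : cpath T) : Prop :=
  (sup_dist f g < e%:E)%E.

Lemma path_ball_center f (e : R) : 0 < e -> path_ball f e f.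
Proof.
move=> e0; apply: (@le_lt_trans _ _ 0%E); last by rewrite lte_fin.
by apply: ge_ereal_sup => _ [t _ <-]; rewrite subrr normr0.
Qed.

Lemma path_ball_sym f g e : path_ball f e g -> path_ball g e f.
Proof.
rewrite /path_ball; congr (_ < _)%E; congr ereal_sup.
by apply/seteqP; split=> _ [t tT <-]; exists t; rewrite // distrC.
Qed.

Lemma path_ball_triangle f g h e1 e2 :
  path_ball f e1 g -> path_ball g e2 h -> path_ball f (e1 + e2) h.
Proof.
rewrite /path_ball => fg gh; apply: le_lt_trans (lteD fg gh).
apply: ge_ereal_sup => _ [t tT <-].
apply: (@le_trans _ _ (`|f t - g t|%:E + `|g t - h t|%:E)%E).
  by rewrite -EFinD lee_fin ler_distD.
by apply: leeD; apply: ereal_sup_ubound; exists t.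
Qed.

HB.instance Definition _ := hasNbhs.Build (cpath T)
  (nbhs_ (entourage_ path_ball)).
HB.instance Definition _ := @Nbhs_isPseudoMetric.Build R (cpath T)
  (entourage_ path_ball) erefl path_ball path_ball_center path_ball_sym
  path_ball_triangle erefl.

End Paths.

Definition bl_norm (R : realType) (X : pseudoMetricType R) (h : X -> R) :
    \bar R :=
  (ereal_sup [set `|h x|%:E | x in [set: X]] +
   ereal_inf [set K%:E | K in [set K : R | (0 <= K)%R /\
     forall x y, `|h x - h y|%:E <= K%:E * edist (x, y)]])%E.

Definition borel (X : ptopologicalType) := g_sigma_algebraType (@open X).

Definition weak_cvg (R : realType) (X : ptopologicalType)
    (mu_ : nat -> {measure set (borel X) -> \bar R})
    (mu : {measure set (borel X) -> \bar R}) : Prop :=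
  forall f : X -> R, continuous f -> bounded_fun f ->
    \int[mu_ n]_x f x @[n --> \oo] --> \int[mu]_x f x.

(* For a finite network. *)
Definition U (R : realType) (M : pseudoPMetricType R) (N : network R M) :
    {measure set (borel (nstar R M)) -> \bar R} :=
  let s : seq nat := fset_set (vertex N) in
  mscale ((size s)%:R^-1)%:nng
    (msum (fun i => \d_(nclass (component_at N (nth 0%N s i)) : borel _))
          (size s)).

Section Probability.
Local Open Scope ereal_scope.
Context d (Omega : measurableType d) (R : realType) (P : probability Omega R).

Definition independent (I : choiceType) (F : I -> set (set Omega)) : Prop :=
  forall (J : {fset I}) (A : I -> set Omega),
    (forall i, i \in J -> F i (A i)) ->
    P (\bigcap_(i in [set` J]) A i) = \prod_(i <- J) P (A i).

Definition standard_brownian (B : R -> Omega -> R) : Prop :=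
  [/\ forall t, (0 <= t)%R -> measurable_fun setT (B t),
      {ae P, forall w, B 0%R w = 0%R},
      {ae P, forall w, {within `[0%R, +oo[, continuous (B ^~ w)}},
      (forall s t, (0 <= s < t)%R -> forall C : set R, measurable C ->
        P ((B t \- B s)%R @^-1` C) = normal_prob 0%R (Num.sqrt (t - s)) C) &
      (forall s t, (0 <= s <= t)%R -> forall (A : set Omega) (C : set R),
        <<s [set B u @^-1` D | u in `[0%R, s] & D in measurable] >> A ->
        measurable C ->
        P (A `&` (B t \- B s)%R @^-1` C) = P A * P ((B t \- B s)%R @^-1` C))].

Definition iid_brownian (B : nat -> R -> Omega -> R) : Prop :=
  (forall v, standard_brownian (B v)) /\
  independent (fun v =>
    <<s [set B v t @^-1` D | t in `[0%R, +oo[ & D in measurable] >>).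

Definition iid_law (I : choiceType) d' (X : measurableType d')
    (nu : probability X R) (Y : I -> Omega -> X) : Prop :=
  [/\ forall i, measurable_fun setT (Y i),
      forall i A, measurable A -> P (Y i @^-1` A) = nu A &
      independent (fun i => [set Y i @^-1` A | A in measurable])].

(* The filtration generated by all the Brownian motions, augmented by the
   null events. *)
Definition filtration (B : nat -> R -> Omega -> R) (t : R) : set (set Omega) :=
  <<s \bigcup_v [set B v s @^-1` D | s in `[0%R, t] & D in measurable] `|`
      [set A | measurable A /\ P A = 0] >>.

End Probability.

Section Diffusion.
Variables (R : realType) (phi : R * R * R * R -> R) (psi : R * R -> R).

(* As [0^-1 = 0], the interaction term vanishes when [total_weight N v = 0]. *)
Definition drift (N : network R (R * R)%type) (x : nat -> R) (v : nat) : R :=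
  (total_weight N v)^-1 *
    (\sum_(u \in vertex N)
       weight N u v * phi (x u, x v, (mark N v).1, (mark N u).1)) +
  psi (x v, (mark N v).1).

(* The noise is additive, so the system of stochastic differential equations
   is a system of pathwise integral equations. *)
Definition strong_solution d (Omega : measurableType d) (P : probability Omega R)
    (B : nat -> R -> Omega -> R) (T : R) (N : network R (R * R)%type)
    (theta : nat -> Omega -> cpath T) : Prop :=
  (forall v t, vertex N v -> 0 <= t <= T -> forall D : set R, measurable D ->
     filtration P B t [set w | D (theta v w t)]) /\
  {ae P, forall w, forall v t, vertex N v -> 0 <= t <= T ->
     theta v w t = (mark N v).2 +
       (\int[lebesgue_measure]_(s in `[0, t])
          drift N (fun u => theta u w s) v)%R + B v t w}.

End Diffusion.

(* [N^theta] in the realization [w], and its rooted version. *)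
Definition theta_marks (R : realType) (T : R) (Omega : Type)
    (N : network R (R * R)%type) (theta : nat -> Omega -> cpath T) (w : Omega)
    (v : nat) : R * cpath T :=
  ((mark N v).1, theta v w).

Definition net_theta (R : realType) (T : R) (Omega : Type)
    (N : network R (R * R)%type) (theta : nat -> Omega -> cpath T) (w : Omega) :
    network R (R * cpath T)%type :=
  set_marks N (theta_marks N theta w).

Definition rnet_theta (R : realType) (T : R) (Omega : Type)
    (x : rnet R (R * R)%type) (theta : nat -> Omega -> cpath T) (w : Omega) :
    rnet R (R * cpath T)%type :=
  rset_marks x (theta_marks x theta w).

(* Main.v *)
Require Import Defs.
From HB Require Import structures.
From mathcomp Require Import all_boot all_order all_algebra finmap.
From mathcomp Require Import all_classical all_reals all_analysis.
From mathcomp Require Import measurable_realfun lra.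

Set Implicit Arguments.
Unset Strict Implicit.
Unset Printing Implicit Defensive.

Import Order.TTheory GRing.Theory Num.Theory.
Import numFieldNormedType.Exports.

Local Open Scope classical_set_scope.
Local Open Scope ring_scope.

(** The noise is additive, so all estimates on the diffusions can be made path
    by path, and the interaction is a weighted average of values of a bounded
    function, so that it is bounded whatever the network looks like. These two
    facts make the trajectory at a vertex depend on the far part of the network
    only through an exponentially small error, and the theorem is a law of large
    numbers for local observables.

    Locality. Restrict a rooted network to the ball of radius [r] around its
    root and run in it the Euler scheme with step [mesh m], driven by increments
    of the Brownian motions rounded to finitely many values. Compare this with a
    solution on the whole network. A vertex on the boundary of the ball sees a
    wrong interaction, but a wrong interaction is off by at most [2 * Mphi]; at
    each generation towards the root the error halves ([euler_cvg]). As [m] goes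
    to infinity, an observable [F] with bounded Lipschitz norm at most [1]
    evaluated on the solution is therefore, up to [locality_error], a function
    of finitely many random codes, each with finitely many values
    ([observable_locality]).

    Consequences. The law of these codes does not depend on which Brownian
    motions carry them, and codes carried by disjoint sets of vertices are
    independent. Hence the mean of the Euler observable depends only on the
    rooted isomorphism class of the network, and continuously so, uniformly in
    [m] ([euler_mean_stable]): its upper limit in [m], [local_mean], is a
    continuous function on the space of classes within [locality_error] of the
    mean of the observable ([local_mean_continuous], [observable_mean_local]).
    Moreover observables of two networks whose balls are disjoint are almost
    uncorrelated ([observable_decorrelation]).

    The limit. For a finite network, [U] of the marked network integrates [F] to
    the average over the vertices [v] of the observables of the components at
    [v]. Its mean is close to the integral of [local_mean] against [U (N n)],
    which converges by weak convergence to the integral against [nu]; the latter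
    is close to the mean of [F] on the random limit network. Its variance is
    small, because a pair of vertices has overlapping balls of radius [r] only
    when the vertices are at distance at most [r + r], and the hypothesis on the
    maximal degree makes such pairs a vanishing proportion of all pairs
    ([sum_concentration], [subpolynomial_balls]). Thus each factor on the left
    converges in mean to a constant ([empirical_convergence]), and so does the
    product of these bounded factors.

    Measurability. On nice classes, [class_mean] is the uniform limit of the
    continuous functions [local_mean], hence a Borel function there; niceness is
    a countable combination of open conditions ([measurable_nice_class]). The
    integrand on the right is arbitrary at classes which are not nice, and the
    integral of a function that agrees with a measurable one on a set of full
    measure is still the expected one ([expectation_full]). *)

(* The notation of polynomial roots shadows the root of a rooted network. *)
Local Notation root := Defs.root.

(** * Piecewise linear paths *)

Section PathInterpolation.
Variables (R : realType) (T : R).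
Hypothesis T_gt0 : 0 < T.

Definition mesh (m : nat) : R := T / m.+1%:R.

Definition gridpt (m j : nat) : R := mesh m * j%:R.

Lemma mesh_gt0 m : 0 < mesh m.
Proof. by rewrite divr_gt0. Qed.

Lemma gridpt_ge0 m j : 0 <= gridpt m j.
Proof. by rewrite mulr_ge0// ltW// mesh_gt0. Qed.

Lemma gridptS m j : gridpt m j.+1 = gridpt m j + mesh m.
Proof. by rewrite /gridpt -natr1 mulrDr mulr1. Qed.

Lemma gridpt_last m : gridpt m m.+1 = T.
Proof. by rewrite /gridpt /mesh divfK. Qed.

Lemma gridpt_le m i j : (i <= j)%N -> gridpt m i <= gridpt m j.
Proof. by move=> ij; rewrite ler_wpM2l ?ler_nat// ltW// mesh_gt0. Qed.

Lemma gridpt_leT m j : (j <= m.+1)%N -> gridpt m j <= T.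
Proof. by move=> jm; rewrite (le_trans (gridpt_le m jm)) ?gridpt_last. Qed.

Lemma gridpt_cell m t : 0 <= t <= T ->
  exists2 j, (j < m.+1)%N & gridpt m j <= t <= gridpt m j.+1.
Proof.
move=> /andP[t0 tT].
(* The bound [j <= n] ends up as [j < m.+1] for [n = m]. *)
suff H n : t <= gridpt m n.+1 ->
    exists2 j, (j <= n)%N & gridpt m j <= t <= gridpt m j.+1.
  by apply: H; rewrite gridpt_last.
elim: n => [|n IH] tn.
  by exists 0%N => //; rewrite tn andbT /gridpt mulr0.
have [/IH[j jn H]|tn'] := leP t (gridpt m n.+1); first by exists j => //; exact: leqW.
by exists n.+1 => //; rewrite tn (ltW tn').
Qed.

(** The function [t / mesh m - j] clamped between [0] and [1]; written with absolute values,
    it is visibly continuous. *)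
Definition ramp (m j : nat) (t : R) : R :=
  (1 + `|t / mesh m - j%:R| - `|t / mesh m - j%:R - 1|) / 2.

(** The piecewise linear interpolation of the values [Y j] at the points [gridpt m j]. *)
Definition polygon (m : nat) (Y : nat -> R) (t : R) : R :=
  Y 0%N + \sum_(j < m.+1) (Y j.+1 - Y j) * ramp m j t.

Lemma polygonE m l t : (l < m.+1)%N ->
  gridpt m l <= t <= gridpt m l.+1 ->
  exists s, [/\ 0 <= s, s <= 1 &
    forall Y, polygon m Y t = (1 - s) * Y l + s * Y l.+1].
Proof.
move=> lm /andP[lt tl]; pose s := t / mesh m - l%:R.
have h0 := mesh_gt0 m.
have s0 : 0 <= s by rewrite subr_ge0 ler_pdivlMr// mulrC.
have s1 : s <= 1.
  by rewrite lerBlDr ler_pdivrMr// addrC natr1 mulrC.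
exists s; split=> // Y.
have before j : (j < l)%N -> ramp m j t = 1.
  move=> jl; have : 1 <= t / mesh m - j%:R.
    have : (j.+1)%:R <= l%:R :> R by rewrite ler_nat.
    by rewrite -natr1; move: s0; rewrite /s; lra.
  by move=> H; rewrite /ramp !ger0_norm; lra.
have after j : (l < j)%N -> ramp m j t = 0.
  move=> jl; have : t / mesh m - j%:R <= 0.
    have : (l.+1)%:R <= j%:R :> R by rewrite ler_nat.
    by rewrite -natr1; move: s1; rewrite /s; lra.
  by move=> H; rewrite /ramp !ler0_norm; lra.
have at_l : ramp m l t = s.
  by rewrite /ramp -/s ger0_norm// ler0_norm; lra.
have telescope n : (n <= l)%N ->
    \sum_(0 <= j < n) (Y j.+1 - Y j) * ramp m j t = Y n - Y 0%N.
  move=> nl; rewrite (eq_big_nat _ _ (F2 := fun j => Y j.+1 - Y j)).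
    by rewrite telescope_sumr.
  by move=> j /andP[_ jn]; rewrite before ?mulr1// (leq_trans jn).
rewrite /polygon -(big_mkord xpredT (fun j => (Y j.+1 - Y j) * ramp m j t)).
rewrite (@big_cat_nat _ _ _ l)//=; last exact: ltnW.
rewrite telescope// big_ltn// at_l big_nat_cond big1 ?addr0.
  by lra.
by move=> j /andP[/andP[lj _] _]; rewrite after ?mulr0.
Qed.

Lemma ramp_continuous m j : continuous (ramp m j).
Proof.
have c (a : R) : continuous (fun t : R => `|t / mesh m - a|).
  move=> t; apply: cvg_norm; apply: cvgB; last exact: cvg_cst.
  by apply: cvgMl; exact: cvg_id.
move=> t; rewrite /ramp; apply: cvgMl; apply: cvgB.
  by apply: cvgD; [exact: cvg_cst|exact: c].
apply: cvg_norm; apply: cvgB; last exact: cvg_cst.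
apply: cvgB; last exact: cvg_cst.
by apply: cvgMl; exact: cvg_id.
Qed.

Lemma polygon_continuous m Y : continuous (polygon m Y).
Proof.
move=> t; apply: cvgD; first exact: cvg_cst.
apply: cvg_big => [|j _]; first exact: add_continuous.
by apply: cvgMr; exact: ramp_continuous.
Qed.

Let path_restriction (g : R -> R) (t : R) : R := if t \in `[0, T] then g t else 0.

Let path_restriction_continuous g : continuous g ->
  {within `[0, T], continuous (path_restriction g)}.
Proof.
move=> cg; apply: (@subspace_eq_continuous _ _ _ g).
  by move=> t; rewrite inE => tT; rewrite /from_subspace /path_restriction ifT.
exact: continuous_subspaceT.
Qed.

Let path_restriction_out g t : t \notin `[0, T] -> path_restriction g t = 0.
Proof. by rewrite /path_restriction => /negbTE ->. Qed.

Definition polygon_path (m : nat) (Y : nat -> R) : cpath T :=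
  CPath (path_restriction_continuous (@polygon_continuous m Y))
    (path_restriction_out (polygon m Y)).

Lemma polygon_pathE m Y t : 0 <= t <= T -> polygon_path m Y t = polygon m Y t.
Proof. by move=> tT; rewrite /= /path_restriction in_itv/= tT. Qed.

(** The two errors are the one at the grid points and the oscillation of [y] over a
    cell; convexity of the interpolation adds them up. *)
Lemma polygon_path_near m Y (y : cpath T) (e w : R) : 0 <= e ->
  (forall j, (j <= m.+1)%N -> `|Y j - y (gridpt m j)| <= e) ->
  (forall s t, 0 <= s <= T -> 0 <= t <= T -> `|s - t| <= mesh m ->
     `|y s - y t| <= w) ->
  (sup_dist (polygon_path m Y) y <= (e + w)%:E)%E.
Proof.
move=> e0 Ye yw; apply: ge_ereal_sup => _ [t tI <-].
have tT : 0 <= t <= T by move: tI; rewrite /= in_itv.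
rewrite lee_fin polygon_pathE//.
have [l lm /andP[lt tl]] := gridpt_cell m tT.
have := @polygonE m l t lm; rewrite lt tl => /(_ isT)[s [s0 s1 ->]].
have h0 := mesh_gt0 m; have := gridptS m l => tS.
have near j : (l <= j <= l.+1)%N -> `|Y j - y t| <= e + w.
  move=> /andP[lj jl].
  have jm : (j <= m.+1)%N by apply: leq_trans jl _.
  rewrite (le_trans (ler_distD (y (gridpt m j)) _ _))// lerD ?Ye// yw//.
    by rewrite gridpt_ge0 gridpt_leT.
  have : gridpt m l <= gridpt m j <= gridpt m l.+1 by rewrite !gridpt_le.
  by move=> /andP[? ?]; rewrite ler_norml; apply/andP; split; lra.
have -> : (1 - s) * Y l + s * Y l.+1 - y t =
    (1 - s) * (Y l - y t) + s * (Y l.+1 - y t) by lra.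
rewrite (le_trans (ler_normD _ _))// !normrM (ger0_norm s0).
rewrite ger0_norm ?subr_ge0//.
have -> : e + w = (1 - s) * (e + w) + s * (e + w) by lra.
by rewrite lerD// ler_wpM2l ?subr_ge0// near ?leqnn ?leqnSn.
Qed.

Lemma polygon_path_stable m Y Z (e : R) :
  (forall j, (j <= m.+1)%N -> `|Y j - Z j| <= e) ->
  (sup_dist (polygon_path m Y) (polygon_path m Z) <= e%:E)%E.
Proof.
move=> YZ; apply: ge_ereal_sup => _ [t tI <-].
have tT : 0 <= t <= T by move: tI; rewrite /= in_itv.
rewrite lee_fin !polygon_pathE//.
have [l lm tl] := gridpt_cell m tT.
have [s [s0 s1 H]] := polygonE lm tl; rewrite !H.
have -> : (1 - s) * Y l + s * Y l.+1 - ((1 - s) * Z l + s * Z l.+1) =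
    (1 - s) * (Y l - Z l) + s * (Y l.+1 - Z l.+1) by lra.
rewrite (le_trans (ler_normD _ _))// !normrM (ger0_norm s0).
rewrite ger0_norm ?subr_ge0//.
have -> : e = (1 - s) * e + s * e by lra.
by rewrite lerD// ler_wpM2l ?subr_ge0// YZ// ltnW.
Qed.

Lemma mesh_near0 (e : R) : 0 < e -> \forall m \near \oo, mesh m < e.
Proof.
move=> e0; near=> m.
rewrite /mesh ltr_pdivrMr// -ltr_pdivrMl// mulrC.
have : (Num.truncn (T / e) <= m)%N by near: m; exact: nbhs_infty_ge.
move=> H; apply: lt_le_trans (truncnS_gt _) _.
by rewrite ler_nat ltnS.
Unshelve. all: by end_near. Qed.

(** Uniform continuity on a compact interval, in terms of the mesh. *)
Lemma cpath_modulus (y : cpath T) (e : R) : 0 < e ->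
  \forall m \near \oo, forall s t, 0 <= s <= T -> 0 <= t <= T ->
    `|s - t| <= mesh m -> `|y s - y t| <= e.
Proof.
move=> e0.
have cy := (subspace_continuousP _ _).1 (@path_continuous _ _ y).
have : \forall m \near \oo, `[0, T]%classic `<=`
    (fun s => `[0, T]%classic s -> forall t, 0 <= t <= T ->
      `|s - t| <= mesh m -> `|y s - y t| <= e).
  apply: (@compact_near_coveringP _ _).1 _ _ _ _ _.
    exact: segment_compact.
  move=> x xT; have e20 : 0 < e / 2 by rewrite divr_gt0.
  have /cvgrPdist_lt/(_ _ e20) := cy _ xT.
  move=> /nbhs_ballP[d /= d0 dP].
  have d20 : 0 < d / 2 by rewrite divr_gt0.
  near=> s m => sT t tT st.
  have tT' : `[0, T]%classic t by rewrite /= in_itv.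
  have sx : `|x - s| < d / 2 by near: s; exact: (nbhsx_ballx x (d / 2) d20).
  have md : mesh m < d / 2 by near: m; exact: mesh_near0.
  have H1 : `|y x - y s| < e / 2 by apply: dP => //=; rewrite /ball/=; lra.
  have H2 : `|y x - y t| < e / 2.
    apply: dP => //=; rewrite /ball/=.
    by rewrite (le_lt_trans (ler_distD s _ _))//; lra.
  rewrite (le_trans (ler_distD (y x) _ _))// distrC; lra.
apply: filterS => m H s t sT tT st; apply: H => //; by rewrite /= in_itv.
Unshelve. all: by end_near. Qed.

End PathInterpolation.

(** * Rounding reals to finitely many values *)

Section Quantizer.
Variable R : realType.

(** Rounding to finitely many values makes every function of a code a finite
    combination of indicators. A code of [y] records which of [2 (m+1)^3]
    thresholds of spacing [(m+1)^-2], starting next to [-(m+1)], lie below [y]: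
    the range grows to the whole line while the spacing is small compared with
    [mesh m], so that the rounding of [m+1] increments is negligible in total. *)
Definition code_type (m : nat) := {ffun 'I_(2 * m.+1 ^ 3) -> bool}.

Definition encode (m : nat) (y : R) : code_type m :=
  [ffun i : 'I_(2 * m.+1 ^ 3) => (i.+1)%:R <= (y + m.+1%:R) * m.+1%:R ^+ 2].

Definition decode (m : nat) (c : code_type m) : R :=
  (\sum_i (c i)%:R) / m.+1%:R ^+ 2 - m.+1%:R.

Lemma sum_thresholds (K : nat) (z : R) : 0 <= z <= K%:R ->
  `|\sum_(i < K) (i.+1%:R <= z)%R%:R - z| <= 1.
Proof.
elim: K => [|K IH] /andP[z0 zK].
  have -> : z = 0 by apply/eqP; rewrite eq_le z0 zK.
  by rewrite big_ord0 subr0 normr0.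
rewrite big_ord_recr/=; have [zK'|Kz] := leP z K%:R.
  have -> : (K.+1%:R <= z) = false.
    by apply/negbTE; rewrite -ltNge (le_lt_trans zK')// ltr_nat.
  by rewrite addr0 IH// z0.
rewrite (eq_bigr (fun=> 1)) => [|i _]; last first.
  by rewrite (le_trans _ (ltW Kz))// ler_nat.
rewrite sumr_const card_ord; move: zK; rewrite -natr1 => zK.
by rewrite ler_norml; case: (K%:R + 1 <= z); rewrite ?addr0 /=; apply/andP; split; lra.
Qed.

Lemma encodeK (m : nat) (y : R) : `|y| <= m.+1%:R ->
  `|decode (encode m y) - y| <= (m.+1%:R ^+ 2)^-1.
Proof.
rewrite ler_norml => /andP[ym my].
set M : R := m.+1%:R; have M0 : 0 < M by [].
have M20 : 0 < M ^+ 2 by rewrite exprn_gt0.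
pose z := (y + M) * M ^+ 2.
have zE : z / M ^+ 2 = y + M by rewrite mulfK ?gt_eqF.
have : `|\sum_(i < 2 * m.+1 ^ 3) (i.+1%:R <= z)%R%:R - z| <= 1.
  apply: sum_thresholds; rewrite mulr_ge0 ?(ltW M20)//=; last first.
    by move: ym; rewrite -/M; lra.
  have -> : (2 * m.+1 ^ 3)%:R = (2 * M) * M ^+ 2 :> R.
    by rewrite natrM natrX -mulrA -exprS.
  rewrite ler_wpM2r ?(ltW M20)//.
  by move: my; rewrite -/M; lra.
have -> : decode (encode m y) - y = (\sum_(i < 2 * m.+1 ^ 3) (i.+1%:R <= z)%R%:R - z) / M ^+ 2.
  rewrite mulrBl zE /decode; under eq_bigr do rewrite ffunE.
  by rewrite -/M -/z -[LHS]addrA -opprD (addrC M).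
by rewrite normrM (gtr0_norm (x := _^-1)) ?invr_gt0// ler_pdivrMr// mulVf ?gt_eqF.
Qed.

Lemma measurable_encode m (c : code_type m) : measurable (encode m @^-1` [set c]).
Proof.
have -> : encode m @^-1` [set c] =
    \bigcap_(i in [set: 'I_(2 * m.+1 ^ 3)])
      [set y | ((i.+1)%:R <= (y + m.+1%:R) * m.+1%:R ^+ 2) = c i].
  apply/seteqP; split=> y /=.
    by move=> <- i _ /=; rewrite ffunE.
  by move=> H; apply/ffunP => i; rewrite ffunE; exact: H.
apply: fin_bigcap_measurable; first exact: finite_finset.
move=> i _; pose a : R := (i.+1)%:R / m.+1%:R ^+ 2 - m.+1%:R.
have E y : ((i.+1)%:R <= (y + m.+1%:R) * m.+1%:R ^+ 2) = (a <= y).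
  by rewrite lerBlDr ler_pdivrMr// exprn_gt0.
have -> : [set y | ((i.+1)%:R <= (y + m.+1%:R) * m.+1%:R ^+ 2) = c i] =
    if c i then `[a, +oo[%classic else `]-oo, a[%classic.
  apply/seteqP; split=> y /=; rewrite E; case: (c i) => /=; rewrite in_itv/= ?andbT//.
    by move=> /negbT; rewrite -ltNge.
  by move=> ya; apply/negbTE; rewrite -ltNge.
by case: (c i); exact: measurable_itv.
Qed.

End Quantizer.

(** * Drift on finite balls *)

Section FiniteBalls.
Variables (R : realType) (M : Type).
Implicit Types (N : network R M).

Lemma finite_ball_vertices N o r : finite_set (ball_vertices N o r).
Proof.
elim: r => [|r IH]; first by rewrite ball_vertices0; exact: finite_set1.
apply: (@sub_finite_set _ _ ([set o] `|`
    \bigcup_(u in ball_vertices N o r) [set v | edge N u v])).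
  by move=> v /ball_verticesS[->|[u ou uv]]; [left|right; exists u].
rewrite finite_setU; split; first exact: finite_set1.
by apply: bigcup_finite => // u _; exact: locally_finite.
Qed.

Definition ball_list N o r : seq nat := fset_set (ball_vertices N o r).

Lemma ball_listP N o r v : reflect (ball_vertices N o r v) (v \in ball_list N o r).
Proof.
by rewrite /ball_list in_fset_set; [exact: asboolP|exact: finite_ball_vertices].
Qed.

Lemma ball_list_uniq N o r : uniq (ball_list N o r).
Proof. exact: fset_uniq. Qed.

Lemma ball_vertices_step N o k u v :
  ball_vertices N o k v -> edge N v u -> ball_vertices N o k.+1 u.
Proof. by move=> ov vu; apply/ball_verticesS; right; exists v. Qed.

(** Any list that contains the neighbors of [v] computes the sum over all
    vertices, since the weight vanishes off the edges. *)
Lemma vertex_sumE N (s : seq nat) v (g : nat -> R) : uniq s ->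
  {in s, forall u, vertex N u} -> (forall u, edge N v u -> u \in s) ->
  \sum_(u \in vertex N) weight N u v * g u = \sum_(u <- s) weight N u v * g u.
Proof.
move=> us sN vs; rewrite (fsbigE s)//.
- rewrite big_seq_cond [RHS]big_seq_cond; apply: eq_bigl => u.
  by case: (boolP (u \in s)) => //= /sN Nu; rewrite mem_set.
- move=> u _ us'; rewrite weight0 ?mul0r//.
  by rewrite edge_sym; apply: contra us'; exact: vs.
Qed.

End FiniteBalls.

Section WeightedAverage.
Variable R : realType.
Implicit Types (s : seq nat) (w g : nat -> R).

(** When the total weight is [0], this is [0], in accordance with the convention
    for the drift at an isolated vertex. *)
Definition waverage s w g : R := (\sum_(u <- s) w u)^-1 * \sum_(u <- s) w u * g u.

Lemma waverage_le s w g D : 0 <= D -> (forall u, 0 <= w u) ->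
  (forall u, u \in s -> w u != 0 -> `|g u| <= D) -> `|waverage s w g| <= D.
Proof.
move=> D0 w0 gD; set W := \sum_(u <- s) w u.
have W0 : 0 <= W by rewrite sumr_ge0.
rewrite /waverage -/W normrM ger0_norm ?invr_ge0//.
apply: (@le_trans _ _ (W^-1 * (W * D))); last first.
  by rewrite mulrA ler_piMl//; have [->|Wn0] := eqVneq W 0; rewrite ?mulr0 ?mulVf.
rewrite ler_wpM2l ?invr_ge0// (le_trans (ler_norm_sum _ _ _))//.
rewrite /W mulr_suml big_seq [leRHS]big_seq ler_sum// => u us.
rewrite normrM (ger0_norm (w0 u)); have [->|wu] := eqVneq (w u) 0.
  by rewrite !mul0r.
by rewrite ler_wpM2l// gD.
Qed.

Lemma waverageB s w g g' :
  waverage s w g - waverage s w g' = waverage s w (fun u => g u - g' u).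
Proof.
rewrite /waverage -mulrBr -sumrB; congr (_ * _).
by apply: eq_bigr => u _; rewrite mulrBr.
Qed.

(** Both the numerator and the normalization contribute [D * a], whence the factor
    two. *)
Lemma waverage_weights s w w' g D a : 0 <= D ->
  (forall u, 0 <= w u) -> (forall u, 0 <= w' u) -> (forall u, `|g u| <= D) ->
  \sum_(u <- s) w u != 0 ->
  \sum_(u <- s) w' u != 0 -> \sum_(u <- s) `|w u - w' u| <= a ->
  `|waverage s w g - waverage s w' g| <= (\sum_(u <- s) w u)^-1 * (2 * D * a).
Proof.
move=> D0 w0 w'0 gD Wn0 W'n0 wa.
set W := \sum_(u <- s) w u in Wn0 *; set W' := \sum_(u <- s) w' u in W'n0.
have W0 : 0 <= W by rewrite sumr_ge0.
have -> : waverage s w g - waverage s w' g =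
    W^-1 * (\sum_(u <- s) (w u - w' u) * g u + (W' - W) * waverage s w' g).
  rewrite mulrDr; under eq_bigr do rewrite mulrBl.
  rewrite sumrB mulrBr mulrBl /waverage -/W -/W' mulrA mulrBr.
  by rewrite !(mulrA _ W'^-1) mulfV// mul1r !mulrA mulVf// mul1r addrA subrK.
rewrite normrM ger0_norm ?invr_ge0// ler_wpM2l ?invr_ge0//.
rewrite (le_trans (ler_normD _ _))//.
have -> : 2 * D * a = a * D + a * D by lra.
apply: lerD.
  rewrite (le_trans (ler_norm_sum _ _ _))//.
  rewrite (@le_trans _ _ ((\sum_(u <- s) `|w u - w' u|) * D))//; last by rewrite ler_wpM2r.
  by rewrite mulr_suml ler_sum// => u _; rewrite normrM ler_wpM2l.
rewrite normrM ler_pM//.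
  by rewrite distrC /W /W' -sumrB (le_trans (ler_norm_sum _ _ _)).
by apply: waverage_le.
Qed.

End WeightedAverage.

Section Drift.
Variables (R : realType) (phi : R * R * R * R -> R) (psi : R * R -> R).
Variables (Mphi L : R).
Hypotheses (Mphi_ge0 : 0 <= Mphi) (L_ge0 : 0 <= L).
Hypothesis phi_le : forall p, `|phi p| <= Mphi.
Hypothesis phi_lip : forall a b c e a' b' c' e' (D : R),
  `|a - a'| <= D -> `|b - b'| <= D -> `|c - c'| <= D -> `|e - e'| <= D ->
  `|phi (a, b, c, e) - phi (a', b', c', e')| <= L * D.
Hypothesis psi_lip : forall a b a' b' (D : R),
  `|a - a'| <= D -> `|b - b'| <= D -> `|psi (a, b) - psi (a', b')| <= L * D.

Notation net := (network R (R * R)%type).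
Implicit Types (N : net) (x : rnet R (R * R)%type) (y : nat -> R).

Lemma weight_ge0 N u v : 0 <= weight N u v.
Proof.
by have [uv|/weight0->//] := boolP (edge N u v); apply/ltW/weight_gt0.
Qed.

Lemma driftE N (s : seq nat) y v : uniq s -> {in s, forall u, vertex N u} ->
  (forall u, edge N v u -> u \in s) ->
  drift phi psi N y v =
  waverage s (fun u => weight N u v)
    (fun u => phi (y u, y v, (mark N v).1, (mark N u).1)) + psi (y v, (mark N v).1).
Proof.
move=> us sN vs; rewrite /drift /waverage /total_weight.
rewrite (vertex_sumE _ us sN vs).
have := vertex_sumE (fun=> 1) us sN vs.
under eq_fsbigr do rewrite mulr1.
move=> ->; congr (_^-1 * _ + _).
by apply: eq_bigr => u _; rewrite mulr1.
Qed.

Lemma neighbors N v : vertex N v -> exists s : seq nat,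
  [/\ uniq s, {in s, forall u, vertex N u} & forall u, edge N v u -> u \in s].
Proof.
move=> Nv; exists (ball_list N v 1); split; first exact: ball_list_uniq.
  move=> u /ball_listP/ball_verticesS[->//|[w _ wu]].
  by apply: edge_vertex; rewrite edge_sym; exact: wu.
move=> u vu; apply/ball_listP/ball_verticesS; right; exists v => //.
exact: ball_vertices_root.
Qed.

Let interaction_le N s y v :
  `|waverage s (fun u => weight N u v)
    (fun u => phi (y u, y v, (mark N v).1, (mark N u).1))| <= Mphi.
Proof. by apply: waverage_le => // u; exact: weight_ge0. Qed.

(** The interaction is bounded whatever happens at the neighbors; only the
    difference at [v] itself matters. This bound is used on the boundary of a ball,
    where neighbors are missing. *)
Lemma drift_crude N N' y y' v (D : R) : vertex N v -> vertex N' v ->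
  mark N v = mark N' v -> `|y v - y' v| <= D ->
  `|drift phi psi N y v - drift phi psi N' y' v| <= 2 * Mphi + L * D.
Proof.
move=> Nv Nv' mv yD.
have [s [us sN vs]] := neighbors Nv; have [s' [us' sN' vs']] := neighbors Nv'.
rewrite (driftE _ us sN vs) (driftE _ us' sN' vs').
set a := waverage _ _ _; set b := waverage _ _ _.
have aM : `|a| <= Mphi by exact: interaction_le.
have bM : `|b| <= Mphi by exact: interaction_le.
have D0 : 0 <= D by apply: le_trans yD.
have pD : `|psi (y v, (mark N v).1) - psi (y' v, (mark N' v).1)| <= L * D.
  by apply: psi_lip => //; rewrite mv subrr normr0.
rewrite opprD addrACA (le_trans (ler_normD _ _))// lerD//.
by rewrite (le_trans (ler_normB _ _))//; lra.
Qed.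

Lemma net_ball_driftE x r y v : ball_vertices x (root x) r v ->
  drift phi psi (net_ball x (root x) r) y v =
  waverage (ball_list x (root x) r) (fun u => weight (net_ball x (root x) r) u v)
    (fun u => phi (y u, y v, (mark x v).1, (mark x u).1)) + psi (y v, (mark x v).1).
Proof.
move=> rv; rewrite (driftE (s := ball_list x (root x) r))//.
- exact: ball_list_uniq.
- by move=> u /ball_listP.
- by move=> u /net_ball_edge[_ ru _]; exact/ball_listP.
Qed.

(** At depth less than [r] a vertex has all its neighbors in the ball, so the drift
    of the ball is that of the network, at the price of looking one generation
    further. *)
Lemma drift_interior x r k y y' v (D : R) : (k < r)%N -> 0 <= D ->
  ball_vertices x (root x) k v ->
  (forall u, ball_vertices x (root x) k.+1 u -> `|y u - y' u| <= D) ->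
  `|drift phi psi x y v -
    drift phi psi (net_ball x (root x) r) y' v| <= 2 * L * D.
Proof.
move=> kr D0 kv yD; have rv := ball_vertices_le (ltnW kr) kv.
have kvS := ball_vertices_le (leqnSn k) kv.
have vs u : edge x v u -> u \in ball_list x (root x) r.
  by move=> vu; apply/ball_listP/(ball_vertices_le kr)/(ball_vertices_step kv vu).
rewrite net_ball_driftE// (driftE (s := ball_list x (root x) r)) ?ball_list_uniq//; last first.
  by move=> u /ball_listP; exact: rnet_ball_vertex.
rewrite opprD addrACA (le_trans (ler_normD _ _))//.
have -> : 2 * L * D = L * D + L * D by lra.
apply: lerD; last by apply: psi_lip; rewrite ?subrr ?normr0// yD.
have -> : waverage (ball_list x (root x) r)
    (fun u => weight (net_ball x (root x) r) u v)
    (fun u => phi (y' u, y' v, (mark x v).1, (mark x u).1)) =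
  waverage (ball_list x (root x) r) (fun u => weight x u v)
    (fun u => phi (y' u, y' v, (mark x v).1, (mark x u).1)).
  have e u : u \in ball_list x (root x) r ->
      weight (net_ball x (root x) r) u v = weight x u v.
    move=> /ball_listP ru /=; case: ifPn => // /negP nuv.
    apply/esym/weight0/negP => uv; apply: nuv; apply/and3P.
    by split=> //; exact/mem_set.
  rewrite /waverage; congr (_^-1 * _).
    by rewrite big_seq [RHS]big_seq; apply: eq_bigr.
  by rewrite big_seq [RHS]big_seq; apply: eq_bigr => u /e ->.
rewrite waverageB; apply: waverage_le; first exact: mulr_ge0.
  by move=> u; exact: weight_ge0.
move=> u us wu; apply: phi_lip; rewrite ?subrr ?normr0 ?yD//.
apply: ball_vertices_step kv _; rewrite edge_sym; apply/negPn/negP => uv.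
by rewrite weight0 ?eqxx in wu.
Qed.

(** The first term comes from moving positions and marks, the second from moving
    the weights. The constant in front of [delta] involves only the network [x],
    which is what makes the Euler scheme continuous at [x]. *)
Lemma drift_iso x (x' : rnet R (R * R)%type) r (f : nat -> nat) (a b : nat -> R) v (D delta : R) :
  graph_iso (net_ball x (root x) r) (net_ball x' (root x') r) f ->
  0 <= D -> delta <= D ->
  (forall u, ball_vertices x (root x) r u -> `|a u - b (f u)| <= D) ->
  (forall u, ball_vertices x (root x) r u ->
    `|(mark x u).1 - (mark x' (f u)).1| <= delta) ->
  (forall u v, edge (net_ball x (root x) r) u v ->
    `|weight (net_ball x (root x) r) u v -
      weight (net_ball x' (root x') r) (f u) (f v)| <= delta) ->
  ball_vertices x (root x) r v ->
  `|drift phi psi (net_ball x (root x) r) a v -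
    drift phi psi (net_ball x' (root x') r) b (f v)| <=
  2 * L * D + (\sum_(u <- ball_list x (root x) r) weight (net_ball x (root x) r) u v)^-1 *
    (2 * Mphi * ((size (ball_list x (root x) r))%:R * delta)).
Proof.
move=> fi D0 dD ab fm fw rv; have [[ffun finj fsurj] fe] := fi.
set s := ball_list x (root x) r; set Bx := net_ball x (root x) r.
set By := net_ball x' (root x') r.
have us : uniq (map f s).
  rewrite map_inj_in_uniq ?ball_list_uniq// => u u' /ball_listP ru /ball_listP ru'.
  by apply: finj; rewrite inE.
have sN : {in map f s, forall u, vertex By u}.
  by move=> _ /mapP[u /ball_listP ru ->]; exact: ffun.
have vs u : edge By (f v) u -> u \in map f s.
  move=> vu; have /net_ball_edge[_ /fsurj[u' ru' <-] _] := vu.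
  by apply: map_f; exact/ball_listP.
rewrite net_ball_driftE// (driftE _ us sN vs).
rewrite opprD addrACA (le_trans (ler_normD _ _))//.
set E := (X in _ <= _ + X).
have -> : 2 * L * D + E = (L * D + E) + L * D by lra.
apply: lerD; last first.
  by apply: psi_lip; [exact: ab|apply: le_trans dD; exact: fm].
have E0 : 0 <= E.
  have d0 : 0 <= delta by apply: le_trans (fm _ rv).
  apply: mulr_ge0; last by rewrite !mulr_ge0.
  by rewrite invr_ge0 sumr_ge0// => u _; exact: weight_ge0.
have -> : waverage (map f s) (fun u => weight By u (f v))
    (fun u => phi (b u, b (f v), (mark By (f v)).1, (mark By u).1)) =
  waverage s (fun u => weight By (f u) (f v))
    (fun u => phi (b (f u), b (f v), (mark x' (f v)).1, (mark x' (f u)).1)).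
  by rewrite /waverage !big_map.
set g := fun u => phi (a u, a v, _, _).
set g' := fun u => phi (b (f u), b (f v), _, _).
set w := fun u => weight Bx u v; set w' := fun u => weight By (f u) (f v).
have gg' : `|waverage s w' g - waverage s w' g'| <= L * D.
  rewrite waverageB; apply: waverage_le; first exact: mulr_ge0.
    by move=> u; exact: weight_ge0.
  by move=> u /ball_listP ru _; apply: phi_lip; rewrite ?ab// (le_trans (fm _ _)).
have -> : waverage s w g - waverage s w' g' =
    (waverage s w g - waverage s w' g) + (waverage s w' g - waverage s w' g') by lra.
rewrite (le_trans (ler_normD _ _))// [leRHS]addrC lerD//.
have ww' u : u \in s -> `|w u - w' u| <= delta.
  move=> /ball_listP ru; rewrite /w /w'.
  have [uv|nuv] := boolP (edge Bx u v); first exact: fw.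
  rewrite weight0// weight0 ?subrr ?normr0; first exact: le_trans (fm _ rv).
  by rewrite fe.
have w0 u : 0 <= w u by exact: weight_ge0.
have w'0 u : 0 <= w' u by exact: weight_ge0.
have Wzero (c : nat -> R) : (forall u, 0 <= c u) -> \sum_(u <- s) c u = 0 ->
    forall u, u \in s -> c u = 0.
  move=> c0 /eqP; rewrite psumr_eq0// => /allP h u us'.
  by apply/eqP; exact: h.
(* Weights vanish exactly off the edges, so both averages are degenerate at the
   same time. *)
have wz u : u \in s -> (w u == 0) = (w' u == 0).
  move=> /ball_listP ru; have := fe u v ru rv; rewrite /w /w'.
  have [uv|nuv] := boolP (edge Bx u v) => fuv.
    by rewrite !gt_eqF//; apply: weight_gt0.
  by rewrite !weight0 ?fuv.
have zero_avg (c h : nat -> R) : \sum_(u <- s) c u = 0 -> waverage s c h = 0.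
  by move=> c0; rewrite /waverage c0 invr0 mul0r.
have [W0|Wn0] := eqVneq (\sum_(u <- s) w u) 0.
  rewrite (zero_avg w)// (zero_avg w') ?subrr ?normr0//.
  by rewrite big_seq big1// => u us'; apply/eqP; rewrite -wz// (Wzero w).
have W'n0 : \sum_(u <- s) w' u != 0.
  apply: contra Wn0 => /eqP W'0; rewrite big_seq big1// => u us'.
  by apply/eqP; rewrite wz// (Wzero w').
apply: waverage_weights => //; first by move=> u; exact: phi_le.
rewrite big_seq (le_trans (ler_sum _ ww'))// -big_seq.
by rewrite big_const_seq count_predT iter_addr addr0 mulr_natl.
Qed.

End Drift.

(** * The Euler scheme on a ball *)

Section EulerScheme.
Variables (R : realType) (T : R) (phi : R * R * R * R -> R) (psi : R * R -> R).
Variables (Mphi L : R).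
Hypothesis T_gt0 : 0 < T.
Hypotheses (Mphi_ge0 : 0 <= Mphi) (L_ge0 : 0 <= L).
Hypothesis phi_le : forall p, `|phi p| <= Mphi.
Hypothesis phi_lip : forall a b c e a' b' c' e' (D : R),
  `|a - a'| <= D -> `|b - b'| <= D -> `|c - c'| <= D -> `|e - e'| <= D ->
  `|phi (a, b, c, e) - phi (a', b', c', e')| <= L * D.
Hypothesis psi_lip : forall a b a' b' (D : R),
  `|a - a'| <= D -> `|b - b'| <= D -> `|psi (a, b) - psi (a', b')| <= L * D.

Implicit Types (N : network R (R * R)%type) (x : rnet R (R * R)%type).

(** The integral equation along one fixed path [b] of the noise. *)
Definition solves N (theta : nat -> cpath T) (b : nat -> R -> R) : Prop :=
  forall v t, vertex N v -> 0 <= t <= T ->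
    theta v t = (mark N v).2 +
      (\int[lebesgue_measure]_(s in `[0%R, t])
          drift phi psi N (fun u => theta u s) v)%R + b v t.

(** Applied to the interaction along an edge, with [y] and [z] the trajectories at its
    two ends, and to the intrinsic drift. *)
Lemma lip_comp_continuous (A : set R) (y z f : R -> R) :
  {within A, continuous y} -> {within A, continuous z} ->
  (forall s t D, `|y s - y t| <= D -> `|z s - z t| <= D -> `|f s - f t| <= L * D) ->
  {within A, continuous f}.
Proof.
move=> /subspace_continuousP cy /subspace_continuousP cz lf.
apply/subspace_continuousP => t At; apply/cvgrPdist_le => e e0.
have L1 : 0 < L + 1 by rewrite ltr_wpDl.
have d0 : 0 < e / (L + 1) by rewrite divr_gt0.
have /cvgrPdist_le/(_ _ d0) Hy := cy _ At.
have /cvgrPdist_le/(_ _ d0) Hz := cz _ At.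
near=> s.
have ys : `|y t - y s| <= e / (L + 1) by near: s.
have zs : `|z t - z s| <= e / (L + 1) by near: s.
rewrite (le_trans (lf _ _ _ ys zs))// mulrA ler_pdivrMr// mulrC.
by rewrite ler_wpM2l ?(ltW e0)// lerDl.
Unshelve. all: by end_near. Qed.

Lemma drift_path_continuous N (theta : nat -> cpath T) v : vertex N v ->
  {within `[0, T], continuous (fun s => drift phi psi N (fun u => theta u s) v)}.
Proof.
move=> Nv; have [s [us sN vs]] := neighbors Nv.
under [X in continuous X]eq_fun do rewrite (driftE phi psi _ us sN vs).
have ct u := @path_continuous _ _ (theta u).
move=> t; apply: cvgD; last first.
  apply: (@lip_comp_continuous _ (theta v) (theta v)) => // a b D ab _.
  apply: psi_lip => //; rewrite subrr normr0; exact: le_trans ab.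
apply: cvgMr; apply: cvg_big => [|u _]; first exact: add_continuous.
apply: cvgMr.
apply: (@lip_comp_continuous _ (theta u) (theta v)) => // a b D ab ab'.
by apply: phi_lip => //; rewrite subrr normr0; exact: le_trans ab.
Qed.

(** Integrate the difference between the drift and its frozen value [c]. *)
Lemma solves_increment N theta b v s t c D : solves N theta b -> vertex N v ->
  0 <= s -> s <= t -> t <= T ->
  (forall u, s <= u <= t ->
    `|drift phi psi N (fun w => theta w u) v - c| <= D) ->
  `|theta v t - theta v s - (t - s) * c - (b v t - b v s)| <= (t - s) * D.
Proof.
move=> sol Nv s0 st tT gc.
set g := fun u : R => drift phi psi N (fun w => theta w u) v.
have cg : lebesgue_measure.-integrable `[0, T] (EFin \o g).
  apply: continuous_compact_integrable; first exact: segment_compact.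
  exact: drift_path_continuous.
have sub (i : interval R) : [set` i] `<=` `[0, T]%classic ->
    lebesgue_measure.-integrable [set` i] (EFin \o g).
  by move=> iT; apply: integrableS cg.
have g0t : lebesgue_measure.-integrable `[0, t] (EFin \o g).
  by apply: sub => u; rewrite /= !in_itv/= => /andP[-> ut]; rewrite (le_trans ut).
have gst : lebesgue_measure.-integrable `]s, t] (EFin \o g).
  apply: sub => u; rewrite /= !in_itv/= => /andP[su ut].
  by rewrite (le_trans ut)// (le_trans s0 (ltW su)).
have mst : (lebesgue_measure `]s, t]%classic < +oo)%E.
  by rewrite lebesgue_measure_itv/=; case: ifP; rewrite ?ltry.
have fst' : fine (lebesgue_measure `]s, t]%classic) = t - s.
  rewrite lebesgue_measure_itv/= lte_fin; case: ltP => //= ts.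
  by apply/eqP; rewrite eq_sym subr_eq0 eq_le st ts.
have ci (a : R) : lebesgue_measure.-integrable `]s, t] (EFin \o (fun=> a)).
  apply: measurable_bounded_integrable => //.
  exact: bounded_cst.
have tI : 0 <= t <= T by rewrite (le_trans s0 st).
have sI : 0 <= s <= T by rewrite s0 (le_trans st).
rewrite (sol _ _ Nv tI) (sol _ _ Nv sI).
have := Rintegral_itvB g0t (x := s).
rewrite !bnd_simp => /(_ s0 st) E.
rewrite -/g.
have -> : (mark N v).2 + \int[lebesgue_measure]_(u in `[0, t]) g u + b v t -
   ((mark N v).2 + \int[lebesgue_measure]_(u in `[0, s]) g u + b v s) -
   (t - s) * c - (b v t - b v s) =
   \int[lebesgue_measure]_(u in `[0, t]) g u -
   \int[lebesgue_measure]_(u in `[0, s]) g u - (t - s) * c by lra.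
have igc : lebesgue_measure.-integrable `]s, t] (EFin \o (fun u => g u - c)).
  have -> : EFin \o (fun u => g u - c) =
      (fun u => (EFin \o g) u - (EFin \o (fun=> c)) u)%E.
    by apply/funext => u; rewrite /= EFinB.
  apply: integrableB => //; exact: ci.
rewrite E -fst' [_ * c]mulrC -Rintegral_cst// -RintegralB//.
rewrite (le_trans (le_normr_Rintegral _ igc))//.
rewrite [leRHS]mulrC -Rintegral_cst//; apply: le_Rintegral => //.
  exact: integrable_norm igc.
by move=> u; rewrite /= in_itv/= => /andP[su ut]; rewrite gc// (ltW su).
Qed.

(** The value at vertex [v] after [j] steps, where [z v j] is the increment of the
    noise at [v] during step [j]. *)
Fixpoint euler N (m : nat) (z : nat -> nat -> R) (j v : nat) : R :=
  match j with
  | 0 => (mark N v).2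
  | j.+1 => euler N m z j v + mesh T m * drift phi psi N (euler N m z j) v + z v j
  end.

(** A vertex at depth [k] of the ball is [r - k] generations away from the region
    where the drift is wrong. The weight [2 ^+ k / 2 ^+ r] decays towards the root:
    the drift at depth [k < r] reads the error at depth [k.+1], hence loses a factor
    two, and this loss is absorbed by the exponential rate [4 * L + 1]. At depth
    [r] the bounded interaction costs [2 * Mphi], the leading term of [K]. The
    other term of [K] is the discretization error, with [omega] a modulus of
    continuity of the solution and [q] the precision of the increments; it vanishes
    with the mesh for fixed [r]. *)
Lemma euler_cvg x theta b r m z (omega q : R) (Lam := 4 * L + 1)
    (K := 2 * Mphi + 2 ^+ r * (2 * L * omega + q)) :
  solves x theta b -> 0 <= omega -> 0 <= q ->
  (forall v, ball_vertices x (root x) r v -> b v 0 = 0) ->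
  (forall v, ball_vertices x (root x) r v ->
    forall s t, 0 <= s <= T -> 0 <= t <= T -> `|s - t| <= mesh T m ->
    `|theta v s - theta v t| <= omega) ->
  (forall v j, ball_vertices x (root x) r v -> (j < m.+1)%N ->
    `|z v j - (b v (gridpt T m j.+1) - b v (gridpt T m j))| <= mesh T m * q) ->
  forall j k v, (j <= m.+1)%N -> (k <= r)%N -> ball_vertices x (root x) k v ->
    `|euler (net_ball x (root x) r) m z j v - theta v (gridpt T m j)| <=
    2 ^+ k / 2 ^+ r * (K * expR (Lam * gridpt T m j)).
Proof.
move=> sol w0 q0 b0 thw zq.
have h0 := mesh_gt0 T_gt0 m.
have p0 n : 0 < 2 ^+ n :> R by rewrite exprn_gt0.
have K1 : 0 <= 2 * L * omega + q by rewrite addr_ge0 ?mulr_ge0.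
have K0 : 0 <= K by rewrite addr_ge0 ?mulr_ge0// ltW.
elim=> [|j IH] k v jm kr kv.
  have xv := rnet_ball_vertex kv.
  rewrite /gridpt mulr0 /= sol ?lexx ?(ltW T_gt0)// b0; last exact: ball_vertices_le kr _ kv.
  rewrite set_itv1 Rintegral_set1 !addr0 subrr normr0.
  by rewrite mulr_ge0 ?divr_ge0 ?(ltW (p0 _))// mulr_ge0// expR_ge0.
have {}IH := IH _ _ (ltnW jm).
have xv := rnet_ball_vertex kv; have rv := ball_vertices_le kr kv.
set A := K * expR (Lam * gridpt T m j) in IH *.
have AK : K <= A.
  rewrite ler_peMr// -expR0 ler_expR mulr_ge0//.
    by rewrite /Lam addr_ge0 ?mulr_ge0.
  exact: gridpt_ge0.
have A0 : 0 <= A := le_trans K0 AK.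
set a := 2 ^+ k / 2 ^+ r : R.
have a0 : 0 <= a by rewrite ltW// divr_gt0.
have a2r : 2 ^+ r * a >= 1.
  by rewrite /a mulrCA divff ?gt_eqF// mulr1 exprn_ege1// ler1n.
set Y := euler (net_ball x (root x) r) m z j in IH *.
set c := drift phi psi (net_ball x (root x) r) Y v.
have tS := gridptS T m j.
have tT := gridpt_leT T_gt0 jm; have tge := gridpt_ge0 T_gt0 m j.
have tjT := gridpt_leT T_gt0 (ltnW jm).
have ssub u : gridpt T m j <= u <= gridpt T m j.+1 ->
    [/\ 0 <= u <= T, 0 <= gridpt T m j <= T & `|u - gridpt T m j| <= mesh T m].
  move=> /andP[tu ut]; split.
  - by rewrite (le_trans tge)// (le_trans ut).
  - by rewrite tge.
  - by rewrite ger0_norm; lra.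
have aK : 2 * L * omega + q <= a * K.
  rewrite /K mulrDr; apply: (@le_trans _ _ (a * (2 ^+ r * (2 * L * omega + q)))).
    by rewrite mulrA [a * _]mulrC ler_peMl.
  by rewrite lerDr !mulr_ge0.
have close u w : ball_vertices x (root x) r w ->
    gridpt T m j <= u <= gridpt T m j.+1 ->
    `|theta w u - theta w (gridpt T m j)| <= omega.
  by move=> rw /ssub[? ? ?]; apply: thw.
(* The error on the drift, at inner depths and at depth [r]; in both cases it fits
   in the budget of one step. *)
have inc : exists2 E, 0 <= E /\ E + q <= a * K + 4 * L * (a * A) &
   (forall u, gridpt T m j <= u <= gridpt T m j.+1 ->
    `|drift phi psi x (fun w => theta w u) v - c| <= E).
  have [kr'|rk] := ltnP k r.
    have aS : 2 ^+ k.+1 / 2 ^+ r = 2 * a :> R by rewrite exprS mulrA.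
    exists (2 * L * (omega + 2 * a * A)).
      split; first by rewrite !mulr_ge0// addr_ge0// !mulr_ge0.
      by move: aK; lra.
    move=> u tu.
    apply: (drift_interior L_ge0 phi_lip psi_lip kr' _ kv).
      by rewrite addr_ge0 ?mulr_ge0.
    move=> w kw; have rw := ball_vertices_le kr' kw.
    rewrite (le_trans (ler_distD (theta w (gridpt T m j)) _ _))// lerD ?close//.
    by rewrite distrC -aS; exact: IH.
  have kE : k = r by apply/eqP; rewrite eqn_leq kr.
  have a1 : a = 1 by rewrite /a kE divff// gt_eqF.
  exists (2 * Mphi + L * (omega + A)).
    split; first by rewrite addr_ge0 ?mulr_ge0// addr_ge0.
    have := mulr_ge0 L_ge0 w0; have := mulr_ge0 L_ge0 A0.
    have : 1 * (2 * L * omega + q) <= 2 ^+ r * (2 * L * omega + q).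
      by rewrite ler_wpM2r// exprn_ege1// ler1n.
    by rewrite a1 /K; lra.
  move=> u tu; apply: drift_crude => //.
  rewrite (le_trans (ler_distD (theta v (gridpt T m j)) _ _))// lerD ?close//.
  rewrite distrC; have := IH _ _ kr kv; by rewrite -/a a1 mul1r.
have [E [E0 EK] Eb] := inc.
have tjS : gridpt T m j <= gridpt T m j.+1 by rewrite tS lerDl ltW.
have := solves_increment sol xv tge tjS tT Eb.
have -> : gridpt T m j.+1 - gridpt T m j = mesh T m by rewrite tS addrC addKr.
move=> S1; have S2 := zq _ _ rv jm; have S3 := IH _ _ kr kv.
rewrite -/a in S3.
rewrite /= -/Y -/c.
set th1 := theta v (gridpt T m j.+1) in S1 *; set th0 := theta v (gridpt T m j) in S1 S3.
set db := b v _ - b v _ in S1 S2.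
apply: (@le_trans _ _ (a * A + mesh T m * (E + q))).
  have -> : Y v + mesh T m * c + z v j - th1 =
    (Y v - th0) - (th1 - th0 - mesh T m * c - db) + (z v j - db) by lra.
  apply: (le_trans (ler_normD _ _)).
  rewrite [mesh T m * (E + q)]mulrDr [leRHS]addrA lerD//.
  by rewrite (le_trans (ler_normB _ _))// lerD.
have step : A * (1 + Lam * mesh T m) <= K * expR (Lam * gridpt T m j.+1).
  rewrite /A tS [Lam * (_ + _)]mulrDr expRD mulrA.
  by rewrite ler_wpM2l ?expR_ge1Dx// mulr_ge0// expR_ge0.
apply: (@le_trans _ _ (a * (A * (1 + Lam * mesh T m)))); last by rewrite ler_wpM2l.
have : mesh T m * (E + q) <= mesh T m * (a * A + 4 * L * (a * A)).
  rewrite ler_wpM2l ?(ltW h0)// (le_trans EK)// lerD2r.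
  by rewrite ler_wpM2l.
by rewrite /Lam; lra.
Qed.

(** The scheme on a fixed ball depends continuously on marks and weights. The bound
    involves the two networks only through [delta] and a constant [Gam] attached to
    [x], and is uniform in the number of steps. *)
Lemma euler_stable x (y : rnet R (R * R)%type) r (f : nat -> nat) m z z' (delta Gam : R)
    (Lam := 2 * L + 1) (K := delta * (1 + 2 * L + 2 * Mphi * Gam)) :
  graph_iso (net_ball x (root x) r) (net_ball y (root y) r) f ->
  0 <= delta -> 0 <= Gam ->
  (forall u, ball_vertices x (root x) r u ->
    `|(mark x u).1 - (mark y (f u)).1| <= delta /\
    `|(mark x u).2 - (mark y (f u)).2| <= delta) ->
  (forall u v, edge (net_ball x (root x) r) u v ->
    `|weight (net_ball x (root x) r) u v -
      weight (net_ball y (root y) r) (f u) (f v)| <= delta) ->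
  (forall v, ball_vertices x (root x) r v ->
    (\sum_(u <- ball_list x (root x) r) weight (net_ball x (root x) r) u v)^-1 *
    (size (ball_list x (root x) r))%:R <= Gam) ->
  (forall v j, ball_vertices x (root x) r v -> z' (f v) j = z v j) ->
  forall j v, ball_vertices x (root x) r v ->
    `|euler (net_ball x (root x) r) m z j v -
      euler (net_ball y (root y) r) m z' j (f v)| <=
    K * expR (Lam * gridpt T m j).
Proof.
move=> fi d0 G0 fm fw fG zz; have h0 := mesh_gt0 T_gt0 m.
have MG0 : 0 <= 2 * Mphi * Gam by rewrite !mulr_ge0.
have Kd : delta <= K.
  by rewrite ler_peMr// -addrA lerDl addr_ge0 ?mulr_ge0.
have K0 : 0 <= K := le_trans d0 Kd.
elim=> [|j IH] v rv.
  by rewrite /gridpt !mulr0 expR0 mulr1 (le_trans (fm _ rv).2).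
set A := K * expR (Lam * gridpt T m j) in IH *.
have AK : K <= A.
  rewrite ler_peMr// -expR0 ler_expR mulr_ge0//.
    by rewrite /Lam addr_ge0 ?mulr_ge0.
  exact: gridpt_ge0.
have A0 : 0 <= A := le_trans K0 AK.
have dA := le_trans Kd AK.
rewrite /= zz//.
set Y := euler _ m z j in IH *; set Y' := euler _ m z' j in IH *.
have D := drift_iso Mphi_ge0 L_ge0 phi_le phi_lip psi_lip fi A0 dA IH
  (fun u ru => (fm u ru).1) fw rv.
set c := drift _ _ _ Y v in D *; set c' := drift _ _ _ Y' _ in D *.
have {}D : `|c - c'| <= 2 * L * A + K.
  apply: le_trans D _; rewrite lerD2l.
  set W := (\sum_(u <- _) _)^-1; set n := (size _)%:R.
  have -> : W * (2 * Mphi * (n * delta)) = 2 * Mphi * delta * (W * n) by lra.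
  apply: (@le_trans _ _ (2 * Mphi * delta * Gam)).
    by rewrite ler_wpM2l ?mulr_ge0// fG.
  have := mulr_ge0 d0 L_ge0; by rewrite /K; lra.
have -> : Y v + mesh T m * c + z v j - (Y' (f v) + mesh T m * c' + z v j) =
  (Y v - Y' (f v)) + mesh T m * (c - c') by lra.
rewrite (le_trans (ler_normD _ _))// normrM (gtr0_norm h0).
have step : A * (1 + Lam * mesh T m) <= K * expR (Lam * gridpt T m j.+1).
  rewrite /A gridptS [Lam * (_ + _)]mulrDr expRD mulrA.
  by rewrite ler_wpM2l ?expR_ge1Dx// mulr_ge0// expR_ge0.
apply: le_trans step.
have : mesh T m * `|c - c'| <= mesh T m * (2 * L * A + A).
  by rewrite ler_wpM2l ?(ltW h0)// (le_trans D)// lerD2l.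
by have := IH _ rv; rewrite /Lam; lra.
Qed.

End EulerScheme.

(** * Euler networks *)

(** A ball has finitely many vertices, so convergence holds uniformly over it. *)
Lemma near_all_in (s : seq nat) (P : nat -> nat -> Prop) :
  (forall v, v \in s -> \forall m \near \oo, P v m) ->
  \forall m \near \oo, forall v, v \in s -> P v m.
Proof.
elim: s => [|u s IH] H; first by near=> m => v; rewrite in_nil.
have Hu := H u (mem_head _ _).
have Hs : \forall m \near \oo, forall v, v \in s -> P v m.
  by apply: IH => v vs; apply: H; rewrite inE vs orbT.
near=> m => v; rewrite inE => /orP[/eqP->|]; first by near: m.
by move: v; near: m.
Unshelve. all: by end_near. Qed.

Lemma near_inv_le (R : realType) (e : R) : 0 < e ->
  \forall n \near \oo, (1 + n%:R)^-1 <= e.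
Proof.
move=> e0; near=> n.
have n0 : 0 < 1 + n%:R :> R by rewrite ltr_wpDr.
rewrite -[leRHS]invrK lef_pV2 ?posrE ?invr_gt0//.
have : (Num.truncn e^-1 <= n)%N by near: n; exact: nbhs_infty_ge.
move=> H; rewrite addrC natr1 ltW// (lt_le_trans (truncnS_gt _))//.
by rewrite ler_nat ltnS.
Unshelve. all: by end_near. Qed.

(** The bound [2 * e] rather than [e] leaves room for the Lipschitz constant being
    an infimum which need not be attained. *)
Lemma bl_norm_bounds (R : realType) (X : pseudoMetricType R) (F : X -> R) :
  (bl_norm F <= 1)%E -> (forall a, `|F a| <= 1) /\
  (forall a b e, 0 < e -> ball a e b -> `|F a - F b| <= 2 * e).
Proof.
rewrite /bl_norm; set S := ereal_sup _; set I := ereal_inf _ => SI1.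
have I0 : (0 <= I)%E.
  by apply/ereal_infP => _ [K [K0 _] <-]; rewrite lee_fin.
have FS a : (`|F a|%:E <= S)%E by apply: ereal_sup_ubound; exists a.
split=> [a|a b e e0 ab].
  rewrite -lee_fin (le_trans _ SI1)// (le_trans (FS a))// leeDl//.
have S0 : (0 <= S)%E by rewrite (le_trans _ (FS a))// lee_fin.
have I2 : (I < 2%:E)%E.
  rewrite (@le_lt_trans _ _ 1%E)// ?lte_fin ?ltr1n// (le_trans _ SI1)// leeDr//.
have [_ [K [K0 FK] <-]] := ereal_inf_lt I2; rewrite lte_fin => K2.
rewrite -lee_fin (le_trans (FK a b))//.
apply: (@le_trans _ _ (K%:E * e%:E)%E).
  by rewrite lee_wpmul2l ?lee_fin// ; apply: ereal_inf_lbound; exists e.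
by rewrite -EFinM lee_fin ler_wpM2r ?(ltW e0)// ltW.
Qed.

Section Isomorphisms.
Variables (R : realType) (M : pseudoMetricType R).
Implicit Types x y : rnet R M.

Lemma graph_iso_inverse (N N' : network R M) f : graph_iso N N' f ->
  exists g, [/\ graph_iso N' N g, forall v, vertex N v -> g (f v) = v &
    forall w, vertex N' w -> f (g w) = w].
Proof.
move=> [fbij fe]; have [g [gbij gf fg]] := set_bij_inverse fbij.
have [gfun _ _] := gbij.
exists g; split=> //; split=> // u v yu yv.
by rewrite -fe ?fg//; exact: gfun.
Qed.

(** The inner balls are determined by the graph structure of the outer one. *)
Lemma graph_iso_restrict x y r s f : (s <= r)%N ->
  graph_iso (net_ball x (root x) r) (net_ball y (root y) r) f ->
  f (root x) = root y ->
  graph_iso (net_ball x (root x) s) (net_ball y (root y) s) f /\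
  forall v, ball_vertices x (root x) r v ->
    (ball_vertices x (root x) s v <-> ball_vertices y (root y) s (f v)).
Proof.
move=> sr fi fr; have [[ffun finj fsurj] fe] := fi.
have [g [gi gf fg]] := graph_iso_inverse fi.
have gr : g (root y) = root x.
  by rewrite -fr gf//; exact: ball_vertices_root.
have ballP (z : rnet R M) w : ball_vertices z (root z) s w -> ball_vertices z (root z) r w.
  exact: ball_vertices_le.
have transfer (z z' : rnet R M) h : graph_iso (net_ball z (root z) r) (net_ball z' (root z') r) h ->
    h (root z) = root z' -> forall t v, (t <= r)%N ->
    ball_vertices z (root z) t v -> ball_vertices z' (root z') t (h v).
  move=> hi hr; elim=> [|t IH] v tr.
    by rewrite !ball_vertices0 => ->.
  move/ball_verticesS=> [->|[u zu uv]].
    by rewrite hr; exact: ball_vertices_root.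
  apply/ball_verticesS; right; exists (h u); first exact: IH (ltnW tr) zu.
  suff /(graph_iso_edge hi)/net_ball_edge[] : edge (net_ball z (root z) r) u v by [].
  apply/net_ball_edge; split=> //; first exact: ball_vertices_le (ltnW tr) _ zu.
  exact: (ball_vertices_le tr) (ball_vertices_step zu uv).
have fs v := transfer _ _ _ fi fr s v sr.
have gs v := transfer _ _ _ gi gr s v sr.
split; last by move=> v rv; split=> [/fs//|/gs]; rewrite gf.
split; first split=> //=.
- by move=> u v; rewrite !inE => /ballP xu /ballP xv; apply: finj; rewrite inE.
- move=> v yv; exists (g v); first exact: gs.
  by apply: fg; exact: ballP.
- move=> u v xu xv; have := fe u v (ballP _ _ xu) (ballP _ _ xv).
  by rewrite /= !mem_set//; try exact: fs; try exact: ballP; apply: ballP; exact: fs.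
Qed.

End Isomorphisms.

Section MarkedNetworks.
Variables (R : realType) (T : R).
Implicit Types (x y : rnet R (R * R)%type).

Definition with_paths x (p : nat -> cpath T) : rnet R (R * cpath T)%type :=
  rset_marks x (fun v => ((mark x v).1, p v)).

Lemma with_paths_iso_near x y f s (delta e : R) (p q : nat -> cpath T) :
  0 < delta -> (1 + s%:R)^-1 + delta < e ->
  graph_iso (net_ball x (root x) s) (net_ball y (root y) s) f ->
  f (root x) = root y ->
  (forall v, ball_vertices x (root x) s v ->
    `|(mark x v).1 - (mark y (f v)).1| < delta /\
    (sup_dist (p v) (q (f v)) < delta%:E)%E) ->
  (forall u v, edge (net_ball x (root x) s) u v ->
    `|weight (net_ball x (root x) s) u v -
      weight (net_ball y (root y) s) (f u) (f v)| < delta) ->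
  ball (nclass (with_paths x p)) e (nclass (with_paths y q)).
Proof.
move=> d0 se fi fr fm fw; rewrite /ball/= /nball ndistE.
apply: (@le_lt_trans _ _ ((1 + s%:R)^-1 + delta)%:E); last by rewrite lte_fin.
apply: ereal_inf_lbound; exists s, delta; split=> //.
by exists f; split.
Qed.

Lemma sup_dist_refl (p : cpath T) : (sup_dist p p <= 0)%E.
Proof. by apply: ge_ereal_sup => _ [t _ <-]; rewrite subrr normr0. Qed.

Lemma with_paths_near x s (delta e : R) (p q : nat -> cpath T) :
  0 < delta -> (1 + s%:R)^-1 + delta < e ->
  (forall v, ball_vertices x (root x) s v -> (sup_dist (p v) (q v) < delta%:E)%E) ->
  ball (nclass (with_paths x p)) e (nclass (with_paths x q)).
Proof.
move=> d0 se pq; apply: (@with_paths_iso_near _ _ id s delta) => //.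
- by split=> //; split=> // v; exists v.
- by move=> v xv; rewrite subrr normr0; split=> //; exact: pq.
- by move=> u v _; rewrite subrr normr0.
Qed.

Variables (phi : R * R * R * R -> R) (psi : R * R -> R).
Variables (Mphi L : R).
Hypothesis T_gt0 : 0 < T.
Hypotheses (Mphi_ge0 : 0 <= Mphi) (L_ge0 : 0 <= L).
Hypothesis phi_le : forall p, `|phi p| <= Mphi.
Hypothesis phi_lip : forall a b c e a' b' c' e' (D : R),
  `|a - a'| <= D -> `|b - b'| <= D -> `|c - c'| <= D -> `|e - e'| <= D ->
  `|phi (a, b, c, e) - phi (a', b', c', e')| <= L * D.
Hypothesis psi_lip : forall a b a' b' (D : R),
  `|a - a'| <= D -> `|b - b'| <= D -> `|psi (a, b) - psi (a', b')| <= L * D.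

(** The noise is set to [0] and the path to a default value off the ball, so that
    the result is a function of the noise inside the ball only. *)
Definition euler_path x r m z (v : nat) : cpath T :=
  if v \in ball_list x (root x) r then
    polygon_path T m (fun j => euler T phi psi (net_ball x (root x) r) m
      (fun u i => if u \in ball_list x (root x) r then z u i else 0) j v)
  else point.

Definition euler_net x r m z := with_paths x (euler_path x r m z).

Definition noise_code (b : nat -> R -> R) m (v : nat) : {ffun 'I_m.+1 -> code_type m} :=
  [ffun j : 'I_m.+1 => encode m (b v (gridpt T m j.+1) - b v (gridpt T m j))].

Definition read_code m n (c : {ffun 'I_n -> code_type m}) (j : nat) : R :=
  if insub j is Some i then decode R (c i) else 0.

Definition coded_noise (b : nat -> R -> R) m (v : nat) : nat -> R :=
  read_code (noise_code b m v).

(** The rounding error [(m+1)^-2] is small compared with the mesh. *)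
Lemma coded_noise_cvg (b : nat -> R -> R) v (q : R) : 0 < q ->
  {within `[0, T], continuous (b v)} ->
  \forall m \near \oo, forall j, (j < m.+1)%N ->
    `|coded_noise b m v j - (b v (gridpt T m j.+1) - b v (gridpt T m j))| <=
      mesh T m * q.
Proof.
move=> q0 cb.
have [C Cb] : exists C, forall t, 0 <= t <= T -> `|b v t| <= C.
  have /compact_bounded[M [_ Mb]] := continuous_compact cb (@segment_compact _ 0 T).
  exists (M + 1) => t tT; apply: (Mb (M + 1)); first by rewrite ltrDl.
  by exists t => //; rewrite /= in_itv.
have Tq : 0 < T * q by rewrite mulr_gt0.
near=> m => j jm; set db := b v _ - b v _.
have m0 : 0 < m.+1%:R :> R by [].
have dbm : `|db| <= m.+1%:R.
  apply: (@le_trans _ _ (2 * C)).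
    rewrite (le_trans (ler_normB _ _))// mulrDl mul1r lerD// Cb//.
      by rewrite gridpt_ge0// gridpt_leT.
    by rewrite gridpt_ge0// gridpt_leT// ltnW.
  have : (Num.truncn (2 * C) <= m)%N by near: m; exact: nbhs_infty_ge.
  by move=> H; rewrite ltW// (lt_le_trans (truncnS_gt _))// ler_nat ltnS.
have -> : coded_noise b m v j = decode R (encode m db).
  by rewrite /coded_noise /read_code insubT /= ffunE.
rewrite (le_trans (encodeK dbm))// expr2 invfM /mesh mulrAC ler_pM2r ?invr_gt0//.
by rewrite -natr1 addrC; near: m; exact: near_inv_le.
Unshelve. all: by end_near. Qed.

(** The ball has radius [s + s] while the paths are compared at depth at most [s]:
    these vertices are [s] generations away from the boundary. *)
Lemma euler_path_cvg x theta b s (delta : R) (Lam := 4 * L + 1) :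
  solves phi psi x theta b ->
  (forall v, b v 0 = 0) -> (forall v, {within `[0, T], continuous (b v)}) ->
  2 * Mphi * expR (Lam * T) / 2 ^+ s < delta ->
  \forall m \near \oo, forall v, ball_vertices x (root x) s v ->
    (sup_dist (euler_path x (s + s) m (coded_noise b m) v) (theta v) < delta%:E)%E.
Proof.
move=> sol b0 bc dlt.
set c0 := 2 * Mphi * _ / _ in dlt.
have p0 n : 0 < 2 ^+ n :> R by rewrite exprn_gt0.
have e0 : 0 < expR (Lam * T) by rewrite expR_gt0.
(* [C * w] gathers all errors which vanish with the mesh: discretization, rounding
   and interpolation. *)
pose C := 2 ^+ s * (2 * L + 1) * expR (Lam * T) + 1.
have C0 : 0 < C.
  by rewrite ltr_wpDl// mulr_ge0 ?(ltW e0)// mulr_ge0 ?(ltW (p0 _))// addr_ge0 ?mulr_ge0.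
pose w := (delta - c0) / (2 * C).
have w0 : 0 < w by rewrite divr_gt0 ?subr_gt0// mulr_gt0.
have wC : C * w < delta - c0.
  have -> : C * w = (delta - c0) / 2.
    by rewrite /w invfM mulrCA (mulrCA C) mulfV ?mulr1// gt_eqF.
  by rewrite ltr_pdivrMr//; move: dlt; lra.
have near_mod : \forall m \near \oo, forall v, v \in ball_list x (root x) (s + s) ->
    forall a t, 0 <= a <= T -> 0 <= t <= T -> `|a - t| <= mesh T m ->
      `|theta v a - theta v t| <= w.
  by apply: near_all_in => v _; exact: cpath_modulus.
have near_noise : \forall m \near \oo, forall v, v \in ball_list x (root x) (s + s) ->
    forall j, (j < m.+1)%N ->
    `|coded_noise b m v j - (b v (gridpt T m j.+1) - b v (gridpt T m j))| <=
      mesh T m * w.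
  by apply: near_all_in => v _; exact: coded_noise_cvg.
near=> m => v sv.
have sv2 := ball_vertices_le (leq_addr s s) sv.
rewrite /euler_path ifT; last exact/ball_listP.
have M1 : forall v, v \in ball_list x (root x) (s + s) ->
    forall a t, 0 <= a <= T -> 0 <= t <= T -> `|a - t| <= mesh T m ->
      `|theta v a - theta v t| <= w by near: m.
have M2 : forall v, v \in ball_list x (root x) (s + s) ->
    forall j, (j < m.+1)%N ->
    `|coded_noise b m v j - (b v (gridpt T m j.+1) - b v (gridpt T m j))| <=
      mesh T m * w by near: m.
set K := 2 * Mphi + 2 ^+ (s + s) * (2 * L * w + w).
set z := fun u i => if u \in ball_list x (root x) (s + s) then coded_noise b m u i else 0.
have K0 : 0 <= K.
  apply: addr_ge0; first exact: mulr_ge0.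
  apply: mulr_ge0; first exact: ltW.
  by have := mulr_ge0 L_ge0 (ltW w0); move: w0; lra.
have H j : (j <= m.+1)%N ->
    `|euler T phi psi (net_ball x (root x) (s + s)) m z j v -
      theta v (gridpt T m j)| <= 2 ^+ s / 2 ^+ (s + s) * (K * expR (Lam * T)).
  move=> jm; apply: (le_trans (euler_cvg T_gt0 Mphi_ge0 L_ge0 phi_le phi_lip psi_lip
    sol (ltW w0) (ltW w0) _ _ _ jm (leq_addr s s) sv)).
  - by move=> ? _; exact: b0.
  - by move=> u /ball_listP; exact: M1.
  - by move=> u i /ball_listP us; rewrite /z us; exact: M2.
  rewrite ler_wpM2l ?divr_ge0 ?(ltW (p0 _))// ler_wpM2l// ler_expR.
  by rewrite ler_wpM2l ?gridpt_leT// addr_ge0 ?mulr_ge0.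
apply: le_lt_trans (polygon_path_near T_gt0 _ H _) _.
- by rewrite mulr_ge0 ?divr_ge0 ?(ltW (p0 _))// mulr_ge0// ltW.
- by apply: M1; exact/ball_listP.
rewrite lte_fin.
have -> : 2 ^+ s / 2 ^+ (s + s) = (2 ^+ s)^-1 :> R.
  by rewrite exprD invfM mulVKf// gt_eqF.
have -> : (2 ^+ s)^-1 * (K * expR (Lam * T)) + w = c0 + C * w.
  rewrite /K /C /c0 exprD; set p := 2 ^+ s : R.
  have pn0 : p != 0 by rewrite gt_eqF//; exact: p0.
  rewrite mulrDl mulrDr -!mulrA (mulrA p^-1 p) mulVf// mul1r.
  by lra.
lra.
Unshelve. all: by end_near. Qed.

(** The term [(1 + s%:R)^-1] is the distance caused by ignoring what lies deeper than
    [s], where the Euler network need not resemble the solution. *)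
Lemma euler_net_cvg (F : nstar R (R * cpath T)%type -> R) x theta b s (eta : R)
    (Lam := 4 * L + 1) :
  (bl_norm F <= 1)%E -> solves phi psi x theta b ->
  (forall v, b v 0 = 0) -> (forall v, {within `[0, T], continuous (b v)}) ->
  0 < eta ->
  \forall m \near \oo,
    `|F (nclass (with_paths x theta)) -
      F (nclass (euler_net x (s + s) m (coded_noise b m)))| <=
    2 * ((1 + s%:R)^-1 + 2 * Mphi * expR (Lam * T) / 2 ^+ s) + eta.
Proof.
move=> /bl_norm_bounds[_ lF] sol b0 bc eta0.
set c0 := 2 * Mphi * _ / _.
have c00 : 0 <= c0.
  by rewrite /c0 !mulr_ge0 ?expR_ge0// invr_ge0 exprn_ge0.
have s0 : 0 <= (1 + s%:R)^-1 :> R by rewrite invr_ge0 addr_ge0.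
have d0 : c0 < c0 + eta / 4 by rewrite ltrDl divr_gt0.
apply: filterS (euler_path_cvg sol b0 bc d0) => m H.
have -> : 2 * ((1 + s%:R)^-1 + c0) + eta = 2 * ((1 + s%:R)^-1 + c0 + eta / 2) by lra.
rewrite distrC; apply: lF; first by rewrite ltr_wpDl ?divr_gt0// addr_ge0.
apply: (@with_paths_near _ s (c0 + eta / 4)) => //; last by lra.
by rewrite ltr_wpDl// divr_gt0.
Qed.

(** If [y] is close to [x], a ball of [y] is matched by [f] with one of [x]. When the
    noise is transported along [f], the observables of the two Euler networks are
    close, uniformly in the number of steps and in the noise. *)
Lemma euler_net_stable (F : nstar R (R * cpath T)%type -> R) x r (eta : R) :
  (bl_norm F <= 1)%E -> 0 < eta ->
  exists2 rho : R, 0 < rho & forall y, (rdist x y < rho%:E)%E ->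
  exists f : nat -> nat,
    [/\ {in ball_list x (root x) r &, injective f},
        forall w, (w \in ball_list y (root y) r) = (w \in map f (ball_list x (root x) r)) &
        forall m z z',
          (forall v j, v \in ball_list x (root x) r -> z' (f v) j = z v j) ->
          `|F (nclass (euler_net x r m z)) - F (nclass (euler_net y r m z'))| <= eta].
Proof.
move=> /bl_norm_bounds[_ lF] eta0.
(* The matching is taken on a deeper ball of radius [r0], because distances of
   rooted networks see everything up to a large depth. *)
have [r0 rr0 r0e] : exists2 r0 : nat, (r <= r0)%N & (1 + r0%:R)^-1 <= eta / 8.
  have eta80 : 0 < eta / 8 by rewrite divr_gt0.
  have := filterI (near_inv_le eta80) (nbhs_infty_ge r).
  by move=> [k _ /(_ k (leqnn k))[? ?]]; exists k.
pose s := ball_list x (root x) r.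
pose W v := \sum_(u <- s) weight (net_ball x (root x) r) u v.
(* A crude bound for all the constants of [drift_iso] on the ball of [x]. *)
pose Gam := \sum_(v <- s) (W v)^-1 * (size s)%:R.
have term0 v : 0 <= (W v)^-1 * (size s)%:R.
  by rewrite mulr_ge0// invr_ge0 sumr_ge0// => u _; exact: weight_ge0.
have G0 : 0 <= Gam by rewrite sumr_ge0.
have fG v : ball_vertices x (root x) r v -> (W v)^-1 * (size s)%:R <= Gam.
  move=> /ball_listP vs; rewrite /Gam (bigD1_seq v) ?ball_list_uniq//= lerDl.
  by rewrite sumr_ge0.
pose C := (1 + 2 * L + 2 * Mphi * Gam) * expR ((2 * L + 1) * T).
have C1 : 1 <= C.
  rewrite /C -[leLHS]mulr1 ler_pM//.
    by rewrite -addrA lerDl addr_ge0// !mulr_ge0.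
  rewrite -expR0 ler_expR mulr_ge0 ?(ltW T_gt0)//.
  by rewrite addr_ge0 ?mulr_ge0.
have C0 : 0 < C := lt_le_trans ltr01 C1.
pose delta := eta / (8 * C).
have delta0 : 0 < delta by rewrite divr_gt0// mulr_gt0.
have dC : delta * C = eta / 8.
  by rewrite /delta invfM -!mulrA mulVf ?gt_eqF// mulr1.
have dle : delta <= eta / 8 by rewrite -dC ler_peMr// ltW.
have r01 : 0 < (1 + r0%:R)^-1 :> R by rewrite invr_gt0 ltr_wpDr.
exists (Num.min delta (1 + r0%:R)^-1); first by rewrite lt_min delta0.
move=> y /ereal_inf_lt[_ [R' [d [d0 xy ->]]]]; rewrite lte_fin lt_min => /andP[Rd Rr].
have R'0 : 0 < (1 + R'%:R)^-1 :> R by rewrite invr_gt0 ltr_wpDr.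
have r0R : (r0 <= R')%N.
  have : (1 + R'%:R)^-1 < (1 + r0%:R)^-1 :> R by apply: le_lt_trans Rr; rewrite lerDl ltW.
  have pos n : 0 < 1 + n%:R :> R by rewrite ltr_wpDr.
  by rewrite ltf_pV2 ?posrE// ltrD2l ltr_nat => /ltnW.
have dd : d <= delta by apply: ltW; apply: le_lt_trans Rd; rewrite lerDr ltW.
have [f [fi fr fm fw]] := good_le r0R dd xy.
have [fi' fball] := graph_iso_restrict rr0 fi fr.
have [[ffun' finj' fsurj'] _] := fi'.
exists f; split.
- by move=> u v /ball_listP us /ball_listP vs; apply: finj'; rewrite inE.
- move=> w; apply/ball_listP/mapP => [|[v /ball_listP sv ->]].
    by move=> /fsurj'[v sv <-]; exists v => //; exact/ball_listP.
  exact: ffun'.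
move=> m z z' zz.
have fm1 u : ball_vertices x (root x) r0 u ->
    `|(mark x u).1 - (mark y (f u)).1| < delta /\
    `|(mark x u).2 - (mark y (f u)).2| < delta by move=> /fm[].
have fm' u : ball_vertices x (root x) r u ->
    `|(mark x u).1 - (mark y (f u)).1| <= delta /\
    `|(mark x u).2 - (mark y (f u)).2| <= delta.
  by move=> /(ball_vertices_le rr0) /fm1[/ltW ? /ltW ?].
have fw' u v : edge (net_ball x (root x) r) u v ->
    `|weight (net_ball x (root x) r) u v -
      weight (net_ball y (root y) r) (f u) (f v)| <= delta.
  move=> uv; have uv0 : edge (net_ball x (root x) r0) u v.
    move: uv => /net_ball_edge[xu xv uv]; apply/net_ball_edge.
    by split=> //; exact: ball_vertices_le rr0 _ _.
  have := fw _ _ uv0.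
  rewrite (net_ball_weight uv0) (net_ball_weight (graph_iso_edge fi uv0)).
  rewrite (net_ball_weight uv) (net_ball_weight (graph_iso_edge fi' uv)).
  by move=> /ltW.
have st := euler_stable T_gt0 Mphi_ge0 L_ge0 phi_le phi_lip psi_lip m fi' (ltW delta0) G0
  fm' fw' fG.
set zx := fun u i => if u \in ball_list x (root x) r then z u i else 0.
set zy := fun u i => if u \in ball_list y (root y) r then z' u i else 0.
have fmem v : ball_vertices x (root x) r v -> f v \in ball_list y (root y) r.
  by move=> rv; apply/ball_listP; exact: ffun'.
have zxy v j : ball_vertices x (root x) r v -> zy (f v) j = zx v j.
  by move=> rv; rewrite /zx /zy fmem// (introT (ball_listP _ _ _ _) rv) zz//; exact/ball_listP.
have {}st := st zx zy zxy.
have eta2 : 0 < eta / 2 by rewrite divr_gt0.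
have -> : eta = 2 * (eta / 2) by lra.
apply: lF => //.
apply: (@with_paths_iso_near _ _ f r0 (eta / 4)) => //; first by rewrite divr_gt0.
- by lra.
- move=> v r0v; split; first by apply: lt_le_trans (fm1 _ r0v).1 _; lra.
  rewrite /euler_path.
  have -> : (f v \in ball_list y (root y) r) = (v \in ball_list x (root x) r).
    by apply/ball_listP/ball_listP => /(fball _ r0v).
  case: ifPn => [/ball_listP rv|_]; last first.
    by apply: le_lt_trans (sup_dist_refl _) _; rewrite lte_fin divr_gt0.
  apply: (@le_lt_trans _ _ (delta * C)%:E); last by rewrite lte_fin dC; lra.
  apply: polygon_path_stable => // j jm.
  apply: le_trans (st j v rv) _.
  rewrite /C mulrA ler_wpM2l//.
    by apply: mulr_ge0 (ltW delta0) _; rewrite !addr_ge0 ?mulr_ge0.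
  rewrite ler_expR ler_wpM2l ?gridpt_leT//.
  by rewrite addr_ge0 ?mulr_ge0.
- move=> u v uv; apply: lt_le_trans (fw _ _ uv) _; lra.
Qed.

End MarkedNetworks.

(** * Means of bounded random variables *)

Section BoundedVariables.
Context d (Omega : measurableType d) (R : realType) (P : probability Omega R).
Implicit Types f g : Omega -> R.

Definition bounded_rv f := measurable_fun setT f /\ exists M, forall w, `|f w| <= M.

Lemma bounded_rv_integrable f : bounded_rv f -> P.-integrable setT (EFin \o f).
Proof.
move=> [mf [M fM]]; apply: measurable_bounded_integrable => //.
  exact: le_lt_trans (probability_le1 P measurableT) (ltry 1).
exists M; split; first exact: num_real.
by move=> M' MM' w _; exact: le_trans (fM w) (ltW MM').
Qed.

Lemma bounded_rv_cst (c : R) : bounded_rv (fun=> c).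
Proof. by split; [exact: measurable_cst|exists `|c|]. Qed.

Lemma bounded_rvD f g : bounded_rv f -> bounded_rv g -> bounded_rv (fun w => f w + g w).
Proof.
move=> [mf [M fM]] [mg [M' gM]]; split; first exact: measurable_funD.
by exists (M + M') => w; rewrite (le_trans (ler_normD _ _))// lerD.
Qed.

Lemma bounded_rvB f g : bounded_rv f -> bounded_rv g -> bounded_rv (fun w => f w - g w).
Proof.
move=> [mf [M fM]] [mg [M' gM]]; split; first exact: measurable_funB.
by exists (M + M') => w; rewrite (le_trans (ler_normB _ _))// lerD.
Qed.

Lemma bounded_rvM f g : bounded_rv f -> bounded_rv g -> bounded_rv (fun w => f w * g w).
Proof.
move=> [mf [M fM]] [mg [M' gM]]; split; first exact: measurable_funM.
by exists (M * M') => w; rewrite normrM ler_pM.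
Qed.

Lemma bounded_rv_norm f : bounded_rv f -> bounded_rv (fun w => `|f w|).
Proof.
move=> [mf [M fM]]; split; first exact: measurableT_comp.
by exists M => w; rewrite normr_id.
Qed.

Lemma bounded_rv_sum (I : Type) (s : seq I) (f : I -> Omega -> R) :
  (forall i, bounded_rv (f i)) -> bounded_rv (fun w => \sum_(i <- s) f i w).
Proof.
move=> bf; elim: s => [|i s IH].
  rewrite (_ : (fun w => _) = (fun=> 0)); first exact: bounded_rv_cst.
  by apply/funext => w; rewrite big_nil.
rewrite (_ : (fun w => _) = (fun w => f i w + \sum_(j <- s) f j w)).
  exact: bounded_rvD.
by apply/funext => w; rewrite big_cons.
Qed.

Lemma bounded_rv_prod (I : Type) (s : seq I) (f : I -> Omega -> R) :
  (forall i, bounded_rv (f i)) -> bounded_rv (fun w => \prod_(i <- s) f i w).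
Proof.
move=> bf; elim: s => [|i s IH].
  rewrite (_ : (fun w => _) = (fun=> 1)); first exact: bounded_rv_cst.
  by apply/funext => w; rewrite big_nil.
rewrite (_ : (fun w => _) = (fun w => f i w * \prod_(j <- s) f j w)).
  exact: bounded_rvM.
by apply/funext => w; rewrite big_cons.
Qed.

(** The real-valued expectation, convenient for algebra with bounded variables. *)
Definition mean f : R := (\int[P]_w f w)%R.

Lemma mean_expectation f : bounded_rv f -> ('E_P[f] = (mean f)%:E)%E.
Proof.
move=> bf; rewrite /mean /Rintegral unlock fineK//.
exact: (integrable_fin_num _ (bounded_rv_integrable bf)).
Qed.

Lemma mean_cst (c : R) : mean (fun=> c) = c.
Proof.
rewrite /mean Rintegral_cst// -[RHS]mulr1; congr (_ * _).
by transitivity (fine (1%E : \bar R)) => //; congr fine; exact: probability_setT.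
Qed.

Lemma meanD f g : bounded_rv f -> bounded_rv g ->
  mean (fun w => f w + g w) = mean f + mean g.
Proof. by move=> bf bg; apply: RintegralD => //; exact: bounded_rv_integrable. Qed.

Lemma meanB f g : bounded_rv f -> bounded_rv g ->
  mean (fun w => f w - g w) = mean f - mean g.
Proof. by move=> bf bg; apply: RintegralB => //; exact: bounded_rv_integrable. Qed.

Lemma meanZ (c : R) f : bounded_rv f -> mean (fun w => c * f w) = c * mean f.
Proof. by move=> bf; apply: RintegralZl => //; exact: bounded_rv_integrable. Qed.

Lemma mean_sum (I : Type) (s : seq I) (f : I -> Omega -> R) :
  (forall i, bounded_rv (f i)) ->
  mean (fun w => \sum_(i <- s) f i w) = \sum_(i <- s) mean (f i).
Proof.
move=> bf; elim: s => [|i s IH].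
  rewrite big_nil -[RHS](mean_cst 0); congr mean.
  by apply/funext => w; rewrite big_nil.
rewrite big_cons -IH -meanD//; last exact: bounded_rv_sum.
by congr mean; apply/funext => w; rewrite big_cons.
Qed.

Lemma mean_le f g : bounded_rv f -> bounded_rv g -> (forall w, f w <= g w) ->
  mean f <= mean g.
Proof.
by move=> bf bg fg; apply: le_Rintegral => //; exact: bounded_rv_integrable.
Qed.

Lemma mean_norm f : bounded_rv f -> `|mean f| <= mean (fun w => `|f w|).
Proof. by move=> bf; apply: le_normr_Rintegral => //; exact: bounded_rv_integrable. Qed.

Lemma mean_norm_le f (c : R) : bounded_rv f -> (forall w, `|f w| <= c) -> `|mean f| <= c.
Proof.
move=> bf fc; rewrite (le_trans (mean_norm bf))//.
rewrite -(mean_cst c); apply: mean_le => //.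
- exact: bounded_rv_norm.
- exact: bounded_rv_cst.
Qed.

Lemma mean_indic (A : set Omega) : measurable A -> mean (\1_A) = fine (P A).
Proof. by move=> mA; rewrite /mean /Rintegral integral_indic// setIT. Qed.

Lemma bounded_rv_indic (A : set Omega) : measurable A -> bounded_rv (\1_A : Omega -> R).
Proof.
move=> mA; split; first exact: measurable_indic.
by exists 1 => w; rewrite indicE; case: (_ \in _); rewrite ?normr0 ?normr1.
Qed.

(** Jensen's inequality for the square, in the form of nonnegativity of the variance
    of [`|f|]. *)
Lemma mean_abs_le_sqrt f (c : R) : bounded_rv f -> 0 <= c ->
  mean (fun w => f w ^+ 2) <= c ^+ 2 -> mean (fun w => `|f w|) <= c.
Proof.
move=> bf c0 fc; have ba := bounded_rv_norm bf.
set mu := mean (fun w => `|f w|).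
have bsq : bounded_rv (fun w => `|f w| * `|f w|) by exact: bounded_rvM.
have : 0 <= mean (fun w => `|f w| * `|f w| - 2 * mu * `|f w| + mu ^+ 2).
  rewrite -(mean_cst 0); apply: mean_le; first exact: bounded_rv_cst.
    apply: bounded_rvD; last exact: bounded_rv_cst.
    apply: bounded_rvB => //; apply: bounded_rvM => //; exact: bounded_rv_cst.
  move=> w; have -> : `|f w| * `|f w| - 2 * mu * `|f w| + mu ^+ 2 = (`|f w| - mu) ^+ 2 by lra.
  exact: sqr_ge0.
have b2 : bounded_rv (fun w => 2 * mu * `|f w|).
  by apply: bounded_rvM => //; exact: bounded_rv_cst.
rewrite meanD; [|exact: bounded_rvB|exact: bounded_rv_cst].
rewrite meanB// meanZ// mean_cst -/mu.
have -> : mean (fun w => `|f w| * `|f w|) = mean (fun w => f w ^+ 2).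
  by congr mean; apply/funext => w; rewrite -expr2 real_normK// num_real.
move=> H; have mc : mu ^+ 2 <= c ^+ 2 by move: fc H; lra.
rewrite leNgt; apply/negP => cm; move: mc; apply/negP; rewrite -ltNge.
by rewrite ltr_pXn2r// nnegrE; apply: le_trans c0 (ltW cm).
Qed.

(** Dominated convergence for the excess of [`|F - G m|] over [eps]. *)
Lemma mean_limsup (F : Omega -> R) (G : nat -> Omega -> R) (eps eta : R) :
  0 <= eps -> 0 < eta -> measurable_fun setT F ->
  (forall m, measurable_fun setT (G m)) -> (forall w, `|F w| <= 1) ->
  (forall m w, `|G m w| <= 1) ->
  {ae P, forall w, forall e, 0 < e -> \forall m \near \oo, `|F w - G m w| <= eps + e} ->
  \forall m \near \oo, mean (fun w => `|F w - G m w|) <= eps + eta.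
Proof.
move=> eps0 eta0 mF mG F1 G1 FG.
have bF : bounded_rv F by split=> //; exists 1.
have bG m : bounded_rv (G m) by split=> //; exists 1.
pose h m w := Num.max (`|F w - G m w| - eps) 0.
have bd m : bounded_rv (fun w => `|F w - G m w|).
  by apply: bounded_rv_norm; exact: bounded_rvB.
have h2 m w : `|h m w| <= 2.
  rewrite /h ger0_norm ?le_max ?lexx ?orbT// ge_max ler0n andbT.
  rewrite lerBlDr (le_trans (ler_normB _ _))//.
  by have := F1 w; have := G1 m w; lra.
have mh m : measurable_fun setT (h m).
  apply: measurable_maxr; last exact: measurable_cst.
  apply: measurable_funB; last exact: measurable_cst.
  by have [] := bd m.
have bh m : bounded_rv (h m) by split=> //; exists 2.
have h0 : {ae P, forall w, setT w -> (EFin \o h m) w @[m --> \oo] --> (0 : R)%:E}.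
  apply: filterS FG => w H _; apply: cvg_EFin; first by near=> m.
  apply/cvgrPdist_le => e e0; near=> m; rewrite /= sub0r normrN.
  rewrite ger0_norm ?le_max ?lexx ?orbT// ge_max (ltW e0) andbT lerBlDl.
  by near: m; exact: H.
have [_ _ cv] : [/\ P.-integrable setT (cst 0%E : Omega -> \bar R),
    [sequence \int[P]_(w in setT) `|(EFin \o h m) w - cst 0 w|]_m%E @ \oo --> 0%E &
    [sequence \int[P]_(w in setT) (EFin \o h m) w]_m%E @ \oo --> (\int[P]_(w in setT) cst 0 w)%E].
  apply: (@dominated_convergence _ _ _ P setT measurableT
    (fun m => EFin \o h m) (cst 0%E) (cst 2%:E)).
  - by move=> m; apply/measurable_EFinP.
  - exact: measurable_cst.
  - exact: h0.
  - by apply: (bounded_rv_integrable (bounded_rv_cst 2)).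
  - by apply: aeW => w m _; rewrite lee_fin.
have {}cv : mean (h m) @[m --> \oo] --> (0 : R).
  by rewrite integral0 in cv; exact: fine_cvg cv.
move/cvgrPdist_le/(_ _ eta0): cv; apply: filterS => m; rewrite sub0r normrN => hm.
apply: (@le_trans _ _ (mean (fun w => eps + h m w))).
  apply: mean_le => //; first by apply: bounded_rvD => //; exact: bounded_rv_cst.
  by move=> w; rewrite -lerBlDl /h le_max lexx.
rewrite meanD//; last exact: bounded_rv_cst.
by rewrite mean_cst lerD2l (le_trans (ler_norm _)).
Unshelve. all: by end_near. Qed.

Section FiniteValued.
Variables (Q : finType) (C : Omega -> Q).
Hypothesis mC : forall q, measurable (C @^-1` [set q]).

Let finite_valuedE (g : Q -> R) w :
  g (C w) = \sum_q g q * \1_(C @^-1` [set q]) w.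
Proof.
rewrite (bigD1 (C w))//= indicE mem_set// mulr1 big1 ?addr0// => q qC.
by rewrite indicE memNset ?mulr0//= => Cq; rewrite Cq eqxx in qC.
Qed.

Lemma finite_valued_bounded (g : Q -> R) : bounded_rv (fun w => g (C w)).
Proof.
under [X in bounded_rv X]eq_fun do rewrite finite_valuedE.
apply: bounded_rv_sum => q; apply: bounded_rvM; first exact: bounded_rv_cst.
exact: bounded_rv_indic.
Qed.

Lemma finite_valued_mean (g : Q -> R) :
  mean (fun w => g (C w)) = \sum_q g q * fine (P (C @^-1` [set q])).
Proof.
under [X in mean X]eq_fun do rewrite finite_valuedE.
rewrite mean_sum => [|q]; last first.
  by apply: bounded_rvM; [exact: bounded_rv_cst|exact: bounded_rv_indic].
by apply: eq_bigr => q _; rewrite meanZ ?mean_indic//; exact: bounded_rv_indic.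
Qed.

End FiniteValued.

End BoundedVariables.
(** * The joint law of the noise codes *)

Section NoiseLaw.
Context d (Omega : measurableType d) (R : realType) (P : probability Omega R).
Variables (T : R) (B : nat -> R -> Omega -> R).
Hypotheses (T_gt0 : 0 < T) (B_brownian : iid_brownian P B).

Lemma sigma_increment (G : set (set Omega)) (f g : Omega -> R) (C : set R) :
  (forall D, measurable D -> <<s G >> (f @^-1` D)) ->
  (forall D, measurable D -> <<s G >> (g @^-1` D)) ->
  measurable C -> <<s G >> ((f \- g) @^-1` C).
Proof.
move=> mf mg mC.
have m' (h : Omega -> R) : (forall D, measurable D -> <<s G >> (h @^-1` D)) ->
    measurable_fun setT (h : g_sigma_algebraType G -> R).
  by move=> mh _ D mD; rewrite setTI; exact: mh.
have := measurable_funB (m' f mf) (m' g mg) measurableT mC.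
by rewrite setTI.
Qed.

Lemma sigma_forall (I : finType) (G : set (set Omega)) (p : pred I) (A : I -> set Omega) :
  (forall i, p i -> <<s G >> (A i)) -> <<s G >> [set w | forall i, p i -> A i w].
Proof.
move=> GA.
have -> : [set w | forall i, p i -> A i w] = \bigcap_(i in [set i | p i]) A i.
  by apply/seteqP; split=> w /= H i; exact: H.
exact: (@fin_bigcap_measurable _ (g_sigma_algebraType G) I [set i | p i] A).
Qed.

Definition cell_prob m (j : nat) (q : code_type m) : R :=
  fine (normal_prob 0 (Num.sqrt (gridpt T m j.+1 - gridpt T m j))
    (encode m @^-1` [set q] : set R)).

Definition code_prob m (c : {ffun 'I_m.+1 -> code_type m}) : R :=
  \prod_(j < m.+1) cell_prob j (c j).

Let gridpt_lt m j : gridpt T m j < gridpt T m j.+1.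
Proof. by rewrite gridptS ltrDl mesh_gt0. Qed.

Let increment_cell m v j (q : code_type m) :
  [set w | encode m (B v (gridpt T m j.+1) w - B v (gridpt T m j) w) = q] =
  (B v (gridpt T m j.+1) \- B v (gridpt T m j)) @^-1` (encode m @^-1` [set q]).
Proof. by []. Qed.

Lemma measurable_increment_cell m v j (q : code_type m) :
  measurable [set w | encode m (B v (gridpt T m j.+1) w - B v (gridpt T m j) w) = q].
Proof.
have [mB _ _ _ _] := B_brownian.1 v.
rewrite increment_cell -[X in measurable X]setTI.
apply: measurable_funB => //; try exact: mB (gridpt_ge0 T_gt0 _ _).
exact: measurable_encode.
Qed.

Lemma increment_cell_prob m v j (q : code_type m) :
  P [set w | encode m (B v (gridpt T m j.+1) w - B v (gridpt T m j) w) = q] =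
  (cell_prob j q)%:E.
Proof.
have [_ _ _ law _] := B_brownian.1 v.
rewrite increment_cell law ?gridpt_ge0 ?gridpt_lt//; last exact: measurable_encode.
by rewrite /cell_prob fineK// fin_num_measure//; exact: measurable_encode.
Qed.

Let past v m j i (q : code_type m) (i_j : (i < j)%N) :
  <<s [set B v u @^-1` D | u in `[0%R, gridpt T m j] & D in measurable] >>
    [set w | encode m (B v (gridpt T m i.+1) w - B v (gridpt T m i) w) = q].
Proof.
rewrite increment_cell; apply: sigma_increment; last exact: measurable_encode.
  move=> D mD; apply: sub_gen_smallest; exists (gridpt T m i.+1); last by exists D.
  by rewrite /= in_itv/= gridpt_ge0// gridpt_le.
move=> D mD; apply: sub_gen_smallest; exists (gridpt T m i); last by exists D.
by rewrite /= in_itv/= gridpt_ge0// gridpt_le// ltnW.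
Qed.

(** The increments of one Brownian motion over the grid are independent: peel off
    the last one, which is independent of the past. *)
Lemma noise_code_prob m v (c : {ffun 'I_m.+1 -> code_type m}) :
  P [set w | noise_code T (fun u t => B u t w) m v = c] = (code_prob c)%:E.
Proof.
pose D j (q : code_type m) :=
  [set w | encode m (B v (gridpt T m j.+1) w - B v (gridpt T m j) w) = q].
pose A l := [set w | forall i : 'I_m.+1, (i < l)%N -> D i (c i) w].
suff H l : (l <= m.+1)%N -> P (A l) = (\prod_(i < m.+1 | (i < l)%N) cell_prob i (c i))%:E.
  have -> : [set w | noise_code T (fun u t => B u t w) m v = c] = A m.+1.
    apply/seteqP; split=> w /=; first by move=> E i _; rewrite /D /= -E ffunE.
    by move=> Aw; apply/ffunP => i; rewrite ffunE; apply: Aw.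
  by rewrite H// /code_prob; congr (_%:E); apply: eq_bigl => i; rewrite ltn_ord.
elim: l => [_|l IH lm].
  rewrite big_pred0//; have -> : A 0%N = setT by apply/seteqP; split.
  exact: probability_setT.
have -> : A l.+1 = A l `&` D l (c (Ordinal lm)).
  apply/seteqP; split=> w /=.
    by move=> Aw; split=> [i il|]; [apply: Aw; exact: ltnW|exact: (Aw (Ordinal lm))].
  move=> [Aw Dw] i; rewrite ltnS leq_eqVlt => /orP[/eqP il|/Aw//].
  by have -> : i = Ordinal lm by exact: val_inj.
have [_ _ _ _ indep] := B_brownian.1 v.
rewrite /D increment_cell (indep (gridpt T m l)).
- rewrite -increment_cell increment_cell_prob IH ?(ltnW lm)// -EFinM.
  congr (_%:E); rewrite mulrC [RHS](bigD1 (Ordinal lm))//=; congr (_ * _).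
  apply: eq_bigl => i; rewrite ltnS -(inj_eq val_inj)/= ltn_neqAle andbC.
  by [].
- by rewrite gridpt_ge0// ltW.
- by apply: sigma_forall => i il; exact: past.
- exact: measurable_encode.
Qed.

Let all_time v m (c : {ffun 'I_m.+1 -> code_type m}) :
  <<s [set B v t @^-1` D | t in `[0%R, +oo[ & D in measurable] >>
    [set w | noise_code T (fun u t => B u t w) m v = c].
Proof.
have -> : [set w | noise_code T (fun u t => B u t w) m v = c] =
    [set w | forall i : 'I_m.+1, true ->
      [set w | encode m (B v (gridpt T m i.+1) w - B v (gridpt T m i) w) = c i] w].
  apply/seteqP; split=> w /=; first by move=> <- i _; rewrite ffunE.
  by move=> H; apply/ffunP => i; rewrite ffunE; exact: H.
apply: sigma_forall => i _.
rewrite increment_cell; apply: sigma_increment; last exact: measurable_encode.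
  move=> D mD; apply: sub_gen_smallest; exists (gridpt T m i.+1); last by exists D.
  by rewrite /= in_itv/= gridpt_ge0.
move=> D mD; apply: sub_gen_smallest; exists (gridpt T m i); last by exists D.
by rewrite /= in_itv/= gridpt_ge0.
Qed.

Definition noise_codes (I : finType) (sigma : I -> nat) m (w : Omega) :
    {ffun I -> {ffun 'I_m.+1 -> code_type m}} :=
  [ffun i => noise_code T (fun u t => B u t w) m (sigma i)].

Lemma measurable_noise_codes (I : finType) (sigma : I -> nat) m
    (c : {ffun I -> {ffun 'I_m.+1 -> code_type m}}) :
  measurable (noise_codes sigma m @^-1` [set c]).
Proof.
have -> : noise_codes sigma m @^-1` [set c] =
    \bigcap_(i in [set: I]) \bigcap_(j in [set: 'I_m.+1])
     [set w | encode m (B (sigma i) (gridpt T m j.+1) w - B (sigma i) (gridpt T m j) w) = c i j].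
  apply/seteqP; split=> w /=.
    by move=> <- i _ j _ /=; rewrite !ffunE.
  move=> H; apply/ffunP => i; rewrite ffunE; apply/ffunP => j; rewrite ffunE.
  exact: (H i Logic.I j Logic.I).
apply: fin_bigcap_measurable; first exact: finite_finset.
move=> i _; apply: fin_bigcap_measurable; first exact: finite_finset.
move=> j _; exact: measurable_increment_cell.
Qed.

(** The right-hand side does not mention [sigma]: the joint law of the codes is the
    same for all families of distinct Brownian motions. *)
Lemma noise_codes_prob (I : finType) (sigma : I -> nat) m
    (c : {ffun I -> {ffun 'I_m.+1 -> code_type m}}) : injective sigma ->
  P (noise_codes sigma m @^-1` [set c]) = (\prod_i code_prob (c i))%:E.
Proof.
move=> inj.
(* Group the conditions by the vertex that carries them, to use independence over
   a finite set of vertices. *)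
pose s := map sigma (enum I); pose J := [fset v in s]%fset.
have us : uniq s by rewrite map_inj_uniq ?enum_uniq.
pose A v := [set w | forall i, sigma i == v -> noise_code T (fun u t => B u t w) m v = c i].
have -> : noise_codes sigma m @^-1` [set c] = \bigcap_(v in [set` J]) A v.
  apply/seteqP; split=> w /=.
    by move=> E v _ i /eqP <-; rewrite -E ffunE.
  move=> H; apply/ffunP => i; rewrite ffunE.
  apply: (H (sigma i)) => //=.
  by rewrite inE; apply: map_f; rewrite mem_enum.
rewrite B_brownian.2; last first.
  by move=> v _; apply: sigma_forall => i _; exact: all_time.
have -> : (\prod_(v <- J) P (A v) = \prod_(v <- s) P (A v))%E.
  apply: perm_big; apply: uniq_perm; rewrite ?fset_uniq// => v.
  by rewrite inE.
rewrite /s big_map big_enum/= -prodEFin; apply: eq_bigr => i _.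
rewrite -(noise_code_prob (sigma i)); congr (P _); apply/seteqP; split=> w /=.
  by apply.
by move=> nc i' /eqP/inj ->.
Qed.

Lemma noise_codes_mean (I : finType) (sigma : I -> nat) m
    (g : {ffun I -> {ffun 'I_m.+1 -> code_type m}} -> R) : injective sigma ->
  mean P (fun w => g (noise_codes sigma m w)) = \sum_c g c * \prod_i code_prob (c i).
Proof.
move=> inj; rewrite finite_valued_mean; last exact: measurable_noise_codes.
by apply: eq_bigr => c _; rewrite noise_codes_prob.
Qed.

Lemma noise_codes_bounded (I : finType) (sigma : I -> nat) m
    (g : {ffun I -> {ffun 'I_m.+1 -> code_type m}} -> R) :
  bounded_rv (fun w => g (noise_codes sigma m w)).
Proof. by apply: finite_valued_bounded; exact: measurable_noise_codes. Qed.

(** Equality in law allows the two functions to be coupled through the same codes. *)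
Lemma noise_codes_mean_dist (I : finType) (sigma sigma' : I -> nat) m
    (g h : {ffun I -> {ffun 'I_m.+1 -> code_type m}} -> R) (e : R) :
  injective sigma -> injective sigma' -> (forall c, `|g c - h c| <= e) ->
  `|mean P (fun w => g (noise_codes sigma m w)) -
    mean P (fun w => h (noise_codes sigma' m w))| <= e.
Proof.
move=> inj inj' gh.
have -> : mean P (fun w => h (noise_codes sigma' m w)) =
    mean P (fun w => h (noise_codes sigma m w)) by rewrite !noise_codes_mean.
rewrite -meanB; try exact: noise_codes_bounded.
apply: mean_norm_le => //.
by apply: bounded_rvB; exact: noise_codes_bounded.
Qed.

Lemma noise_codes_indep (I I' : finType) (sigma : I -> nat) (sigma' : I' -> nat) m
    (g : {ffun I -> {ffun 'I_m.+1 -> code_type m}} -> R)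
    (h : {ffun I' -> {ffun 'I_m.+1 -> code_type m}} -> R) :
  injective sigma -> injective sigma' -> (forall i i', sigma i != sigma' i') ->
  mean P (fun w => g (noise_codes sigma m w) * h (noise_codes sigma' m w)) =
  mean P (fun w => g (noise_codes sigma m w)) * mean P (fun w => h (noise_codes sigma' m w)).
Proof.
move=> inj inj' dis.
(* Both families of codes are parts of one family indexed by the disjoint union. *)
pose tau (k : I + I') := match k with inl i => sigma i | inr i => sigma' i end.
have tinj : injective tau.
  move=> [i|i] [k|k] /= => [/inj ->|E|E|/inj' ->] //.
    by have := dis i k; rewrite E eqxx.
  by have := dis k i; rewrite E eqxx.
pose C w := (noise_codes sigma m w, noise_codes sigma' m w).
have CE q : C @^-1` [set q] =
    noise_codes tau m @^-1` [set [ffun k => match k with inl i => q.1 i | inr i => q.2 i end]].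
  case: q => q1 q2; apply/seteqP; split=> w /=.
    by move=> [<- <-]; apply/ffunP => -[i|i]; rewrite !ffunE.
  move=> H; rewrite /C; congr (_, _); apply/ffunP => i.
    by move/ffunP/(_ (inl i)): H; rewrite !ffunE.
  by move/ffunP/(_ (inr i)): H; rewrite !ffunE.
have mC q : measurable (C @^-1` [set q]).
  by rewrite CE; exact: measurable_noise_codes.
rewrite (finite_valued_mean P mC (fun q => g q.1 * h q.2)).
rewrite !noise_codes_mean// big_distrlr/= pair_big/=.
apply: eq_bigr => -[q1 q2] _ /=.
rewrite CE noise_codes_prob// big_sumType/= /=.
under eq_bigr do rewrite ffunE.
under [X in _ * (_ * X)]eq_bigr do rewrite ffunE.
by rewrite mulrACA.
Qed.

End NoiseLaw.

(** * Locality of the mean of an observable *)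

Lemma ae_nat d (Omega : measurableType d) (R : realType) (P : probability Omega R)
    (Q : nat -> Omega -> Prop) :
  (forall v, {ae P, forall w, Q v w}) -> {ae P, forall w, forall v, Q v w}.
Proof.
move=> H; have := negligible_bigcup H; apply: negligibleS.
by move=> w /existsNP[v nQ]; exists v.
Qed.

Section UpperLimit.
Variable R : realType.
Implicit Types u v : nat -> R.

(** The limit superior, for bounded sequences. It turns a bound valid for all
    large indices into a bound on one number, whether or not the sequence converges. *)
Definition upper_limit u : R := inf [set c | \forall m \near \oo, u m <= c].

Lemma upper_limit_le u c : (forall m, -1 <= u m) ->
  (\forall m \near \oo, u m <= c) -> upper_limit u <= c.
Proof.
move=> u1 uc; apply: ge_inf => //; exists (-1) => a [n _ ua].
by apply: le_trans (u1 n) _; exact: ua (leqnn n).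
Qed.

Lemma upper_limit_ge u c : (forall m, u m <= 1) ->
  (\forall m \near \oo, c <= u m) -> c <= upper_limit u.
Proof.
move=> u1 uc; apply: lb_le_inf; first by exists 1; near=> m.
move=> a ua; have [n _ /(_ n (leqnn n))[cu uan]] := filterI uc ua.
exact: le_trans cu uan.
Unshelve. all: by end_near. Qed.

Lemma upper_limit_dist u v e : (forall m, `|u m| <= 1) -> (forall m, `|v m| <= 1) ->
  (forall m, `|u m - v m| <= e) -> `|upper_limit u - upper_limit v| <= e.
Proof.
have bd (z : nat -> R) m : `|z m| <= 1 -> -1 <= z m /\ z m <= 1 :> R by rewrite ler_norml => /andP.
have main z z' : (forall m, `|z m| <= 1) -> (forall m, `|z' m| <= 1) ->
    (forall m, `|z m - z' m| <= e) -> upper_limit z - e <= upper_limit z'.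
  move=> z1 z'1 zz'; apply: lb_le_inf.
    by exists 1; near=> m; have [] := bd _ _ (z'1 m).
  move=> a z'a; rewrite lerBlDr; apply: upper_limit_le => [m|].
    by have [] := bd _ _ (z1 m).
  apply: filterS z'a => m z'a.
  by have := zz' m; rewrite ler_norml => /andP[_]; lra.
move=> u1 v1 uv; have := main _ _ u1 v1 uv.
have vu m : `|v m - u m| <= e by rewrite distrC.
have := main _ _ v1 u1 vu.
by rewrite ler_norml => ? ?; apply/andP; split; lra.
Unshelve. all: by end_near. Qed.

Lemma upper_limit_near u c e : (forall m, `|u m| <= 1) ->
  (\forall m \near \oo, `|u m - c| <= e) -> `|upper_limit u - c| <= e.
Proof.
move=> u1 uc; have u1' m : -1 <= u m <= 1 by rewrite -ler_norml.
rewrite ler_norml; apply/andP; split.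
  rewrite lerBrDr; apply: upper_limit_ge => [m|]; first by have /andP[] := u1' m.
  by apply: filterS uc => m; rewrite ler_norml => /andP[]; lra.
rewrite lerBlDr; apply: upper_limit_le => [m|]; first by have /andP[] := u1' m.
by apply: filterS uc => m; rewrite ler_norml => /andP[]; lra.
Qed.

End UpperLimit.

Section Locality.
Variables (R : realType) (T : R) (phi : R * R * R * R -> R) (psi : R * R -> R).
Variables (Mphi L : R).
Hypothesis T_gt0 : 0 < T.
Hypotheses (Mphi_ge0 : 0 <= Mphi) (L_ge0 : 0 <= L).
Hypothesis phi_le : forall p, `|phi p| <= Mphi.
Hypothesis phi_lip : forall a b c e a' b' c' e' (D : R),
  `|a - a'| <= D -> `|b - b'| <= D -> `|c - c'| <= D -> `|e - e'| <= D ->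
  `|phi (a, b, c, e) - phi (a', b', c', e')| <= L * D.
Hypothesis psi_lip : forall a b a' b' (D : R),
  `|a - a'| <= D -> `|b - b'| <= D -> `|psi (a, b) - psi (a', b')| <= L * D.
Context d (Omega : measurableType d) (P : probability Omega R).
Variables (B : nat -> R -> Omega -> R).
Hypotheses (B_brownian : iid_brownian P B).
Variable (F : nstar R (R * cpath T)%type -> R).
Hypothesis F_bl : (bl_norm F <= 1)%E.

Implicit Types (x y : rnet R (R * R)%type).

Let F_le c : `|F c| <= 1.
Proof. by have [] := bl_norm_bounds F_bl. Qed.

Let F_lip a b e : 0 < e -> ball a e b -> `|F a - F b| <= 2 * e.
Proof. by have [_] := bl_norm_bounds F_bl; apply. Qed.

Definition euler_observable x r m (w : Omega) : R :=
  F (nclass (euler_net T phi psi x r m (coded_noise T (fun v t => B v t w) m))).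

(** The noise at vertex [sigma i] is read from the code of index [i]; vertices that
    are not of this form receive no noise. *)
Definition decoded_noise (I : finType) (sigma : I -> nat) m
    (c : {ffun I -> {ffun 'I_m.+1 -> code_type m}}) (u j : nat) : R :=
  if [pick i | sigma i == u] is Some i then read_code R (c i) j else 0.

Lemma decoded_noiseE (I : finType) (sigma : I -> nat) m c i j : injective sigma ->
  decoded_noise sigma (m := m) c (sigma i) j = read_code R (c i) j.
Proof.
move=> inj; rewrite /decoded_noise; case: pickP => [k /eqP/inj ->//|/(_ i)].
by rewrite eqxx.
Qed.

Lemma eq_euler_net x r m z z' :
  (forall v j, v \in ball_list x (root x) r -> z v j = z' v j) ->
  euler_net T phi psi x r m z = euler_net T phi psi x r m z' :> rnet R (R * cpath T)%type.
Proof.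
move=> zz; rewrite /euler_net; congr with_paths; apply/funext => v.
rewrite /euler_path.
have -> : (fun u i => if u \in ball_list x (root x) r then z u i else 0) =
    (fun u i => if u \in ball_list x (root x) r then z' u i else 0).
  by apply/funext => u; apply/funext => i; case: ifPn => // /zz.
by [].
Qed.

(** The Euler observable is a deterministic function of finitely many finitely valued
    codes, under any enumeration of the vertices of the ball. *)
Lemma euler_observableE x r m (I : finType) (sigma : I -> nat) w : injective sigma ->
  (forall v, v \in ball_list x (root x) r -> exists i, sigma i = v) ->
  euler_observable x r m w =
  F (nclass (euler_net T phi psi x r m (decoded_noise sigma (noise_codes T B sigma m w)))).
Proof.
move=> inj sur; rewrite /euler_observable; congr (F (nclass _)).
apply: eq_euler_net => v j /sur[i <-].
by rewrite decoded_noiseE// /noise_codes ffunE.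
Qed.

Let ball_index x r := seq_sub (ball_list x (root x) r).

Let ball_index_sur x r v : v \in ball_list x (root x) r ->
  exists i : ball_index x r, val i = v.
Proof. by move=> vs; exists (SeqSub vs). Qed.

Lemma euler_observable_bounded x r m : bounded_rv (euler_observable x r m).
Proof.
have ex w : euler_observable x r m w = F (nclass (euler_net T phi psi x r m
    (decoded_noise (val : ball_index x r -> nat) (noise_codes T B val m w)))).
  by apply: euler_observableE; [exact: val_inj|exact: ball_index_sur].
rewrite (funext ex).
exact: (noise_codes_bounded T_gt0 B_brownian _
  (fun c => F (nclass (euler_net T phi psi x r m (decoded_noise val c))))).
Qed.

Lemma euler_observable_indep x y r m :
  (forall v, ball_vertices x (root x) r v -> ~ ball_vertices y (root y) r v) ->
  mean P (fun w => euler_observable x r m w * euler_observable y r m w) =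
  mean P (euler_observable x r m) * mean P (euler_observable y r m).
Proof.
move=> dis.
have ex w : euler_observable x r m w = F (nclass (euler_net T phi psi x r m
    (decoded_noise (val : ball_index x r -> nat) (noise_codes T B val m w)))).
  by apply: euler_observableE; [exact: val_inj|exact: ball_index_sur].
have ey w : euler_observable y r m w = F (nclass (euler_net T phi psi y r m
    (decoded_noise (val : ball_index y r -> nat) (noise_codes T B val m w)))).
  by apply: euler_observableE; [exact: val_inj|exact: ball_index_sur].
rewrite (funext ex) (funext ey).
apply: (noise_codes_indep T_gt0 B_brownian
  (fun c => F (nclass (euler_net T phi psi x r m (decoded_noise val c))))
  (fun c => F (nclass (euler_net T phi psi y r m (decoded_noise val c))))); try exact: val_inj.
move=> i i'; apply/eqP => E; apply: (dis (val i)).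
  by apply/ball_listP; exact: valP.
by rewrite E; apply/ball_listP; exact: valP.
Qed.

Definition euler_mean x r m : R := mean P (euler_observable x r m).

Lemma euler_mean_le x r m : `|euler_mean x r m| <= 1.
Proof.
apply: mean_norm_le => [|w]; last exact: F_le.
exact: euler_observable_bounded.
Qed.

(** Transport the codes along the matching of the two balls: they have the same law on
    both sides, and the observables are close for every value of the codes. *)
Lemma euler_mean_stable x r (eta : R) : 0 < eta ->
  exists2 rho : R, 0 < rho & forall y, (rdist x y < rho%:E)%E ->
    forall m, `|euler_mean x r m - euler_mean y r m| <= eta.
Proof.
move=> eta0; have [rho rho0 H] := euler_net_stable T_gt0 Mphi_ge0 L_ge0 phi_le
  phi_lip psi_lip x r F_bl eta0.
exists rho => // y /H[f [finj fmem Fxy]] m.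
pose sx : ball_index x r -> nat := val; pose sy := f \o sx.
have inx : injective sx by exact: val_inj.
have iny : injective sy.
  by move=> i k /finj/inx; apply; exact: valP.
rewrite /euler_mean.
have ex w : euler_observable x r m w = F (nclass (euler_net T phi psi x r m
    (decoded_noise sx (noise_codes T B sx m w)))).
  by apply: euler_observableE => //; exact: ball_index_sur.
have ey w : euler_observable y r m w = F (nclass (euler_net T phi psi y r m
    (decoded_noise sy (noise_codes T B sy m w)))).
  apply: euler_observableE => // v; rewrite fmem => /mapP[u us ->].
  by have [i <-] := ball_index_sur us; exists i.
rewrite (funext ex) (funext ey).
apply: (noise_codes_mean_dist T_gt0 B_brownian
  (g := fun c => F (nclass (euler_net T phi psi x r m (decoded_noise sx c))))
  (h := fun c => F (nclass (euler_net T phi psi y r m (decoded_noise sy c))))) => // c.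
apply: Fxy => v j /ball_index_sur[i <-].
have -> : f (val i) = sy i by [].
by rewrite !decoded_noiseE.
Qed.

(** A representative is chosen to evaluate the mean, but the mean does not depend on
    it, see [euler_mean_class]. *)
Definition local_mean r (c : nstar R (R * R)%type) : R :=
  upper_limit (euler_mean (repr c) r).

Lemma local_mean_le r c : `|local_mean r c| <= 1.
Proof.
have := @upper_limit_near _ (euler_mean (repr c) r) 0 1 (euler_mean_le (repr c) r).
by rewrite subr0; apply; near=> m; rewrite subr0 euler_mean_le.
Unshelve. all: by end_near. Qed.

Lemma local_mean_continuous r : continuous (local_mean r).
Proof.
move=> c; apply/(@cvgrPdist_le _ _ _ (nbhs c)) => e e0.
have [rho rho0 H] := euler_mean_stable (repr c) r e0.
apply/nbhs_ballP; exists rho => //= c' cc'.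
by apply: upper_limit_dist; [exact: euler_mean_le|exact: euler_mean_le|exact: H].
Qed.

(** Isomorphic rooted networks are at distance [0], so stability gives equality. *)
Lemma euler_mean_class x r m : euler_mean (repr (nclass x)) r m = euler_mean x r m.
Proof.
apply/eqP; rewrite -subr_eq0 -normr_le0; apply/ler_addgt0Pr => e e0; rewrite add0r.
have [rho rho0 H] := euler_mean_stable (repr (nclass x)) r e0.
apply: H; apply: rdist_iso0 => //.
by apply/nclassP; rewrite /nclass reprK.
Qed.

Section Solution.
Variables (x : rnet R (R * R)%type) (theta : nat -> Omega -> cpath T).

(** The consequences of being a strong solution that pass from a network to its
    connected components. *)
Definition strong_on : Prop :=
  (forall v t, vertex x v -> 0 <= t <= T -> measurable_fun setT (fun w => theta v w t)) /\
  {ae P, forall w, solves phi psi x (fun v => theta v w) (fun v t => B v t w)}.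

Hypothesis theta_strong : strong_on.

Definition observable (w : Omega) : R := F (nclass (with_paths x (fun v => theta v w))).

Let position_codes m (w : Omega) :
    {ffun ball_index x m -> {ffun 'I_m.+2 -> code_type m}} :=
  [ffun i : ball_index x m => [ffun j : 'I_m.+2 => encode m (theta (val i) w (gridpt T m j))]].

Let sampled m (c : {ffun ball_index x m -> {ffun 'I_m.+2 -> code_type m}}) (v : nat) : cpath T :=
  if insub v is Some i then polygon_path T m (read_code R (c i)) else point.

Let measurable_position_codes m c : measurable (position_codes m @^-1` [set c]).
Proof.
have -> : position_codes m @^-1` [set c] =
    \bigcap_(i in [set: ball_index x m]) \bigcap_(j in [set: 'I_m.+2])
     ((fun w => theta (val i) w (gridpt T m j)) @^-1` (encode m @^-1` [set c i j])).
  apply/seteqP; split=> w /=.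
    by move=> <- i _ j _ /=; rewrite !ffunE.
  move=> H; apply/ffunP => i; rewrite ffunE; apply/ffunP => j; rewrite ffunE.
  exact: (H i Logic.I j Logic.I).
apply: fin_bigcap_measurable; first exact: finite_finset.
move=> i _; apply: fin_bigcap_measurable; first exact: finite_finset.
move=> j _; rewrite -[X in measurable X]setTI; apply: theta_strong.1 => //.
- by apply: (@rnet_ball_vertex _ _ x m); apply/ball_listP; exact: valP.
- by rewrite gridpt_ge0 ?gridpt_leT// -ltnS.
- exact: measurable_encode.
Qed.

(** Rounding and interpolation errors both vanish as the grid is refined. *)
Lemma sampled_near (p : cpath T) (e : R) : 0 < e -> \forall m \near \oo,
  forall c : {ffun 'I_m.+2 -> code_type m},
  (forall j : 'I_m.+2, c j = encode m (p (gridpt T m j))) ->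
  (sup_dist (polygon_path T m (read_code R c)) p < e%:E)%E.
Proof.
move=> e0; have e40 : 0 < e / 4 by rewrite divr_gt0.
have [C Cb] : exists C, forall t, 0 <= t <= T -> `|p t| <= C.
  have /compact_bounded[M [_ Mb]] :=
    continuous_compact (@path_continuous _ _ p) (@segment_compact _ 0 T).
  exists (M + 1) => t tT; apply: (Mb (M + 1)); first by rewrite ltrDl.
  by exists t => //; rewrite /= in_itv.
near=> m => c cE.
have M1 : forall s t, 0 <= s <= T -> 0 <= t <= T -> `|s - t| <= mesh T m ->
    `|p s - p t| <= e / 4 by near: m; exact: cpath_modulus.
have m1 : (1 + m%:R)^-1 <= e / 4 by near: m; exact: near_inv_le.
have Cm : C <= m.+1%:R.
  have : (Num.truncn C <= m)%N by near: m; exact: nbhs_infty_ge.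
  by move=> H; rewrite ltW// (lt_le_trans (truncnS_gt _))// ler_nat ltnS.
apply: (@le_lt_trans _ _ (e / 4 + e / 4)%:E); last by rewrite lte_fin; lra.
apply: polygon_path_near => //; first exact: ltW.
move=> j jm; have tT : 0 <= gridpt T m j <= T by rewrite gridpt_ge0 ?gridpt_leT.
have -> : read_code R c j = decode R (encode m (p (gridpt T m j))).
  by rewrite /read_code insubT /= cE.
rewrite (le_trans (encodeK _))//; first exact: le_trans (Cb _ tT) Cm.
apply: le_trans m1; rewrite addrC natr1 lef_pV2 ?posrE ?exprn_gt0//.
by rewrite expr2 ler_peMr// ler1n.
Unshelve. all: by end_near. Qed.

(** Only the positions at fixed times are known to be measurable. The observable is
    the pointwise limit of its values on networks whose trajectories are interpolated
    from the rounded positions on a grid, in a ball whose radius grows; these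
    approximations take finitely many values. *)
Lemma measurable_observable : measurable_fun setT observable.
Proof.
apply: (@measurable_fun_cvg _ _ _ _
  (fun m w => F (nclass (with_paths x (sampled (position_codes m w)))))).
  move=> m.
  have [//] := finite_valued_bounded (measurable_position_codes (m := m))
    (fun c => F (nclass (with_paths x (sampled c)))).
move=> w _; apply/cvgrPdist_le => e e0.
have e80 : 0 < e / 8 by rewrite divr_gt0.
have [k _ /(_ k (leqnn k)) ke] := near_inv_le e80.
have near_ball : \forall m \near \oo, forall v, v \in ball_list x (root x) k ->
    forall c : {ffun 'I_m.+2 -> code_type m},
    (forall j : 'I_m.+2, c j = encode m (theta v w (gridpt T m j))) ->
    (sup_dist (polygon_path T m (read_code R c)) (theta v w) < (e / 8)%:E)%E.
  by apply: near_all_in => v _; exact: sampled_near.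
near=> m; rewrite /observable distrC.
have -> : e = 2 * (e / 2) by lra.
apply: F_lip; first by rewrite divr_gt0.
apply: (@with_paths_near _ _ _ k (e / 8)) => //; first by lra.
move=> v kv; have km : (k <= m)%N by near: m; exact: nbhs_infty_ge.
have vm : v \in ball_list x (root x) m.
  by apply/ball_listP; exact: ball_vertices_le km _ kv.
rewrite /sampled insubT /=; move: v kv vm => v /ball_listP kv vm.
have H : forall v, v \in ball_list x (root x) k ->
    forall c : {ffun 'I_m.+2 -> code_type m},
    (forall j : 'I_m.+2, c j = encode m (theta v w (gridpt T m j))) ->
    (sup_dist (polygon_path T m (read_code R c)) (theta v w) < (e / 8)%:E)%E by near: m.
by apply: H => // j; rewrite !ffunE.
Unshelve. all: by end_near. Qed.

Lemma observable_bounded : bounded_rv observable.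
Proof. by split; [exact: measurable_observable|exists 1 => w; exact: F_le]. Qed.

(** A path at depth at most [s] is known up to the second term, by [euler_path_cvg];
    deeper vertices are at distance [(1 + s%:R)^-1]; the factor two is the one of
    [bl_norm_bounds]. *)
Definition locality_error (s : nat) : R :=
  2 * ((1 + s%:R)^-1 + 2 * Mphi * expR ((4 * L + 1) * T) / 2 ^+ s).

Lemma locality_error_ge0 s : 0 <= locality_error s.
Proof.
by rewrite mulr_ge0// addr_ge0 ?invr_ge0 ?addr_ge0// !mulr_ge0 ?expR_ge0.
Qed.

Lemma observable_locality s (eta : R) : 0 < eta -> \forall m \near \oo,
  mean P (fun w => `|observable w - euler_observable x (s + s) m w|) <=
    locality_error s + eta.
Proof.
move=> eta0; apply: mean_limsup => //.
- exact: locality_error_ge0.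
- exact: measurable_observable.
- by move=> m; have [] := euler_observable_bounded x (s + s) m.
- by move=> w; exact: F_le.
- by move=> m w; exact: F_le.
have B0 : {ae P, forall w, forall v, B v 0 w = 0}.
  by apply: ae_nat => v; have [] := B_brownian.1 v.
have Bc : {ae P, forall w, forall v, {within `[0, +oo[, continuous (B v ^~ w)}}.
  by apply: ae_nat => v; have [] := B_brownian.1 v.
have [_ sol] := theta_strong.
apply: filterS3 sol B0 Bc => w sw b0 bc e e0.
apply: (euler_net_cvg T_gt0 Mphi_ge0 L_ge0 phi_le phi_lip psi_lip) => //.
move=> v; apply: continuous_subspaceW (bc v) => t.
by rewrite /= !in_itv/= andbT => /andP[].
Qed.

Lemma observable_mean_local s :
  `|mean P observable - local_mean (s + s) (nclass x)| <= locality_error s.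
Proof.
apply/ler_addgt0Pr => e e0; rewrite distrC.
apply: upper_limit_near; first exact: euler_mean_le.
apply: filterS (observable_locality s e0) => m.
apply: le_trans; rewrite euler_mean_class distrC /euler_mean -meanB.
- apply: mean_norm.
  by apply: bounded_rvB; [exact: observable_bounded|exact: euler_observable_bounded].
- exact: observable_bounded.
- exact: euler_observable_bounded.
Qed.

End Solution.

(** Replace both observables by Euler observables on disjoint balls, which are
    independent. Each of the two products changes by at most [2 * locality_error s]. *)
Lemma observable_decorrelation x y theta theta' s :
  strong_on x theta -> strong_on y theta' ->
  (forall v, ball_vertices x (root x) (s + s) v ->
    ~ ball_vertices y (root y) (s + s) v) ->
  `|mean P (fun w => observable x theta w * observable y theta' w) -
    mean P (observable x theta) * mean P (observable y theta')| <=
  4 * locality_error s.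
Proof.
move=> sx sy dis; apply/ler_addgt0Pr => e e0.
have e40 : 0 < e / 4 by rewrite divr_gt0.
have [m _ /(_ m (leqnn m))[Hx Hy]] :=
  filterI (observable_locality sx s e40) (observable_locality sy s e40).
set X := observable x theta in Hx *; set Y := observable y theta' in Hy *.
set X' := euler_observable x (s + s) m in Hx *.
set Y' := euler_observable y (s + s) m in Hy *.
have bX : bounded_rv X by exact: observable_bounded.
have bY : bounded_rv Y by exact: observable_bounded.
have bX' : bounded_rv X' by exact: euler_observable_bounded.
have bY' : bounded_rv Y' by exact: euler_observable_bounded.
have X1 w : `|X w| <= 1 by exact: F_le.
have Y1 w : `|Y w| <= 1 by exact: F_le.
have Y'1 w : `|Y' w| <= 1 by exact: F_le.
have dX : `|mean P X - mean P X'| <= locality_error s + e / 4.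
  by rewrite -meanB// (le_trans (mean_norm P _))//; exact: bounded_rvB.
have dY : `|mean P Y - mean P Y'| <= locality_error s + e / 4.
  by rewrite -meanB// (le_trans (mean_norm P _))//; exact: bounded_rvB.
have bXY := bounded_rvM bX bY; have bXY' := bounded_rvM bX' bY'.
have dXY : `|mean P (fun w => X w * Y w) - mean P (fun w => X' w * Y' w)| <=
    2 * (locality_error s + e / 4).
  rewrite -meanB//.
  have bd := bounded_rvB bXY bXY'.
  rewrite (le_trans (mean_norm P bd))//.
  have ba := bounded_rv_norm (bounded_rvB bX bX').
  have bb := bounded_rv_norm (bounded_rvB bY bY').
  apply: (@le_trans _ _ (mean P (fun w => `|X w - X' w| + `|Y w - Y' w|))).
    apply: mean_le; [exact: bounded_rv_norm|exact: bounded_rvD|move=> w].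
    have -> : X w * Y w - X' w * Y' w = (X w - X' w) * Y' w + X w * (Y w - Y' w) by lra.
    rewrite (le_trans (ler_normD _ _))// !normrM lerD//.
      by rewrite ler_piMr.
    by rewrite ler_piMl.
  by rewrite meanD// mulrDl mul1r; apply: lerD.
have prod1 : `|mean P X * mean P Y - mean P X' * mean P Y'| <= 2 * (locality_error s + e / 4).
  have -> : mean P X * mean P Y - mean P X' * mean P Y' =
     (mean P X - mean P X') * mean P Y' + mean P X * (mean P Y - mean P Y') by lra.
  rewrite (le_trans (ler_normD _ _))// !normrM mulrDl mul1r lerD//.
    rewrite (le_trans _ dX)// ler_piMr// mean_norm_le//.
  by rewrite (le_trans _ dY)// ler_piMl// mean_norm_le.
have ind : mean P (fun w => X' w * Y' w) = mean P X' * mean P Y'.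
  exact: euler_observable_indep.
rewrite ind in dXY.
have -> : 4 * locality_error s + e = 2 * (locality_error s + e / 4) +
  2 * (locality_error s + e / 4) by lra.
rewrite (le_trans (ler_distD (mean P X' * mean P Y') _ _))// lerD//.
by rewrite distrC.
Qed.

End Locality.

(** * Nice classes form a Borel set *)

Section NiceClasses.
Variables (R : realType) (M : pseudoPMetricType R).
Implicit Types (x y : rnet R M).

(** A quantitative form of niceness which reads the ball of radius [r] only. The bounds
    on the weights are strict and those on the integer sizes are stable, so that this
    is an open condition. *)
Definition nice_up_to (a : R) (r : nat) x : Prop :=
  ((1 <= r)%N ->
    #|` fset_set (ball_boundary x (root x) r)|%:R <= a * expR (a * r%:R)) /\
  forall u v, edge (net_ball x (root x) r) u v -> a^-1 < weight x u v < a.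

Lemma nice_up_toP x : nice x (root x) <-> exists a : nat, forall r, nice_up_to a.+1%:R r x.
Proof.
split=> [[[a a0 ha] infw supw]|[a H]].
  have [c c0 hc] : exists2 c : R, 0 < c & forall u v, edge x u v -> c <= weight x u v.
    move: infw; set I := ereal_inf _ => I0.
    have Iw u v : edge x u v -> (I <= (weight x u v)%:E)%E.
      by move=> uv; apply: ereal_inf_lbound; exists (u, v).
    move: I0 Iw; case: I => [i||] //= I0 Iw.
      exists i; first by rewrite -lte_fin.
      by move=> u v /Iw; rewrite lee_fin.
    by exists 1 => // u v /Iw; rewrite leye_eq.
  have [C hC] : exists C : R, forall u v, edge x u v -> weight x u v <= C.
    move: supw; set S := ereal_sup _ => S1.
    have Sw u v : edge x u v -> ((weight x u v)%:E <= S)%E.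
      by move=> uv; apply: ereal_sup_ubound; exists (u, v).
    move: S1 Sw; case: S => [i||] //= _ Sw.
      by exists i => u v /Sw; rewrite lee_fin.
    by exists 0 => u v /Sw.
  pose A := a + c^-1 + `|C|.
  exists (Num.truncn A); set k := (_.+1)%:R : R.
  have kA : A < k by exact: truncnS_gt.
  have c10 : 0 < c^-1 by rewrite invr_gt0.
  have C0 := normr_ge0 C; have CC := ler_norm C.
  have ak : a <= k by move: kA; rewrite /A; lra.
  have k0 : 0 < k by [].
  move=> r; split=> [r1|u v /net_ball_edge[_ _ uv]].
    rewrite (le_trans (ha r r1))// ler_pM ?expR_ge0 ?(ltW a0)// ler_expR.
    by rewrite ler_wpM2r.
  apply/andP; split; last by rewrite (le_lt_trans (hC _ _ uv))//; move: kA; rewrite /A; lra.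
  apply: lt_le_trans (hc _ _ uv); rewrite -[ltRHS]invrK ltf_pV2 ?posrE//.
  by move: kA; rewrite /A; lra.
have a0 : 0 < a.+1%:R :> R by [].
have edge_ball u v : edge x u v -> exists r, edge (net_ball x (root x) r) u v.
  move=> uv; have [p op] := rnet_connected (root_vertex x) (edge_vertex uv).
  have ou : ball_vertices x (root x) (size p) u by exists p.
  exists (size p).+1; apply/net_ball_edge; split=> //.
    exact: ball_vertices_le (leqnSn _) _ ou.
  exact: ball_vertices_step ou uv.
have w u v : edge x u v -> a.+1%:R^-1 < weight x u v < a.+1%:R.
  by move=> /edge_ball[r uv]; exact: (H r).2.
split.
- by exists a.+1%:R => // r r1; exact: (H r).1.
- apply: (@lt_le_trans _ _ (a.+1%:R^-1)%:E); first by rewrite lte_fin invr_gt0.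
  apply/ereal_infP => _ [[u v] /= uv <-]; rewrite lee_fin.
  by have /andP[/ltW] := w _ _ uv.
- apply: (@le_lt_trans _ _ (a.+1%:R)%:E); last exact: ltry.
  apply: ge_ereal_sup => _ [[u v] /= uv <-]; rewrite lee_fin.
  by have /andP[_ /ltW] := w _ _ uv.
Qed.

Lemma card_le_image (A C : set nat) (f : nat -> nat) : finite_set A ->
  finite_set C -> (forall v, C v -> exists2 u, A u & f u = v) ->
  (#|` fset_set C| <= #|` fset_set A|)%N.
Proof.
move=> fA fC CA; rewrite -(size_map f (fset_set A)).
apply: uniq_leq_size; first exact: fset_uniq.
move=> v; rewrite in_fset_set// inE => /CA[u Au <-].
by apply: map_f; rewrite in_fset_set// inE.
Qed.

Lemma finite_boundary x r : finite_set (ball_boundary x (root x) r).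
Proof. by apply: sub_finite_set (finite_ball_vertices x (root x) r) => v []. Qed.

(** A matching on the ball of radius [r.+1] carries the boundary of the inner ball to
    that of the other network, and finitely many strict inequalities for the weights
    persist. *)
Lemma nice_up_to_open a r x : nice_up_to a r x ->
  exists2 rho : R, 0 < rho & forall y, (rdist x y < rho%:E)%E -> nice_up_to a r y.
Proof.
move=> [xb xw].
have [n Hn] : exists n : nat, forall u v, edge (net_ball x (root x) r) u v ->
    a^-1 + (1 + n%:R)^-1 < weight x u v < a - (1 + n%:R)^-1.
  have : \forall n \near \oo, forall u, u \in ball_list x (root x) r ->
      forall v, v \in ball_list x (root x) r -> edge (net_ball x (root x) r) u v ->
      a^-1 + (1 + n%:R)^-1 < weight x u v < a - (1 + n%:R)^-1.
    apply: near_all_in => u _; apply: near_all_in => v _.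
    have [uv|nuv] := pselect (edge (net_ball x (root x) r) u v); last by near=> n.
    have /andP[w1 w2] := xw _ _ uv.
    pose e := Num.min (weight x u v - a^-1) (a - weight x u v) / 2.
    have e1 : 0 < e by rewrite divr_gt0// lt_min !subr_gt0 w1.
    apply: filterS (near_inv_le e1) => n ne _.
    have : 2 * e <= weight x u v - a^-1 by rewrite /e mulrC divfK// ge_min lexx.
    have : 2 * e <= a - weight x u v by rewrite /e mulrC divfK// ge_min lexx orbT.
    by move: e1 ne => e1 ne ? ?; apply/andP; split; lra.
  move=> [n _ /(_ n (leqnn n))H]; exists n => u v uv.
  have [xu xv _] := (net_ball_edge _ _ _ _ _).1 uv.
  by apply: H => //; exact/ball_listP.
have pos k : 0 < 1 + k%:R :> R by rewrite ltr_wpDr.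
pose rho : R := (1 + (maxn n r.+1)%:R)^-1.
exists rho; first by rewrite invr_gt0.
move=> y /ereal_inf_lt[_ [R' [d [d0 xy ->]]]]; rewrite lte_fin => Rd.
have R'0 : 0 < (1 + R'%:R)^-1 :> R by rewrite invr_gt0.
have nR : (maxn n r.+1 <= R')%N.
  have : (1 + R'%:R)^-1 < rho by apply: le_lt_trans Rd; rewrite lerDl ltW.
  by rewrite ltf_pV2 ?posrE// ltrD2l ltr_nat => /ltnW.
have rR : (r.+1 <= R')%N := leq_trans (leq_maxr _ _) nR.
have dn : d <= (1 + n%:R)^-1.
  apply: (@le_trans _ _ rho); first by apply/ltW; apply: le_lt_trans Rd; rewrite lerDr ltW.
  by rewrite lef_pV2 ?posrE// lerD2l ler_nat leq_maxl.
have [f [fi fr fm fw]] := good_le rR dn xy.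
have [g [gi gf fg]] := graph_iso_inverse fi.
have [_ fball] := graph_iso_restrict (leqnSn r) fi fr.
have gball w : ball_vertices y (root y) r.+1 w ->
    (ball_vertices x (root x) r (g w) <-> ball_vertices y (root y) r w).
  move=> yw; have [[gfun _ _] _] := gi.
  by have := fball (g w) (gfun _ yw); rewrite (fg w yw).
split=> [r1|u v].
  rewrite (le_trans _ (xb r1))// ler_nat.
  apply: (@card_le_image _ _ f); try exact: finite_boundary.
  move=> w [yw [u wu nyu]]; have [[gfun _ _] _] := gi.
  have yw1 := ball_vertices_le (leqnSn r) yw.
  have yu1 := ball_vertices_step yw wu.
  exists (g w); last exact: fg.
  split; first exact/(gball _ yw1).
  exists (g u); last by move/(gball _ yu1).
  suff /(graph_iso_edge gi)/net_ball_edge[] : edge (net_ball y (root y) r.+1) w u by [].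
  by apply/net_ball_edge.
move=> /net_ball_edge[yu yv uv].
have yu1 := ball_vertices_le (leqnSn r) yu; have yv1 := ball_vertices_le (leqnSn r) yv.
have uv1 : edge (net_ball y (root y) r.+1) u v by apply/net_ball_edge.
have guv := graph_iso_edge gi uv1.
have := fw _ _ guv; rewrite (net_ball_weight guv) !fg// (net_ball_weight uv1).
rewrite /ball/= => wd.
have /Hn : edge (net_ball x (root x) r) (g u) (g v).
  by apply/net_ball_edge; split; [exact/gball|exact/gball|case/net_ball_edge: guv].
by move: wd; rewrite ltr_norml => /andP[? ?] /andP[? ?]; apply/andP; split; lra.
Unshelve. all: by end_near. Qed.

(** Isomorphic networks are at distance [0], so openness of [nice_up_to] shows that
    niceness depends on the class only. *)
Lemma nice_class_repr (c : nstar R M) : nice_class c <-> nice (repr c) (root (repr c)).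
Proof.
split=> [[x /nice_up_toP[a H] <-]|nc]; last first.
  by exists (repr c) => //; rewrite /nclass reprK.
apply/nice_up_toP; exists a => r; have [rho rho0] := nice_up_to_open (H r).
apply; apply: rdist_iso0 => //.
by apply/nclassP; rewrite /nclass reprK.
Qed.

Lemma measurable_nice_class : measurable (@nice_class R M : set (borel (nstar R M))).
Proof.
have -> : (@nice_class R M : set (borel (nstar R M))) =
    \bigcup_a \bigcap_r [set c : nstar R M | nice_up_to a.+1%:R r (repr c)].
  apply/seteqP; split=> c.
    by move=> /nice_class_repr/nice_up_toP[a H]; exists a => // r _; exact: H.
  by move=> [a _ H]; apply/nice_class_repr/nice_up_toP; exists a => r; exact: H.
apply: bigcup_measurable => a _; apply: bigcap_measurable => // r _.
apply: sub_sigma_algebra; rewrite openE => c /nice_up_to_open[rho rho0 H].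
apply/nbhs_ballP; exists rho => //= c' cc'; exact: H.
Qed.

End NiceClasses.

(** * Finite networks and their empirical measures *)

Section FiniteNetworks.
Variables (R : realType) (M : Type).
Implicit Types (N : network R M).

Lemma ball_sub_vertex N o r : vertex N o -> ball_vertices N o r `<=` vertex N.
Proof.
move=> No; case: r => [v|r v]; first by rewrite ball_vertices0 => ->.
move/ball_verticesS=> [->//|[u _ uv]].
by apply: (@edge_vertex _ _ _ v u); rewrite edge_sym.
Qed.

(** A finite network has finitely many weights and boundaries of bounded size. *)
Lemma finite_nice N o : finite_set (vertex N) -> vertex N o -> nice N o.
Proof.
move=> fN No; pose V : seq nat := fset_set (vertex N).
have VN u v : edge N u v -> u \in V /\ v \in V.
  move=> uv; rewrite /V !in_fset_set// !inE; split; first exact: edge_vertex uv.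
  by apply: (@edge_vertex _ _ _ v u); rewrite edge_sym.
have [n Hn] : exists n : nat, forall u v, edge N u v ->
    (1 + n%:R)^-1 <= weight N u v <= n%:R.
  have : \forall n \near \oo, forall u, u \in V -> forall v, v \in V -> edge N u v ->
      (1 + n%:R)^-1 <= weight N u v <= n%:R.
    apply: near_all_in => u _; apply: near_all_in => v _.
    have [uv|nuv] := pselect (edge N u v); last by near=> n.
    have w0 := weight_gt0 uv; near=> n => _; apply/andP; split.
      by near: n; exact: near_inv_le.
    apply: ltW; apply: lt_le_trans (truncnS_gt _) _; rewrite ler_nat.
    by near: n; exact: nbhs_infty_gt.
  move=> [n _ /(_ n (leqnn n))H]; exists n => u v uv.
  by have [uV vV] := VN _ _ uv; exact: H.
split.
- exists (size V).+1%:R => // r r1.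
  have card : (#|` fset_set (ball_boundary N o r)| <= size V)%N.
    apply: uniq_leq_size; first exact: fset_uniq.
    have fb : finite_set (ball_boundary N o r).
      by apply: sub_finite_set (finite_ball_vertices N o r) => v [].
    move=> v; rewrite in_fset_set// inE => -[vb _].
    by rewrite /V in_fset_set// inE; exact: ball_sub_vertex vb.
  apply: (@le_trans _ _ (size V).+1%:R); first by rewrite ler_nat leqW.
  by rewrite ler_peMr// -expR0 ler_expR mulr_ge0.
- apply: (@lt_le_trans _ _ ((1 + n%:R)^-1)%:E); first by rewrite lte_fin invr_gt0 ltr_wpDr.
  apply/ereal_infP => _ [[u v] /= uv <-]; rewrite lee_fin.
  by have /andP[] := Hn _ _ uv.
- apply: (@le_lt_trans _ _ (n%:R)%:E); last exact: ltry.
  apply: ge_ereal_sup => _ [[u v] /= uv <-]; rewrite lee_fin.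
  by have /andP[_] := Hn _ _ uv.
Unshelve. all: by end_near. Qed.

Lemma walk_rev N u v p : walk N u v p -> exists2 q, walk N v u q & size q = size p.
Proof.
elim: p u => [|w p IH] u; rewrite /walk/=.
  by move=> [_ <-]; exists [::].
move=> [/andP[uw wp] lw]; have [q [qp ql] qs] := IH w (conj wp lw).
exists (rcons q u); last by rewrite size_rcons qs.
by split; rewrite ?last_rcons// rcons_path qp ql edge_sym.
Qed.

Lemma ball_overlap N u v w r : ball_vertices N u r w -> ball_vertices N v r w ->
  ball_vertices N u (r + r) v.
Proof.
move=> [p [pu pw] pr] [q /walk_rev[q' [qw qv] qs] qr].
exists (p ++ q'); last by rewrite size_cat leq_add// qs.
by split; rewrite ?last_cat ?cat_path pw// pu.
Qed.

Lemma ball_list_size N o r D : (forall v, (degree N v <= D)%N) ->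
  (size (ball_list N o r) <= D.+1 ^ r)%N.
Proof.
move=> deg; elim: r => [|r IH].
  rewrite expn0 -(_ : size [:: o] = 1%N)//; apply: uniq_leq_size; first exact: ball_list_uniq.
  by move=> v /ball_listP; rewrite ball_vertices0 inE => ->.
pose nb u : seq nat := fset_set [set v | edge N u v].
apply: (@leq_trans (size (ball_list N o r ++ flatten (map nb (ball_list N o r))))).
  apply: uniq_leq_size; first exact: ball_list_uniq.
  move=> v /ball_listP/ball_verticesS[->|[u ou uv]]; rewrite mem_cat; apply/orP.
    by left; apply/ball_listP; exact: ball_vertices_root.
  right; apply/flatten_mapP; exists u; first exact/ball_listP.
  by rewrite /nb in_fset_set ?inE//; exact: locally_finite.
rewrite size_cat expnS mulSn leq_add// size_flatten /shape -map_comp sumnE big_map.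
apply: (@leq_trans (\sum_(u <- ball_list N o r) D)).
  by apply: leq_sum => u _; exact: deg.
by rewrite big_const_seq count_predT iter_addn_0 leq_mul2l IH orbT.
Qed.

Lemma component_ball N o r v : ball_vertices (component_at N o) o r v ->
  ball_vertices N o r v.
Proof.
move=> [p [op pv] pr]; exists p => //; split=> //.
by apply: sub_path op => a b /= /and3P[].
Qed.

End FiniteNetworks.

Section EmpiricalMeasure.
Variables (R : realType) (M : pseudoPMetricType R).
Implicit Types (N : network R M).

Definition empirical_mean N (g : nstar R M -> R) : R :=
  let s : seq nat := fset_set (vertex N) in
  (size s)%:R^-1 * \sum_(v <- s) g (nclass (component_at N v)).

Lemma continuous_borel (X : ptopologicalType) (g : X -> R) : continuous g ->
  measurable_fun setT (g : borel X -> R).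
Proof.
move=> /continuousP cg; apply: (measurability _ (RGenOpens.measurableE R)).
move=> _ [_ [a [b ->]] <-]; rewrite setTI; apply: sub_sigma_algebra.
by apply: cg; exact: interval_open.
Qed.

Lemma U_integral N (g : nstar R M -> R) : continuous g ->
  (\int[U N]_c g c)%R = empirical_mean N g.
Proof.
move=> /continuous_borel mg.
rewrite /Rintegral /U /empirical_mean; set s : seq nat := fset_set (vertex N).
set k := (X in mscale X _).
pose at_ i : borel (nstar R M) := nclass (component_at N (nth 0%N s i)).
have ge0 (h : borel (nstar R M) -> R) : measurable_fun setT h -> (forall c, 0 <= h c) ->
    (\int[mscale k (msum (fun i => \d_(at_ i)) (size s))]_c (h c)%:E)%E =
    ((size s)%:R^-1 * \sum_(i < size s) h (at_ i))%:E.
  move=> mh h0; have mh' : measurable_fun setT (EFin \o h) by exact/measurable_EFinP.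
  rewrite ge0_integral_mscale//; last by move=> c _; rewrite lee_fin.
  rewrite ge0_integral_measure_sum//; last by move=> c _; rewrite lee_fin.
  rewrite EFinM; congr (_ * _)%E; rewrite -sumEFin; apply: eq_bigr => i _.
  by rewrite integral_dirac// diracT mul1e.
have pos (c : borel (nstar R M)) : ((fun c => (g c)%:E)^\+ c)%E = (Num.max (g c) 0)%:E.
  by rewrite funeposE -EFin_max.
have neg (c : borel (nstar R M)) : ((fun c => (g c)%:E)^\- c)%E = (Num.max (- g c) 0)%:E.
  by rewrite funenegE -EFinN -EFin_max.
set mu := mscale k _.
have -> : (\int[mu]_c (g c)%:E)%E =
    (\int[mu]_c (Num.max (g c) 0)%:E - \int[mu]_c (Num.max (- g c) 0)%:E)%E.
  rewrite integralE; congr (_ - _)%E; apply: eq_integral => c _.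
    exact: pos.
  exact: neg.
rewrite ge0; [|by apply: measurable_maxr|by move=> c; rewrite le_max lexx orbT].
rewrite ge0; [|by apply: measurable_maxr => //; exact: measurable_funN|
  by move=> c; rewrite le_max lexx orbT].
rewrite -EFinB/= -mulrBr -sumrB; congr (_ * _).
rewrite (big_nth 0%N) big_mkord; apply: eq_bigr => i _.
rewrite -/(at_ i); have [gp|gn] := leP 0 (g (at_ i)).
  by rewrite max_r ?oppr_le0// subr0.
by rewrite max_l ?oppr_ge0 ?(ltW gn)// sub0r opprK.
Qed.

End EmpiricalMeasure.
Section Components.
Variables (R : realType) (T : R) (phi : R * R * R * R -> R) (psi : R * R -> R).
Implicit Types (N : network R (R * R)%type).

Lemma component_step M (N : network R M) o u v :
  component N o u -> edge N u v -> component N o v.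
Proof.
move=> [p [op pu]] uv; exists (rcons p v).
by split; rewrite ?last_rcons// rcons_path op pu.
Qed.

Lemma component_sub_vertex M (N : network R M) o : vertex N o -> component N o `<=` vertex N.
Proof. by move=> No v [p op]; apply: (@ball_sub_vertex _ _ N o (size p)) => //; exists p. Qed.

(** All neighbors of a vertex lie in its component. *)
Lemma component_drift N o y v : vertex N o -> component N o v ->
  drift phi psi (component_at N o) y v = drift phi psi N y v.
Proof.
move=> No ov; have Nv := component_sub_vertex No ov.
pose s := ball_list N v 1.
have us : uniq s by exact: ball_list_uniq.
have sP u : u \in s -> u = v \/ edge N v u.
  move=> /ball_listP/ball_verticesS[->|[w]]; first by left.
  by rewrite ball_vertices0 => ->; right.
have so u : u \in s -> component N o u.
  by move=> /sP[->//|vu]; exact: component_step ov vu.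
have vs u : edge N v u -> u \in s.
  move=> vu; apply/ball_listP/ball_verticesS; right; exists v => //.
  exact: ball_vertices_root.
have ew u : u \in s -> weight (component_at N o) u v = weight N u v.
  move=> /so ou /=; case: ifPn => // /negP nuv.
  apply/esym/weight0/negP => uv; apply: nuv; apply/and3P.
  by split=> //; exact/mem_set.
rewrite (@driftE _ phi psi (component_at N o) s)//; last first.
  by move=> u /and3P[_ _]; exact: vs.
rewrite (@driftE _ phi psi N s)//; last by move=> u /so; exact: component_sub_vertex.
rewrite /waverage /=; congr (_^-1 * _ + _).
  by rewrite big_seq [RHS]big_seq; apply: eq_bigr.
by rewrite big_seq [RHS]big_seq; apply: eq_bigr => u /ew E; congr (_ * _); exact: E.
Qed.

(** The identity is an isomorphism, as trajectories are attached to vertices. *)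
Lemma with_paths_component (N : network R (R * R)%type) (Omega : Type)
    (theta : nat -> Omega -> cpath T) w v :
  nclass (component_at (net_theta N theta w) v) =
  nclass (with_paths (component_at N v) (fun u => theta u w)).
Proof.
apply/nclassP; exists id; split=> //.
by split=> //; split=> // u ou; exists u.
Qed.

Context d (Omega : measurableType d) (P : probability Omega R).
Variables (B : nat -> R -> Omega -> R).
Hypotheses (T_gt0 : 0 < T) (B_brownian : iid_brownian P B).

Lemma filtration_measurable t (A : set Omega) : filtration P B t A -> measurable A.
Proof.
apply: smallest_sub; first exact: sigma_algebra_measurable.
move=> C [[v _ [s + [D mD <-]]]|[]//].
rewrite /= in_itv/= => /andP[s0 _]; have [mB _ _ _ _] := B_brownian.1 v.
by rewrite -[X in measurable X]setTI; exact: mB.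
Qed.

Lemma strong_on_component N (theta : nat -> Omega -> cpath T) v : vertex N v ->
  strong_solution phi psi P B N theta ->
  strong_on phi psi P B (component_at N v) theta.
Proof.
move=> Nv [adapted sol]; split.
  move=> u t vu tT _ D mD; rewrite setTI; apply: filtration_measurable.
  by apply: adapted => //; exact: component_sub_vertex vu.
apply: filterS sol => w sol u t vu tT.
rewrite sol//; last exact: component_sub_vertex vu.
by congr (_ + _ + _); apply: eq_Rintegral => s _; rewrite component_drift.
Qed.

Lemma strong_on_rnet (x : rnet R (R * R)%type) (theta : nat -> Omega -> cpath T) :
  strong_solution phi psi P B x theta -> strong_on phi psi P B x theta.
Proof.
move=> [adapted sol]; split.
  by move=> u t xu tT _ D mD; rewrite setTI; apply: filtration_measurable; exact: adapted.
by apply: filterS sol => w sol u t xu tT; exact: sol.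
Qed.

End Components.

(** * Concentration of local averages *)

Section Variance.
Context d (Omega : measurableType d) (R : realType) (P : probability Omega R).

(** The square expands into covariances. In the row of [u], at most [D] of them are
    bounded by [2] only and the others by [e]. *)
Lemma sum_concentration (s : seq nat) (X : nat -> Omega -> R) (near_ : nat -> seq nat)
    (D : nat) (e : R) (n := (size s)%:R : R) : uniq s -> (0 < size s)%N -> 0 <= e ->
  (forall v, bounded_rv (X v)) -> (forall v w, `|X v w| <= 1) ->
  (forall v, uniq (near_ v) /\ (size (near_ v) <= D)%N) ->
  (forall u v, u \in s -> v \in s -> v \notin near_ u ->
    `|mean P (fun w => X u w * X v w) - mean P (X u) * mean P (X v)| <= e) ->
  mean P (fun w => (n^-1 * \sum_(v <- s) X v w -
    mean P (fun w' => n^-1 * \sum_(v <- s) X v w')) ^+ 2) <= e + 2 * D%:R / n.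
Proof.
move=> us s0 e0 bX X1 nD cov.
have n0 : 0 < n by rewrite ltr0n.
pose a v := mean P (X v).
have a1 v : `|a v| <= 1 by exact: mean_norm_le.
have bS : bounded_rv (fun w => \sum_(v <- s) X v w) by exact: bounded_rv_sum.
have mS : mean P (fun w => n^-1 * \sum_(v <- s) X v w) = n^-1 * \sum_(v <- s) a v.
  by rewrite meanZ// mean_sum.
rewrite mS.
have bc (c : R) : @bounded_rv d Omega R (fun=> c) by exact: bounded_rv_cst.
have bXa v : bounded_rv (fun w => X v w - a v) by exact: bounded_rvB.
have -> : (fun w => (n^-1 * \sum_(v <- s) X v w - n^-1 * \sum_(v <- s) a v) ^+ 2) =
    (fun w => (n^-1 ^+ 2) * \sum_(u <- s) \sum_(v <- s) (X u w - a u) * (X v w - a v)).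
  apply/funext => w; rewrite -mulrBr -sumrB exprMn; congr (_ * _).
  by rewrite expr2 big_distrlr.
have bXX u v : bounded_rv (fun w => (X u w - a u) * (X v w - a v)) by exact: bounded_rvM.
rewrite meanZ; last by apply: bounded_rv_sum => u; exact: bounded_rv_sum.
rewrite mean_sum => [|u]; last exact: bounded_rv_sum.
have row u : u \in s ->
    mean P (fun w => \sum_(v <- s) (X u w - a u) * (X v w - a v)) <= n * e + 2 * D%:R.
  move=> us'; rewrite mean_sum//.
  have term v : mean P (fun w => (X u w - a u) * (X v w - a v)) =
      mean P (fun w => X u w * X v w) - a u * a v.
    have -> : (fun w => (X u w - a u) * (X v w - a v)) =
        (fun w => (X u w * X v w - a v * X u w) - (a u * X v w - a u * a v)).
      by apply/funext => w; lra.
    have b1 := bounded_rvM (bX u) (bX v); have b2 := bounded_rvM (bc (a v)) (bX u).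
    have b3 := bounded_rvM (bc (a u)) (bX v); have b4 := bc (a u * a v).
    rewrite meanB; [|exact: bounded_rvB|exact: bounded_rvB].
    by rewrite meanB// meanB// !meanZ// mean_cst -/(a u) -/(a v); lra.
  under eq_bigr do rewrite term.
  rewrite (bigID (fun v => v \in near_ u))/= addrC lerD//.
    apply: (@le_trans _ _ (\sum_(v <- s) e)).
      rewrite big_mkcond/= big_seq [leRHS]big_seq; apply: ler_sum => v vs.
      by case: ifPn => // vn; rewrite (le_trans (ler_norm _))// cov.
    by rewrite big_const_seq count_predT iter_addr addr0 mulr_natl.
  apply: (@le_trans _ _ (\sum_(v <- s | v \in near_ u) 2)).
    apply: ler_sum => v _; rewrite (le_trans (ler_norm _))//.
    rewrite (le_trans (ler_normB _ _))//.
    have : `|mean P (fun w => X u w * X v w)| <= 1.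
      apply: mean_norm_le; first exact: bounded_rvM.
      by move=> w; rewrite normrM mulr_ile1.
    have : `|a u * a v| <= 1 by rewrite normrM mulr_ile1.
    lra.
  rewrite big_const_seq iter_addr addr0 -[_ *+ count _ _]mulr_natr ler_wpM2l// ler_nat.
  rewrite -size_filter (leq_trans _ (nD u).2)//.
  apply: uniq_leq_size; first exact: filter_uniq.
  by move=> v; rewrite mem_filter => /andP[].
apply: (@le_trans _ _ (n^-1 ^+ 2 * \sum_(u <- s) (n * e + 2 * D%:R))).
  rewrite ler_wpM2l ?exprn_ge0 ?invr_ge0 ?(ltW n0)// big_seq [leRHS]big_seq.
  by apply: ler_sum => u us'; exact: row.
rewrite big_const_seq count_predT iter_addr addr0 -[_ *+ size s]mulr_natl -/n.
have nn : n^-1 * n = 1 by rewrite mulVf// gt_eqF.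
have -> : n^-1 ^+ 2 * (n * (n * e + 2 * D%:R)) =
   (n^-1 * n) * ((n^-1 * n) * e + 2 * D%:R * n^-1) by lra.
by rewrite nn !mul1r.
Qed.

End Variance.

Section Degrees.
Variable R : realType.

(** With [eta = 1 / (2 q + 1)], eventually [(Delta n).+1 ^ q] is at most
    [2 ^ q * n `^ (q * eta)], and the exponent is less than [1/2]. *)
Lemma subpolynomial_balls (eps : nat -> R) (Delta : nat -> nat) (q : nat) :
  eps n @[n --> \oo] --> (0 : R) ->
  (\forall n \near \oo, (Delta n)%:R = n%:R `^ eps n) ->
  ((Delta n).+1 ^ q)%N%:R / n%:R @[n --> \oo] --> (0 : R).
Proof.
move=> eps0 DE; apply/cvgrPdist_le => e e0.
pose eta : R := (q.*2.+1%:R)^-1.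
have eta0 : 0 < eta by rewrite invr_gt0.
have near_eps : \forall n \near \oo, `|0 - eps n| <= eta by exact: (cvgrPdist_le _ _).1.
near=> n.
have n0 : (0 < n)%N by near: n; exact: nbhs_infty_gt.
have nR0 : 0 < n%:R :> R by rewrite ltr0n.
have n1 : 1 <= n%:R :> R by rewrite ler1n.
have epsn : eps n <= eta.
  have : `|0 - eps n| <= eta by near: n.
  by rewrite sub0r normrN; apply: le_trans; exact: ler_norm.
have D1 : (Delta n).+1%:R <= 2 * n%:R `^ eta :> R.
  have DR : (Delta n)%:R = n%:R `^ eps n :> R by near: n.
  rewrite -natr1 DR.
  have a1 : n%:R `^ eps n <= n%:R `^ eta by exact: ler_powR.
  have a2 : 1 <= n%:R `^ eta by have := ler_powR n1 (ltW eta0); rewrite powRr0.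
  lra.
have sq : (n%:R `^ eta) ^+ q <= Num.sqrt n%:R.
  rewrite -powR12_sqrt ?ler0n// -powR_mulrn ?powR_ge0// -powRrM ler_powR//.
  have qE : q.*2.+1%:R = 2 * q%:R + 1 :> R by rewrite -natr1 -muln2 natrM mulrC.
  rewrite /eta qE mulrC ler_pdivrMr; last by rewrite ltr_wpDl// mulr_ge0.
  by lra.
have Dq : ((Delta n).+1 ^ q)%N%:R <= 2 ^+ q * Num.sqrt n%:R :> R.
  rewrite natrX (le_trans (lerXn2r _ _ _ D1)) ?nnegrE// ?mulr_ge0 ?powR_ge0//.
  by rewrite exprMn ler_wpM2l ?exprn_ge0.
rewrite sub0r normrN ger0_norm ?divr_ge0// ler_pdivrMr//.
apply: (le_trans Dq).
have sn0 : 0 < Num.sqrt n%:R :> R by rewrite sqrtr_gt0.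
have -> : e * n%:R = (e * Num.sqrt n%:R) * Num.sqrt n%:R.
  by rewrite -mulrA -expr2 sqr_sqrtr// ltW.
rewrite ler_wpM2r ?(ltW sn0)// -ler_pdivrMl//.
rewrite -[leLHS]ger0_norm ?mulr_ge0 ?invr_ge0 ?(ltW e0) ?exprn_ge0//.
rewrite -sqrtr_sqr ler_sqrt ?ler0n//.
set C := _ ^+ 2; have : (Num.truncn C < n)%N by near: n; exact: nbhs_infty_gt.
by move=> Cn; rewrite ltW// (lt_le_trans (truncnS_gt _))// ler_nat.
Unshelve. all: by end_near. Qed.

End Degrees.

(** * Convergence of the empirical observables *)

Section LipschitzConstants.
Variable R : realType.

Lemma lipschitz_coordinates2 (f : R * R -> R) : lipschitz f ->
  exists2 K : R, 0 <= K & forall a b a' b' (D : R),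
  `|a - a'| <= D -> `|b - b'| <= D -> `|f (a, b) - f (a', b')| <= K * D.
Proof.
move=> /pinfty_ex_gt0[K K0 fK]; exists K; first exact: ltW.
move=> a b a' b' D aD bD.
have := fK ((a, b), (a', b')) => /(_ (conj Logic.I Logic.I))/= h.
apply: (le_trans h); rewrite ler_wpM2l ?(ltW K0)//.
by rewrite /Num.norm/= ge_max aD.
Qed.

Lemma lipschitz_coordinates4 (f : R * R * R * R -> R) : lipschitz f ->
  exists2 K : R, 0 <= K & forall a b c e a' b' c' e' (D : R),
  `|a - a'| <= D -> `|b - b'| <= D -> `|c - c'| <= D -> `|e - e'| <= D ->
  `|f (a, b, c, e) - f (a', b', c', e')| <= K * D.
Proof.
move=> /pinfty_ex_gt0[K K0 fK]; exists K; first exact: ltW.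
move=> a b c e a' b' c' e' D aD bD cD eD.
have := fK ((a, b, c, e), (a', b', c', e')) => /(_ (conj Logic.I Logic.I))/= h.
apply: (le_trans h); rewrite ler_wpM2l ?(ltW K0)//.
by rewrite /Num.norm/= !ge_max aD bD cD eD.
Qed.

End LipschitzConstants.

(** Replace the factors one at a time. *)
Lemma prod_dist (R : realType) (I : Type) (s : seq I) (a b : I -> R) :
  (forall i, `|a i| <= 1) -> (forall i, `|b i| <= 1) ->
  `|\prod_(i <- s) a i - \prod_(i <- s) b i| <= \sum_(i <- s) `|a i - b i|.
Proof.
move=> a1 b1; elim: s => [|i s IH]; first by rewrite !big_nil subrr normr0.
have pb : `|\prod_(j <- s) b j| <= 1.
  elim: s {IH} => [|j s IH]; first by rewrite big_nil normr1.
  by rewrite big_cons normrM mulr_ile1.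
rewrite !big_cons.
have -> : a i * \prod_(j <- s) a j - b i * \prod_(j <- s) b j =
   (a i - b i) * \prod_(j <- s) b j + a i * (\prod_(j <- s) a j - \prod_(j <- s) b j) by lra.
rewrite (le_trans (ler_normD _ _))// !normrM lerD//; first by rewrite ler_piMr.
by rewrite (le_trans _ IH)// ler_piMl.
Qed.

Section FullMeasure.
Import HBNNSimple.

(** The integral of a nonnegative function is defined here as a supremum over simple
    functions for arbitrary integrands, so it makes sense for [f], which need not be
    measurable. A simple function below [f] is almost everywhere below [g], and [g]
    restricted to [A] is below [f]. *)
Lemma expectation_full d (Omega : measurableType d) (R : realType)
    (P : probability Omega R) (A : set Omega) (f g : Omega -> R) :
  measurable A -> P A = 1%E -> bounded_rv g -> (forall w, A w -> f w = g w) ->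
  ('E_P[f] = (mean P g)%:E)%E.
Proof.
move=> mA PA bg fg; have PAC : P (~` A) = 0%E.
  by rewrite probability_setC// PA subee.
have aeA : {ae P, forall w, A w} by exists (~` A); split => //; exact: measurableC.
have main (u v : Omega -> \bar R) : (forall w, 0 <= u w)%E -> (forall w, 0 <= v w)%E ->
    measurable_fun setT v -> (forall w, A w -> u w = v w) ->
    (\int[P]_w u w = \int[P]_w v w)%E.
  move=> u0 v0 mv uv; apply/eqP; rewrite eq_le; apply/andP; split.
    rewrite ge0_integralTE//; apply: ge_ereal_sup => _ [h hu <-].
    rewrite -integralT_nnsfun; apply: ae_ge0_le_integral => //.
    - by move=> w _; rewrite lee_fin; exact: fun_ge0.
    - by apply/measurable_EFinP.
    - by apply: filterS aeA => w Aw _; rewrite -uv.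
  rewrite (@ge0_ae_eq_integral _ _ _ P setT v (v \_ A))//; last first.
  - by apply: filterS aeA => w Aw _; rewrite patchT// inE.
  - by move=> w _; apply: erestrict_ge0.
  - by apply/(measurable_restrictT _ _).1 => //; exact: measurable_funS mv.
  rewrite ge0_integralTE//; last by move=> w; apply: erestrict_ge0.
  rewrite ge0_integralTE//; apply: le_ereal_sup => _ [h hv <-]; exists h => //= w.
  apply: le_trans (hv w) _; rewrite patchE; case: ifPn => [|_]; last exact: u0.
  by rewrite inE => /uv ->.
have mg : measurable_fun setT (EFin \o g) by apply/measurable_EFinP; case: bg.
rewrite -mean_expectation//.
have -> : ('E_P[f] = \int[P]_w (f w)%:E)%E by rewrite unlock.
have -> : ('E_P[g] = \int[P]_w (g w)%:E)%E by rewrite unlock.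
rewrite (integralE P setT (EFin \o f)) (integralE P setT (EFin \o g)).
have pos : (\int[P]_w (EFin \o f)^\+ w = \int[P]_w (EFin \o g)^\+ w)%E.
  apply: main.
  - by move=> w; exact: funepos_ge0.
  - by move=> w; exact: funepos_ge0.
  - exact: measurable_funepos.
  - by move=> w /fg fgw; rewrite !funeposE /= fgw.
have neg : (\int[P]_w (EFin \o f)^\- w = \int[P]_w (EFin \o g)^\- w)%E.
  apply: main.
  - by move=> w; exact: funeneg_ge0.
  - by move=> w; exact: funeneg_ge0.
  - exact: measurable_funeneg.
  - by move=> w /fg fgw; rewrite !funenegE /= fgw.
by rewrite pos neg.
Qed.

End FullMeasure.

Lemma locality_error_small (R : realType) (T Mphi L e : R) : 0 <= Mphi -> 0 < e ->
  exists s, locality_error T Mphi L s <= e.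
Proof.
move=> M0 e0; pose C : R := 1 + 2 * Mphi * expR ((4 * L + 1) * T).
have C0 : 0 < C by rewrite ltr_wpDr// !mulr_ge0 ?expR_ge0.
have e1 : 0 < e / (2 * C) by rewrite divr_gt0// mulr_gt0.
have [s _ /(_ s (leqnn s)) se] := near_inv_le e1.
exists s; rewrite /locality_error; set E := 2 * Mphi * _ in C C0 e1 se *.
have s0 : 0 < 1 + s%:R :> R by rewrite ltr_wpDr.
have E0 : 0 <= E by rewrite !mulr_ge0 ?expR_ge0.
have p : (2 ^+ s)^-1 <= (1 + s%:R)^-1 :> R.
  rewrite lef_pV2 ?posrE ?exprn_gt0//.
  by rewrite addrC natr1 -natrX ler_nat ltn_expl.
(* Both terms of the error are at most a multiple of [(1 + s%:R)^-1], as
   [s < 2 ^ s]. *)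
apply: (@le_trans _ _ (2 * (C * (1 + s%:R)^-1))).
  by rewrite ler_wpM2l// /C mulrDl mul1r lerD2l ler_wpM2l.
have : C * (1 + s%:R)^-1 <= C * (e / (2 * C)) by rewrite ler_wpM2l// ltW.
have -> : C * (e / (2 * C)) = e / 2.
  by rewrite invfM mulrCA (mulrCA C) mulfV ?mulr1// gt_eqF.
lra.
Qed.

Section Convergence.
Variables (R : realType) (T : R) (phi : R * R * R * R -> R) (psi : R * R -> R).
Variables (Mphi L : R).
Hypothesis T_gt0 : 0 < T.
Hypotheses (Mphi_ge0 : 0 <= Mphi) (L_ge0 : 0 <= L).
Hypothesis phi_le : forall p, `|phi p| <= Mphi.
Hypothesis phi_lip : forall a b c e a' b' c' e' (D : R),
  `|a - a'| <= D -> `|b - b'| <= D -> `|c - c'| <= D -> `|e - e'| <= D ->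
  `|phi (a, b, c, e) - phi (a', b', c', e')| <= L * D.
Hypothesis psi_lip : forall a b a' b' (D : R),
  `|a - a'| <= D -> `|b - b'| <= D -> `|psi (a, b) - psi (a', b')| <= L * D.
Context d (Omega : measurableType d) (P : probability Omega R).
Variables (B : nat -> R -> Omega -> R).
Hypotheses (B_brownian : iid_brownian P B).
Variable theta : network R (R * R)%type -> nat -> Omega -> cpath T.
Hypothesis theta_sol : forall N : network R (R * R)%type,
    (exists2 o, vertex N o & nice N o) ->
    strong_solution phi psi P B N (theta N).
Variable (F : nstar R (R * cpath T)%type -> R).
Hypothesis F_bl : (bl_norm F <= 1)%E.
Variable nu : probability (borel (nstar R (R * R)%type)) R.
Hypothesis nu_nice : nu (@nice_class R (R * R)%type) = 1%E.

Notation err := (locality_error T Mphi L).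
Notation nice_set := (@nice_class R (R * R)%type : set (borel _)).
Notation lmean := (local_mean phi psi P B F).

Let F_le c : `|F c| <= 1.
Proof. by have [] := bl_norm_bounds F_bl. Qed.

Lemma F_continuous : continuous F.
Proof.
move=> c; apply/(@cvgrPdist_le _ _ _ (nbhs c)) => e e0.
apply/nbhs_ballP; exists (e / 2) => /=; first by rewrite divr_gt0.
move=> c' cc'; have -> : e = 2 * (e / 2) by lra.
by have [_] := bl_norm_bounds F_bl; apply => //; rewrite divr_gt0.
Qed.

Definition class_mean (c : nstar R (R * R)%type) : R :=
  let x : rnet R (R * R)%type := repr c in
  mean P (fun w => F (nclass (rnet_theta x (theta x) w))).

Lemma class_mean_local s (c : nstar R (R * R)%type) : nice_class c ->
  `|class_mean c - lmean (s + s) c| <= err s.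
Proof.
move=> /nice_class_repr nc; set x : rnet R (R * R)%type := repr c in nc.
have st : strong_on phi psi P B x (theta x).
  apply: strong_on_rnet => //; apply: theta_sol; exists (root x) => //.
  exact: root_vertex.
have := observable_mean_local T_gt0 Mphi_ge0 L_ge0 phi_le phi_lip psi_lip B_brownian
  F_bl st s.
by rewrite /nclass reprK.
Qed.

(** Off the nice classes, [class_mean] is out of control; it is cut off there. *)
Let nice_part (c : borel (nstar R (R * R)%type)) : R :=
  if c \in nice_set then class_mean c else 0.

Let lmean_bounded r : @bounded_rv _ (borel (nstar R (R * R)%type)) R (lmean r).
Proof.
split; last by exists 1 => c; exact: local_mean_le.
apply: continuous_borel.
exact: (local_mean_continuous T_gt0 Mphi_ge0 L_ge0 phi_le phi_lip psi_lip B_brownian F_bl).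
Qed.

Let nice_part_near s c :
  `|nice_part c - lmean (s + s) c * \1_nice_set c| <= err s.
Proof.
rewrite /nice_part indicE; case: (boolP (c \in _)) => [|_].
  by rewrite inE mulr1 => /class_mean_local.
by rewrite mulr0 subrr normr0 locality_error_ge0.
Qed.

Let nice_part_bounded : bounded_rv nice_part.
Proof.
have bi : bounded_rv (\1_nice_set : borel _ -> R).
  by apply: bounded_rv_indic; exact: measurable_nice_class.
split; last first.
  exists (err 0 + 1) => c; have := nice_part_near 0 c.
  have : `|lmean (0 + 0) c * \1_nice_set c| <= 1.
    rewrite normrM mulr_ile1 ?local_mean_le//.
    by rewrite indicE; case: (_ \in _); rewrite ?normr0 ?normr1.
  move=> h1 h2; rewrite -(subrK (lmean (0 + 0) c * \1_nice_set c) (nice_part c)).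
  by rewrite (le_trans (ler_normD _ _))// lerD.
have /choice[s_ s_small] n : exists s, err s <= (1 + n%:R)^-1.
  exact: locality_error_small.
pose h n (c : borel (nstar R (R * R)%type)) : R := lmean (s_ n + s_ n) c *
  \1_nice_set c.
apply: (@measurable_fun_cvg _ (borel (nstar R (R * R)%type)) R setT h).
  by move=> n; have [] := bounded_rvM (lmean_bounded (s_ n + s_ n)) bi.
move=> c _; apply/cvgrPdist_le => e e0; apply: filterS (near_inv_le e0) => n ne.
by rewrite (le_trans (nice_part_near _ _))// (le_trans (s_small n)).
Qed.

Definition limit_mean : R := mean nu nice_part.

(** The class is nice almost surely, so cutting off does not change the integral. *)
Lemma limit_mean_local s : `|mean nu (lmean (s + s)) - limit_mean| <= err s.
Proof.
have mn := @measurable_nice_class R (R * R)%type.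
have mnC := measurableC mn.
have bi := bounded_rv_indic R mn; have biC := bounded_rv_indic R mnC.
have bl := lmean_bounded (s + s).
rewrite distrC -meanB; [|exact: nice_part_bounded|exact: bl].
have bd := bounded_rvB nice_part_bounded bl.
rewrite (le_trans (mean_norm nu bd))//.
have be : @bounded_rv _ (borel (nstar R (R * R)%type)) R (fun=> err s) by exact: bounded_rv_cst.
apply: (@le_trans _ _ (mean nu (fun c => err s + \1_(~` nice_set) c))).
  apply: mean_le; [exact: bounded_rv_norm|exact: bounded_rvD|move=> c].
  have := nice_part_near s c; rewrite /nice_part !indicE in_setC.
  case: (boolP (c \in _)) => /= _; first by rewrite mulr1 addr0.
  by move=> _; rewrite sub0r normrN (le_trans (local_mean_le _ _ _ _ _ _ _))//
    lerDr locality_error_ge0.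
rewrite meanD// mean_cst mean_indic//.
have -> : nu (~` nice_set) = 0%E.
  by rewrite probability_setC// nu_nice subee.
by rewrite addr0.
Qed.

Lemma limit_mean_le : `|limit_mean| <= 1.
Proof.
apply/ler_addgt0Pr => e e0; have [s se] := locality_error_small T L Mphi_ge0 e0.
have : `|mean nu (lmean (s + s))| <= 1.
  by apply: mean_norm_le; [exact: lmean_bounded|move=> c; exact: local_mean_le].
have := limit_mean_local s; rewrite distrC => h1 h2.
rewrite -(subrK (mean nu (lmean (s + s))) limit_mean) addrC.
rewrite (le_trans (ler_normD _ _))// lerD//; exact: le_trans h1 se.
Qed.

Lemma limit_mean_expectation d' (Omega' : measurableType d') (P' : probability Omega' R)
    (Y : Omega' -> borel (nstar R (R * R)%type)) : measurable_fun setT Y ->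
  (forall A, measurable A -> P' (Y @^-1` A) = nu A) ->
  ('E_P'[fun w => class_mean (Y w)] = limit_mean%:E)%E.
Proof.
move=> mY lawY; have mn := @measurable_nice_class R (R * R)%type.
have [mnp [K np]] := nice_part_bounded.
have bY : bounded_rv (fun w => nice_part (Y w)).
  by split; [exact: measurableT_comp|exists K].
rewrite (@expectation_full _ _ _ P' (Y @^-1` nice_set) _
  (fun w => nice_part (Y w)))//.
- congr (_%:E); rewrite /limit_mean /mean /Rintegral; congr fine.
  have -> : (\int[nu]_c (nice_part c)%:E = \int[pushforward P' Y]_c (nice_part c)%:E)%E.
    by apply: eq_measure_integral => A mA _; rewrite /= -lawY.
  rewrite integral_pushforward//.
  + exact/measurable_EFinP.
  + exact: bounded_rv_integrable.
- by rewrite -[X in measurable X]setTI; exact: mY.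
- by rewrite lawY.
- by move=> w Yw; rewrite /nice_part mem_set.
Qed.

Variable N : nat -> network R (R * R)%type.
Hypothesis vertexN : forall n, vertex (N n) = [set v | (1 <= v <= n)%N].
Hypothesis UN_cvg : weak_cvg (fun n => U (N n)) nu.
Variable eps : nat -> R.
Hypothesis eps_cvg0 : eps n @[n --> \oo] --> (0 : R).
Hypothesis max_degree : \forall n \near \oo,
    (\max_(1 <= v < n.+1) degree (N n) v)%:R = n%:R `^ eps n.

Definition empirical_observable n (w : Omega) : R :=
  (\int[U (net_theta (N n) (theta (N n)) w)]_c F c)%R.

Let vs n : seq nat := fset_set (vertex (N n)).

Let vsE n : perm_eq (vs n) (iota 1 n).
Proof.
apply: uniq_perm; [exact: fset_uniq|exact: iota_uniq|move=> v].
have fv : finite_set (vertex (N n)).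
  rewrite vertexN; apply: (@sub_finite_set _ _ [set` iota 1 n]); last exact: finite_seq.
  by move=> u /= /andP[? ?]; rewrite mem_iota add1n ltnS; apply/andP.
rewrite /vs in_fset_set// vertexN mem_iota add1n ltnS.
by apply/idP/idP; rewrite inE.
Qed.

Let vs_vertex n v : v \in vs n -> vertex (N n) v.
Proof. by rewrite (perm_mem (vsE n)) mem_iota add1n ltnS vertexN. Qed.

Let vs_size n : size (vs n) = n.
Proof. by rewrite (perm_size (vsE n)) size_iota. Qed.

Let strongN n : (0 < n)%N -> strong_solution phi psi P B (N n) (theta (N n)).
Proof.
move=> n0; apply: theta_sol; have N1 : vertex (N n) 1%N by rewrite vertexN /= n0.
exists 1%N => //; apply: finite_nice => //; rewrite vertexN.
apply: (@sub_finite_set _ _ [set` iota 1 n]); last exact: finite_seq.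
by move=> v /= /andP[? ?]; rewrite mem_iota add1n ltnS; apply/andP.
Qed.

(** The observable seen from [v]. It is extended by [0] to numbers which are not
    vertices, so that it is a bounded random variable for all [v]. *)
Let var n v : Omega -> R :=
  if v \in vs n then observable F (component_at (N n) v) (theta (N n)) else (fun=> 0).

Let empirical_observableE n w :
  empirical_observable n w = n%:R^-1 * \sum_(v <- vs n) var n v w.
Proof.
rewrite /empirical_observable U_integral; last exact: F_continuous.
rewrite /empirical_mean -/(vs n) vs_size; congr (_ * _).
rewrite big_seq [RHS]big_seq; apply: eq_bigr => v vn.
by rewrite /var vn with_paths_component.
Qed.

Let strong_var n v : v \in vs n -> strong_on phi psi P B (component_at (N n) v) (theta (N n)).
Proof.
move=> vn; have n0 : (0 < n)%N.
  by rewrite -[X in (0 < X)%N]vs_size; case: (vs n) vn.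
by apply: strong_on_component => //; [exact: vs_vertex|exact: strongN].
Qed.

Let var_bounded n v : bounded_rv (var n v).
Proof.
rewrite /var; case: ifPn => [vn|_]; last exact: bounded_rv_cst.
exact: (observable_bounded T_gt0 F_bl (strong_var vn)).
Qed.

Let var_le n v w : `|var n v w| <= 1.
Proof. by rewrite /var; case: ifPn => _; [exact: F_le|rewrite normr0]. Qed.

Lemma empirical_observable_bounded n : bounded_rv (empirical_observable n).
Proof.
rewrite (_ : empirical_observable n = (fun w => n%:R^-1 * \sum_(v <- vs n) var n v w)).
  apply: bounded_rvM; first exact: bounded_rv_cst.
  by apply: bounded_rv_sum => v; exact: var_bounded.
by apply/funext => w; exact: empirical_observableE.
Qed.

Lemma average_le n (a : nat -> R) c : 0 <= c -> (forall v, v \in vs n -> `|a v| <= c) ->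
  `|n%:R^-1 * \sum_(v <- vs n) a v| <= c.
Proof.
move=> c0 ac; rewrite normrM ger0_norm ?invr_ge0//.
have [->|n0] := posnP n; first by rewrite invr0 mul0r.
rewrite ler_pdivrMl ?ltr0n// (le_trans (ler_norm_sum _ _ _))//.
apply: (@le_trans _ _ (\sum_(v <- vs n) c)).
  by rewrite big_seq [leRHS]big_seq; apply: ler_sum => v; exact: ac.
by rewrite big_const_seq count_predT iter_addr addr0 -[_ *+ size _]mulr_natl vs_size.
Qed.

Lemma empirical_observable_le n w : `|empirical_observable n w| <= 1.
Proof. by rewrite empirical_observableE; apply: average_le => // v _; exact: var_le. Qed.

Lemma degree_le n v : (degree (N n) v <= \max_(1 <= u < n.+1) degree (N n) u)%N.
Proof.
have [vn|nv] := boolP (v \in vs n).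
  apply: (@leq_bigmax_seq _ (index_iota 1 n.+1) xpredT (fun u => degree (N n) u) v) => //.
  by rewrite mem_index_iota; move: vn; rewrite (perm_mem (vsE n)) mem_iota add1n.
rewrite /degree (_ : [set u | edge (N n) v u] = set0) ?fset_set0 ?cardfs0//.
apply/seteqP; split=> // u vu; move/negP: nv; apply.
rewrite (perm_mem (vsE n)) mem_iota add1n ltnS.
by have := edge_vertex vu; rewrite vertexN.
Qed.

(** The error splits into the fluctuation around the mean [m], controlled by the
    variance, and the distance from [m] to the limit, in three moves: from the
    observables to [local_mean], from [U (N n)] to [nu] by weak convergence, and from
    [local_mean] back to the observable of the limit network. Each is at most
    [eta / 4]. *)
Lemma empirical_convergence (eta : R) : 0 < eta ->
  \forall n \near \oo, mean P (fun w => `|empirical_observable n w - limit_mean|) <= eta.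
Proof.
move=> eta0.
have e1 : 0 < (eta / 4) ^+ 2 / 2 by rewrite divr_gt0// exprn_gt0// divr_gt0.
have e40 : 0 < eta / 4 by rewrite divr_gt0.
pose e2 := Num.min (eta / 4) ((eta / 4) ^+ 2 / 2 / 4).
have e20 : 0 < e2 by rewrite lt_min e40 divr_gt0.
have [s se] := locality_error_small T L Mphi_ge0 e20.
have s1 : err s <= eta / 4 by rewrite (le_trans se)// ge_min lexx.
have s2 : 4 * err s <= (eta / 4) ^+ 2 / 2.
  by have : err s <= (eta / 4) ^+ 2 / 2 / 4 by [rewrite (le_trans se)// ge_min lexx orbT]; lra.
pose r := (s + s)%N; pose Delta n := \max_(1 <= u < n.+1) degree (N n) u.
have balls := subpolynomial_balls (Delta := Delta) (r + r) eps_cvg0 max_degree.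
have e3 : 0 < (eta / 4) ^+ 2 / 4 by rewrite divr_gt0// exprn_gt0.
have near_balls : \forall n \near \oo,
    `|0 - ((Delta n).+1 ^ (r + r))%N%:R / n%:R| <= (eta / 4) ^+ 2 / 4.
  exact: (cvgrPdist_le _ _).1 balls _ e3.
have near_weak : \forall n \near \oo,
    `|(\int[nu]_c lmean r c)%R - (\int[U (N n)]_c lmean r c)%R| <= eta / 4.
  have weak := UN_cvg (local_mean_continuous T_gt0 Mphi_ge0 L_ge0 phi_le phi_lip
    psi_lip B_brownian F_bl (r := r)).
  apply: (cvgrPdist_le _ _).1 (weak _) _ e40.
  exists 1; split; first exact: num_real.
  by move=> K K1 c _ /=; rewrite (le_trans _ (ltW K1))//; exact: local_mean_le.
near=> n.
have n0 : (0 < n)%N by near: n; exact: nbhs_infty_gt.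
have E : empirical_observable n = (fun w => n%:R^-1 * \sum_(v <- vs n) var n v w).
  by apply/funext => w; exact: empirical_observableE.
have bE := empirical_observable_bounded n.
set m := mean P (empirical_observable n).
have conc : mean P (fun w => `|empirical_observable n w - m|) <= eta / 4.
  apply: mean_abs_le_sqrt; [by apply: bounded_rvB => //; exact: bounded_rv_cst|exact: ltW|].
  have := @sum_concentration _ _ _ P (vs n) (var n) (fun u => ball_list (N n) u (r + r))
    ((Delta n).+1 ^ (r + r)) (4 * err s).
  rewrite /= vs_size => H; rewrite /m E; apply: (le_trans (H _ _ _ _ _ _ _)) => //.
  - exact: fset_uniq.
  - by rewrite mulr_ge0// locality_error_ge0.
  - by move=> v; split; [exact: ball_list_uniq|apply: ball_list_size; exact: degree_le].
  - move=> u v un vn vu; rewrite /var un vn.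
    apply: (observable_decorrelation T_gt0 Mphi_ge0 L_ge0 phi_le phi_lip psi_lip
      B_brownian F_bl (strong_var un) (strong_var vn)).
    (* Two balls of radius [r] that meet have centers at distance at most [r + r]. *)
    move=> w /component_ball wu /component_ball wv; move/negP: vu; apply.
    by apply/ball_listP; exact: ball_overlap wu wv.
  - have : `|0 - ((Delta n).+1 ^ (r + r))%N%:R / n%:R| <= (eta / 4) ^+ 2 / 4 by near: n.
    rewrite sub0r normrN ger0_norm ?divr_ge0// => H1.
    by move: s2 H1; lra.
have mean_near : `|m - (\int[U (N n)]_c lmean r c)%R| <= err s.
  rewrite U_integral; last first.
    exact: (local_mean_continuous T_gt0 Mphi_ge0 L_ge0 phi_le phi_lip psi_lip B_brownian F_bl).
  rewrite /m E meanZ; last by apply: bounded_rv_sum => v; exact: var_bounded.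
  rewrite mean_sum; last exact: var_bounded.
  rewrite /empirical_mean -/(vs n) vs_size -mulrBr -sumrB.
  apply: average_le; first exact: locality_error_ge0.
  move=> v vn; rewrite /var vn.
  exact: (observable_mean_local T_gt0 Mphi_ge0 L_ge0 phi_le phi_lip psi_lip B_brownian
    F_bl (strong_var vn) s).
have weak : `|(\int[nu]_c lmean r c)%R - (\int[U (N n)]_c lmean r c)%R| <= eta / 4 by near: n.
have lim := limit_mean_local s.
have mc : `|m - limit_mean| <= 3 * (eta / 4).
  set a := (\int[U (N n)]_c lmean r c)%R in mean_near weak.
  set b := (\int[nu]_c lmean r c)%R in weak.
  have lim' : `|b - limit_mean| <= err s by exact: lim.
  move: mean_near weak lim' s1; rewrite !ler_norml.
  by move=> /andP[? ?] /andP[? ?] /andP[? ?] ?; apply/andP; split; lra.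
have b1 : bounded_rv (fun w => `|empirical_observable n w - m|).
  by apply: bounded_rv_norm; apply: bounded_rvB => //; exact: bounded_rv_cst.
apply: (@le_trans _ _ (mean P (fun w => `|empirical_observable n w - m| + 3 * (eta / 4)))).
  apply: mean_le.
  - by apply: bounded_rv_norm; apply: bounded_rvB => //; exact: bounded_rv_cst.
  - by apply: bounded_rvD => //; exact: bounded_rv_cst.
  - by move=> w; rewrite (le_trans (ler_distD m _ _))// lerD2l.
rewrite meanD//; last exact: bounded_rv_cst.
rewrite mean_cst; move: conc; lra.
Unshelve. all: by end_near. Qed.

End Convergence.

(** * The limit of the products *)

Theorem corollary2 (R : realType)
  (psi : R * R -> R) (phi : R * R * R * R -> R) (T : R)
  (psi_lip : lipschitz psi)
  (phi_bounded : bounded_fun phi) (phi_lip : lipschitz phi)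
  (T_gt0 : 0 < T)
  (d : measure_display) (Omega : measurableType d) (P : probability Omega R)
  (B : nat -> R -> Omega -> R) (B_brownian : iid_brownian P B)
  (theta : network R (R * R) -> nat -> Omega -> cpath T)
  (theta_sol : forall N : network R (R * R),
    (exists2 o, vertex N o & nice N o) ->
    strong_solution phi psi P B N (theta N))
  (N : nat -> network R (R * R))
  (vertexN : forall n, vertex (N n) = [set v | (1 <= v <= n)%N])
  (nu : probability (borel (nstar R (R * R))) R)
  (UN_cvg : weak_cvg (fun n => U (N n)) nu)
  (nu_nice : nu (@nice_class R (R * R)) = 1%E)
  (eps : nat -> R) (eps_cvg0 : eps n @[n --> \oo] --> (0 : R))
  (max_degree : \forall n \near \oo,
    (\max_(1 <= v < n.+1) degree (N n) v)%:R = n%:R `^ eps n)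
  (k : nat) (f : 'I_k -> nstar R (R * cpath T) -> R)
  (f_bl : forall i, (bl_norm (f i) <= 1)%E)
  (d' : measure_display) (Omega' : measurableType d')
  (P' : probability Omega' R)
  (X : 'I_k -> Omega' -> borel (nstar R (R * R)))
  (X_iid : iid_law P' nu X) :
  ('E_P[fun w => (\prod_(i < k)
          \int[U (net_theta (N n) (theta (N n)) w)]_x f i x)%R]
     @[n --> \oo] -->
   \prod_(i < k)
     'E_P'[fun w' =>
        let x : rnet R (R * R) := repr (X i w' : nstar R (R * R)) in
        fine 'E_P[fun w => f i (nclass (rnet_theta x (theta x) w))]])%E.
Proof.
have [Kphi Kphi0 phiK] := lipschitz_coordinates4 phi_lip.
have [Kpsi Kpsi0 psiK] := lipschitz_coordinates2 psi_lip.
have [Mphi Mphi0 phiM] := pinfty_ex_gt0 phi_bounded.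
have phi_le p : `|phi p| <= Mphi by exact: phiM.
pose L := Kphi + Kpsi.
have L0 : 0 <= L by rewrite addr_ge0.
have phiL a b c e a' b' c' e' (D : R) : `|a - a'| <= D -> `|b - b'| <= D ->
    `|c - c'| <= D -> `|e - e'| <= D ->
    `|phi (a, b, c, e) - phi (a', b', c', e')| <= L * D.
  move=> aD bD cD eD; apply: (le_trans (phiK _ _ _ _ _ _ _ _ _ aD bD cD eD)).
  by rewrite ler_wpM2r ?(le_trans _ aD)// lerDl.
have psiL a b a' b' (D : R) : `|a - a'| <= D -> `|b - b'| <= D ->
    `|psi (a, b) - psi (a', b')| <= L * D.
  move=> aD bD; apply: (le_trans (psiK _ _ _ _ _ aD bD)).
  by rewrite ler_wpM2r ?(le_trans _ aD)// lerDr.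
pose c i := limit_mean P theta (f i) nu.
have [mX lawX _] := X_iid.
have -> : (\prod_(i < k) 'E_P'[fun w' =>
    let x : rnet R (R * R) := repr (X i w' : nstar R (R * R)) in
    fine 'E_P[fun w => f i (nclass (rnet_theta x (theta x) w))]] =
    (\prod_(i < k) c i)%:E)%E.
  rewrite -prodEFin; apply: eq_bigr => i _.
  (* Only here does the law of [X i] enter: the inner expectation is [class_mean] of
     the class [X i w']. *)
  rewrite -(limit_mean_expectation T_gt0 (ltW Mphi0) L0 phi_le phiL psiL B_brownian
    theta_sol (f_bl i) nu_nice (mX i) (lawX i)).
  congr ('E_P'[_])%E; apply/funext => w'.
  by rewrite /= /class_mean /mean /Rintegral unlock.
pose Y n i := empirical_observable theta (f i) N n.
have bY n i : bounded_rv (Y n i).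
  exact: (empirical_observable_bounded T_gt0 B_brownian theta_sol (f_bl i) vertexN).
have Y1 n i w : `|Y n i w| <= 1.
  exact: (empirical_observable_le theta (f_bl i) vertexN).
have c1 i : `|c i| <= 1.
  exact: (limit_mean_le T_gt0 (ltW Mphi0) L0 phi_le phiL psiL B_brownian
    theta_sol (f_bl i) nu_nice).
have -> : (fun n => 'E_P[fun w => (\prod_(i < k)
      \int[U (net_theta (N n) (theta (N n)) w)]_x f i x)%R])%E =
    (fun n => (mean P (fun w => \prod_(i < k) Y n i w))%:E).
  apply/funext => n; rewrite -mean_expectation//.
  by apply: bounded_rv_prod.
apply: cvg_EFin; first by exact: nearW.
apply/cvgrPdist_le => eta eta0.
have ek : 0 < eta / k.+1%:R by rewrite divr_gt0.
have conv : \forall n \near \oo, forall i, mean P (fun w => `|Y n i w - c i|) <= eta / k.+1%:R.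
  apply: filter_forall => i.
  exact: (empirical_convergence T_gt0 (ltW Mphi0) L0 phi_le phiL psiL B_brownian
    theta_sol (f_bl i) nu_nice vertexN UN_cvg eps_cvg0 max_degree ek).
near=> n.
have bP : bounded_rv (fun w => \prod_(i < k) Y n i w) by exact: bounded_rv_prod.
have bC : bounded_rv (fun _ : Omega => \prod_(i < k) c i) by exact: bounded_rv_cst.
have bd i : bounded_rv (fun w => `|Y n i w - c i|).
  by apply: bounded_rv_norm; apply: bounded_rvB => //; exact: bounded_rv_cst.
rewrite /= distrC -(mean_cst P (\prod_(i < k) c i)) -meanB//.
rewrite (le_trans (mean_norm P (bounded_rvB bP bC)))//.
apply: (@le_trans _ _ (mean P (fun w => \sum_(i < k) `|Y n i w - c i|))).
  apply: mean_le; [exact: bounded_rv_norm (bounded_rvB bP bC)|exact: bounded_rv_sum|].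
  by move=> w; exact: prod_dist.
rewrite mean_sum//; apply: (@le_trans _ _ (\sum_(i < k) (eta / k.+1%:R))).
  by apply: ler_sum => i _; move: i; near: n.
rewrite sumr_const card_ord -[_ *+ k]mulr_natl mulrCA.
rewrite ler_piMr ?(ltW eta0)// ler_pdivrMr// mul1r ler_nat.
by rewrite leqnSn.
Unshelve. all: by end_near. Qed.
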